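(* Let $1+\frac{4}{N_\gamma}\le p<\frac{N_\gamma+2}{N_\gamma-2}$ and let $u\in H^{1,2}_\gamma(\mathbb{R}^{N+l}_+)\cap C^0(\overline{\mathbb{R}^{N+l}_+})$ be a solution of $$-\Delta_\gamma u=u^p,\quad u>0\ \text{ in }\mathbb{R}^{N+l}_+,\qquad u=0\ \text{ on }\partial\mathbb{R}^{N+l}_+ .$$ If $u$ is bounded in $\mathbb{R}^{N+l}_+$, then $u\equiv 0$.
   Context: $N,l\ge 1$ are integers with $N+l\ge 3$, $\gamma>0$ is real, and points of $\mathbb{R}^{N+l}$ are written $z=(x,y)$ with $x\in\mathbb{R}^N$, $y=(y_1,\dots,y_l)\in\mathbb{R}^l$. The half space is $\mathbb{R}^{N+l}_+=\{z=(x,y)\in\mathbb{R}^{N+l}: y_l>0\}$. The homogeneous dimension is $N_\gamma=N+(1+\gamma)l$. The Grushin operator is $\Delta_\gamma u=\Delta_x u+|x|^{2\gamma}\Delta_y u$, and $\nabla_\gamma=(\partial_{x_1},\dots,\partial_{x_N},|x|^\gamma\partial_{y_1},\dots,|x|^\gamma\partial_{y_l})$. For an open set $\Omega$, $H^{1,2}_\gamma(\Omega)$ is the space of $u\in L^2(\Omega)$ with weak derivatives $\partial_{x_i}u\in L^2(\Omega)$ and $|x|^\gamma\partial_{y_j}u\in L^2(\Omega)$ for all $i,j$. Solutions are understood in the weak sense: $\int\nabla_\gamma u\cdot\nabla_\gamma\varphi\,dz=\int u^p\varphi\,dz$ for all $\varphi\in C_c^\infty(\mathbb{R}^{N+l}_+)$,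 with the boundary condition holding pointwise. Since the problem includes $u>0$, the conclusion $u\equiv 0$ is a nonexistence statement. *)

(* Defs.v *)
From HB Require Import structures.
From mathcomp Require Import all_boot all_order all_algebra.
From mathcomp Require Import all_classical all_reals all_analysis.

Set Implicit Arguments.
Unset Strict Implicit.
Unset Printing Implicit Defensive.

Import Order.TTheory GRing.Theory Num.Theory.
Import numFieldNormedType.Exports.

Local Open Scope classical_set_scope.
Local Open Scope ring_scope.

(* The Borel sigma-algebra of R^n, presented as the product sigma-algebra,
   exactly as the library does for [n.-tuple T]. *)
Section measurable_rV.
Context (R : realType) (n : nat).

Let coor : 'I_n -> 'rV[R]_n -> R := fun i v => v 0 i.

Let rV_set0 : g_sigma_preimage coor set0.
Proof. exact: sigma_algebra0. Qed.

Let rV_setC A : g_sigma_preimage coor A -> g_sigma_preimage coor (~` A).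
Proof. exact: sigma_algebraC. Qed.

Let rV_bigcup (F : (set 'rV[R]_n)^nat) :
  (forall i, g_sigma_preimage coor (F i)) ->
  g_sigma_preimage coor (\bigcup_i (F i)).
Proof. exact: sigma_algebra_bigcup. Qed.

HB.instance Definition _ := @isMeasurable.Build default_measure_display
  'rV[R]_n (g_sigma_preimage coor) rV_set0 rV_setC rV_bigcup.

Lemma measurable_coor (i : 'I_n) :
  measurable_fun [set: 'rV[R]_n] (fun v : 'rV[R]_n => v 0 i).
Proof.
move=> _ Y mY; rewrite setTI; apply: sub_sigma_algebra => /=.
rewrite -bigcup_seq/=; exists i => /=; first by rewrite mem_index_enum.
by exists Y => //; rewrite setTI.
Qed.

Lemma measurable_fun_rV d (T : measurableType d) (f : T -> 'rV[R]_n) :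
  (forall i, measurable_fun [set: T] (fun t => f t 0 i)) ->
  measurable_fun [set: T] f.
Proof.
move=> mf _ A; rewrite setTI => mA.
pose S := [set B : set 'rV[R]_n | measurable (f @^-1` B)].
suff: S A by [].
move: A mA; apply: smallest_sub.
  split => [|B SB|F SF]; rewrite /S/=.
  - by rewrite preimage_set0.
  - by rewrite setTD preimage_setC; exact: measurableC.
  - by rewrite preimage_bigcup; apply: bigcupT_measurable.
move=> A; rewrite -bigcup_seq => -[i _ [B mB <-]].
by rewrite /S/= setTI -[X in measurable X]setTI; exact: mf.
Qed.

End measurable_rV.

(* R^(n+1) as R x R^n, along the first coordinate *)
Definition row_cons (R : realType) n (q : R * 'rV[R]_n) : 'rV[R]_n.+1 :=
  \row_i if unlift ord0 i is Some j then q.2 0 j else q.1.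

Definition row_uncons (R : realType) n (v : 'rV[R]_n.+1) : R * 'rV[R]_n :=
  (v 0 ord0, \row_j v 0 (lift ord0 j)).

Lemma row_consK (R : realType) n : cancel (@row_cons R n) (@row_uncons R n).
Proof.
move=> [a v]; rewrite /row_cons /row_uncons/= mxE unlift_none; congr pair.
by apply/rowP => j; rewrite !mxE liftK.
Qed.

Lemma measurable_row_cons (R : realType) n :
  measurable_fun [set: R * 'rV[R]_n] (@row_cons R n).
Proof.
apply: measurable_fun_rV => i; rewrite /row_cons/=.
case: (unliftP ord0 i) => [j ->|->].
  rewrite (_ : (fun _ => _) = (fun v : 'rV[R]_n => v 0 j) \o snd).
    by apply: measurableT_comp => //; exact: measurable_coor.
  by apply/funext => q/=; rewrite mxE liftK.
rewrite (_ : (fun _ => _) = fst) //.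
by apply/funext => q/=; rewrite mxE unlift_none.
Qed.

Lemma measurable_row_uncons (R : realType) n :
  measurable_fun [set: 'rV[R]_n.+1] (@row_uncons R n).
Proof.
apply: measurable_fun_pair; first exact: measurable_coor.
apply: measurable_fun_rV => j.
rewrite (_ : (fun _ => _) = (fun v : 'rV[R]_n.+1 => v 0 (lift ord0 j))).
  exact: measurable_coor.
by apply/funext => v; rewrite mxE.
Qed.

Section lebesgue_rV_step.
Context (R : realType) (n : nat).
Variable mu : {sigma_finite_measure set 'rV[R]_n -> \bar R}.

Definition lebesgue_rV_step : set 'rV[R]_n.+1 -> \bar R :=
  pushforward ((@lebesgue_measure R) \x mu)%E (@row_cons R n).

Let mpre (A : set 'rV[R]_n.+1) :
  measurable A -> measurable (@row_cons R n @^-1` A).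
Proof.
by move=> mA; rewrite -[X in measurable X]setTI; exact: measurable_row_cons.
Qed.

Let step0 : lebesgue_rV_step set0 = 0%E.
Proof. by rewrite /lebesgue_rV_step /pushforward preimage_set0 measure0. Qed.

Let step_ge0 A : (0 <= lebesgue_rV_step A)%E.
Proof. by rewrite /lebesgue_rV_step /pushforward; exact: measure_ge0. Qed.

Let step_sigma_additive : semi_sigma_additive lebesgue_rV_step.
Proof.
move=> F mF tF mUF; rewrite /lebesgue_rV_step /pushforward preimage_bigcup.
apply: measure_semi_sigma_additive.
- by move=> k; exact: mpre.
- apply/trivIsetP => /= i j _ _ ij; rewrite -preimage_setI.
  by move/trivIsetP : tF => /(_ _ _ _ _ ij) ->//; rewrite preimage_set0.
- by rewrite -preimage_bigcup; exact: mpre.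
Qed.

HB.instance Definition _ := isMeasure.Build _ _ _ lebesgue_rV_step
  step0 step_ge0 step_sigma_additive.

Let step_sigma_finite : sigma_finite setT lebesgue_rV_step.
Proof.
have /sigma_finiteP[F [TF ndF Foo]] := sigma_finiteT (@lebesgue_measure R).
have /sigma_finiteP[G [TG ndG Goo]] := sigma_finiteT mu.
exists (fun k => @row_uncons R n @^-1` (F k `*` G k)).
  rewrite -preimage_bigcup -[LHS](preimage_setT (@row_uncons R n)).
  congr preimage; rewrite -setXTT TF TG predeqE => -[x y]; split.
    move=> [/= [i _ Fix] [k _ Gky]]; exists (maxn i k) => //; split.
    - by move: x Fix; exact/subsetPset/ndF/leq_maxl.
    - by move: y Gky; exact/subsetPset/ndG/leq_maxr.
  by move=> [k _ []/= ? ?]; split; exists k.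
move=> k; have [mFk Fkoo] := Foo k; have [mGk Gkoo] := Goo k; split.
  by rewrite -[X in measurable X]setTI; apply: measurable_row_uncons => //;
    exact: measurableX.
rewrite /lebesgue_rV_step /pushforward -comp_preimage.
rewrite (_ : _ \o _ = id) ?preimage_id; last first.
  by apply/funext => q; rewrite /comp row_consK.
by rewrite product_measure1E// lte_mul_pinfty// ge0_fin_numE.
Qed.

HB.instance Definition _ := Measure_isSigmaFinite.Build _ _ _
  lebesgue_rV_step step_sigma_finite.

End lebesgue_rV_step.

Fixpoint lebesgue_rV (R : realType) (n : nat) :
    {sigma_finite_measure set 'rV[R]_n -> \bar R} :=
  match n with
  | 0 => \d_(0 : 'rV[R]_0)
  | n'.+1 => lebesgue_rV_step (lebesgue_rV R n')
  end.

Section grushin.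
Context (R : realType) (N l : nat).

(* R^(N+l), whose points are z = (x, y) = (z.1, z.2) *)
Local Notation space := ('rV[R]_N * 'rV[R]_l)%type.
Implicit Types (z v : space) (O : set space) (u phi : space -> R).
Implicit Types (gamma p : R).

Definition lebesgue_space : {measure set space -> \bar R} :=
  (lebesgue_rV R N \x lebesgue_rV R l)%E.

(* The norm of the library on ['rV_N] is the sup norm. *)
Definition euclidean_norm n (x : 'rV[R]_n) : R :=
  Num.sqrt (\sum_(i < n) x 0 i ^+ 2).

Definition dot v z : R :=
  \sum_(i < N) v.1 0 i * z.1 0 i + \sum_(j < l) v.2 0 j * z.2 0 j.

Definition hom_dim gamma : R := N%:R + (1 + gamma) * l%:R.

(* [s] lists the successive directions of differentiation *)
Definition iter_derive (s : seq space) phi : space -> R :=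
  foldr (fun v f => fun z => 'D_v f z) phi s.

Definition smooth phi := forall s z, differentiable (iter_derive s phi) z.

Definition test_function O phi :=
  [/\ smooth phi, compact (closure [set z | phi z != 0]) &
      closure [set z | phi z != 0] `<=` O].

Definition dx (i : 'I_N) phi : space -> R := 'D_(delta_mx 0 i, 0) phi.
Definition dy (j : 'I_l) phi : space -> R := 'D_(0, delta_mx 0 j) phi.

Definition grushin_grad gamma phi z : space :=
  (\row_i dx i phi z, \row_j (euclidean_norm z.1 `^ gamma * dy j phi z)).

Definition L2 O u := u \_ O \in Lfun lebesgue_space 2%:E.

(* [G] is the gradient (d_x u, |x|^gamma d_y u) of [u] on [O] in the sense of
   distributions, with all components in L^2(O).  The fields
   |x|^gamma d_(y_j) are skew-adjoint, as |x|^gamma does not depend on y.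
   Only the product |x|^gamma d_(y_j) u has to be a function: d_(y_j) u alone
   need not be locally integrable across x = 0. *)
Definition weak_grushin_grad gamma O u (G : space -> space) :=
  [/\ forall i : 'I_N, L2 O (fun z => (G z).1 0 i),
      forall j : 'I_l, L2 O (fun z => (G z).2 0 j),
      forall phi, test_function O phi -> forall i : 'I_N,
        \int[lebesgue_space]_(z in O) (u z * (grushin_grad gamma phi z).1 0 i)
        = - \int[lebesgue_space]_(z in O) ((G z).1 0 i * phi z) &
      forall phi, test_function O phi -> forall j : 'I_l,
        \int[lebesgue_space]_(z in O) (u z * (grushin_grad gamma phi z).2 0 j)
        = - \int[lebesgue_space]_(z in O) ((G z).2 0 j * phi z)].

Definition H12 gamma O u :=
  L2 O u /\ exists G, weak_grushin_grad gamma O u G.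

(* - Delta_gamma u = f in O, in the weak sense *)
Definition weak_solution gamma O u (f : space -> R) :=
  exists2 G, weak_grushin_grad gamma O u G &
    forall phi, test_function O phi ->
      \int[lebesgue_space]_(z in O) dot (G z) (grushin_grad gamma phi z)
      = \int[lebesgue_space]_(z in O) (f z * phi z).

Definition last_index (hl : (1 <= l)%N) : 'I_l :=
  Ordinal (etrans (ltn_predL l) hl).

Definition half_space (hl : (1 <= l)%N) : set space :=
  [set z : space | 0 < z.2 0 (last_index hl)].

Definition boundary O := closure O `\` O°.

Definition positive_solution gamma p O u :=
  [/\ weak_solution gamma O u (fun z => u z `^ p),
      forall z, O z -> 0 < u z &
      forall z, boundary O z -> u z = 0].

End grushin.

(* Main.v *)
Require Import Defs.
From HB Require Import structures.
From mathcomp Require Import all_boot all_order all_algebra.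
From mathcomp Require Import all_classical all_reals all_analysis.
From mathcomp Require Import measurable_realfun ring lra.

Set Implicit Arguments.
Unset Strict Implicit.
Unset Printing Implicit Defensive.

Import Order.TTheory GRing.Theory Num.Theory.
Import numFieldNormedType.Exports.

Local Open Scope classical_set_scope.
Local Open Scope ring_scope.

(** Why a bounded positive solution cannot exist.

    Let [U] be the solution extended by [0] below the boundary, [g i] and [k j]
    the components of its gradient extended in the same way, and [L] a
    Lipschitz-type constant of [t `^ p] on the range of [U]. The operator is
    invariant under translations in [y], so [U] can be compared with
    [U_h z = U (z - h e_l)], the same function pushed into the half space. As
    [U_h] vanishes in a strip along the boundary, it is an admissible test
    function ([pairing_shift]); letting [h] tend to [0], so is [U]
    ([energy_identity]). Consequently the squared L2 norm of the increment of the
    gradient is [2 * \int U `^ p * (U - U_h)] ([energy_shift]). Young's inequality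
    gives [\int U_h `^ p * (U - U_h) <= 0], because [U `^ p * U] and its translate
    have the same integral, and therefore the norm is at most [2 * L * \int (U - U_h) ^ 2]
    ([power_translate_le]).

    The last integral is of order [h ^ 2] ([shift_estimate]). Where [x] stays away
    from [0], the weighted derivative in [y_l] controls the increment of [U].
    Where [x] is small, [U - U_h] is compared with its value at a point moved by a
    small step [d] in [x]; this costs [d ^ 2] times the norm of the increment of
    the gradient, which the previous paragraph absorbs in the left-hand side.

    So the increment of the gradient is of order [h] in L2. In the strip
    [0 < y_l < h] the gradient of [U_h] is zero, hence the flux of [U] itself is
    of order [h] there ([strip_estimate]): the normal derivative vanishes on the
    boundary in the mean, which contradicts the Hopf lemma. The contradiction is
    made explicit in two steps. A test function that does not vanish on the
    boundary may be cut off at distance [1 / c] from it: the error is bounded by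
    means of the flux in the strip, and tends to [0]. Thus [U] solves the
    equation across the boundary ([extended_equation]). A hump centred below
    the boundary is subharmonic in the half space, so that
    [\int U `^ p * phi = - \int U * Lap phi <= 0], whereas the left-hand side is
    positive ([barrier_contradiction]).

    Three technical points. The test functions are taken in an explicit algebra
    that is closed under differentiation ([elem]), with density in L2 obtained
    from the monotone class theorem ([density]). The weight [|x| ^ gamma]
    degenerates on [x = 0], where [d_(y_j) U] need not be a function, so testing
    the equation against [U_h] requires a mollification that is much finer in
    [x] than in [y], for which the commutator with the weight is small
    ([pairing_bounded]). Finally, [U] has weak derivatives on the whole space
    because its boundary values are zero, uniformly on bounded sets
    ([wder_zero_extension]). *)

(** * Square-integrable functions *)

Lemma cvgn_eq (R : realType) (u v : nat -> R) (x y : R) : (forall n, u n = v n) ->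
  u @ \oo --> x -> v @ \oo --> y -> x = y.
Proof.
move=> /funext -> cx cy.
by rewrite -(cvg_lim _ cx)// -(cvg_lim _ cy).
Qed.

Lemma cvgn_sum (R : realType) (I : finType) (F : I -> nat -> R) (l : I -> R) :
  (forall i, F i @ \oo --> l i) ->
  (fun n => \sum_i F i n) @ \oo --> \sum_i l i.
Proof.
move=> h; elim: (index_enum I) => [|i r IH].
  by under eq_fun do rewrite big_nil; rewrite big_nil; exact: cvg_cst.
by under eq_fun do rewrite big_cons; rewrite big_cons; exact: cvgD.
Qed.

Lemma cvgn_shiftS (R : realType) (u : nat -> R) (l : R) :
  (fun n => u n.+1) @ \oo --> l -> u @ \oo --> l.
Proof. by move=> h; have <- := cvg_shiftS u (nbhs l). Qed.

Lemma cvgn_le (R : realType) (a : nat -> R) (l M : R) :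
  a @ \oo --> l -> (forall n, a n <= M) -> l <= M.
Proof.
move=> al aM; rewrite -(cvg_lim _ al)//; apply: limr_le; last exact: nearW.
by apply/cvg_ex; exists l.
Qed.

Lemma le_cvgn (R : realType) (a b : nat -> R) (l m : R) :
  a @ \oo --> l -> b @ \oo --> m -> (forall n, a n <= b n) -> l <= m.
Proof.
move=> al bm ab; rewrite -subr_ge0 -(opprK (m - l)) oppr_ge0 opprB.
by apply: (@cvgn_le _ (fun n => a n - b n)) => [|n]; [exact: cvgB|rewrite subr_le0].
Qed.

Section square_integrable.
Context d (T : measurableType d) (R : realType).
Variable mu : {measure set T -> \bar R}.
Implicit Types (f g h : T -> R) (s t : R).

(** Integrability of real-valued functions on the whole space, so that neither
    domains nor extended reals appear in the estimates. *)
Definition integ f := mu.-integrable setT (EFin \o f).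

Lemma integ_meas f : integ f -> measurable_fun setT f.
Proof. by move=> /measurable_int /measurable_EFinP. Qed.

Lemma integD f g : integ f -> integ g -> integ (fun x => f x + g x).
Proof. by move=> hf hg; exact: (integrableD _ hf hg). Qed.

Lemma integB f g : integ f -> integ g -> integ (fun x => f x - g x).
Proof. by move=> hf hg; exact: (integrableB _ hf hg). Qed.

Lemma integZ t f : integ f -> integ (fun x => t * f x).
Proof. by move=> hf; exact: (integrableZl _ _ hf). Qed.

Lemma integ0 : integ (fun=> 0).
Proof. exact: integrable0. Qed.

Lemma integ_sum (I : finType) (F : I -> T -> R) :
  (forall i, integ (F i)) -> integ (fun x => \sum_i F i x).
Proof.
move=> hF; rewrite (_ : (fun x => _) = \sum_i F i); last first.
  by apply/funext => x; rewrite fct_sumE.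
elim/big_ind: _ => //; first exact: integ0.
by move=> f g hf hg; exact: integD hf hg.
Qed.

Lemma integ_le f g : measurable_fun setT f -> integ g ->
  (forall x, `|f x| <= g x) -> integ f.
Proof.
move=> mf hg fg; apply: le_integrable hg => //; first exact/measurable_EFinP.
by move=> x _ /=; rewrite lee_fin (le_trans (fg x))// ler_norm.
Qed.

Lemma integ_norm f : integ f -> integ (fun x => `|f x|).
Proof. by move=> /integrable_norm. Qed.

Lemma RintD f g : integ f -> integ g ->
  \int[mu]_x (f x + g x) = \int[mu]_x f x + \int[mu]_x g x.
Proof. by move=> hf hg; exact: RintegralD. Qed.

Lemma RintB f g : integ f -> integ g ->
  \int[mu]_x (f x - g x) = \int[mu]_x f x - \int[mu]_x g x.
Proof. by move=> hf hg; exact: RintegralB. Qed.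

Lemma RintZ t f : integ f -> \int[mu]_x (t * f x) = t * \int[mu]_x f x.
Proof. by move=> hf; exact: RintegralZl. Qed.

Lemma RintN f : integ f -> \int[mu]_x (- f x) = - \int[mu]_x f x.
Proof.
by move=> hf; rewrite -mulN1r -RintZ//; apply: eq_Rintegral => x _; rewrite mulN1r.
Qed.

Lemma Rint_sum (I : finType) (F : I -> T -> R) : (forall i, integ (F i)) ->
  \int[mu]_x (\sum_i F i x) = \sum_i \int[mu]_x F i x.
Proof.
move=> hF; elim: (index_enum I) => [|i r IH].
  rewrite big_nil; under eq_Rintegral do rewrite big_nil.
  by rewrite Rintegral_cst// mul0r.
rewrite big_cons -IH -RintD//.
  by apply: eq_Rintegral => x _; rewrite big_cons.
rewrite (_ : (fun x => _) = \sum_(j <- r) F j); last first.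
  by apply/funext => x; rewrite fct_sumE.
elim/big_ind: _ => //; first exact: integ0.
by move=> f g hf hg; exact: integD hf hg.
Qed.

Lemma Rint_le f g : integ f -> integ g -> (forall x, f x <= g x) ->
  \int[mu]_x f x <= \int[mu]_x g x.
Proof. by move=> hf hg fg; apply: le_Rintegral. Qed.

Lemma Rint_ge0 f : (forall x, 0 <= f x) -> 0 <= \int[mu]_x f x.
Proof. by move=> f0; apply: Rintegral_ge0. Qed.

Lemma Rint0 : \int[mu]_(x in setT) (0:R) = 0.
Proof. by rewrite Rintegral_cst// mul0r. Qed.

Lemma Rint_abs_le f g : integ f -> integ g -> (forall x, `|f x| <= g x) ->
  `|\int[mu]_x f x| <= \int[mu]_x g x.
Proof.
move=> hf hg fg; rewrite (le_trans (le_normr_Rintegral _ hf))//.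
apply: Rint_le => //; apply: (@integ_le _ g) => //.
- by apply: measurableT_comp => //; exact: integ_meas.
- by move=> x; rewrite normr_id.
Qed.

Lemma Rdct (f_ : nat -> T -> R) f g : (forall n, measurable_fun setT (f_ n)) ->
  (forall x, f_ ^~ x @ \oo --> f x) -> integ g ->
  (forall n x, `|f_ n x| <= g x) ->
  integ f /\ (fun n => \int[mu]_x f_ n x) @ \oo --> \int[mu]_x f x.
Proof.
move=> mf_ f_f ig fg.
have mf : measurable_fun setT f by apply: measurable_fun_cvg mf_ _ => x _; exact: f_f.
have [||||i0 _ c] :=
  @dominated_convergence _ T R mu setT measurableT (fun n => EFin \o f_ n) (EFin \o f) (EFin \o g) _ _ _ ig.
- by move=> n; exact/measurable_EFinP.
- exact/measurable_EFinP.
- by apply: aeW => x _; apply: cvg_EFin; [exact: nearW | exact: f_f].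
- by apply: aeW => x n _; rewrite /= lee_fin; exact: fg.
split => //; move: c.
rewrite -(fineK (integrable_fin_num measurableT i0)) => /fine_cvgP[_].
exact.
Qed.

Definition l2 f := measurable_fun setT f /\ integ (fun x => f x ^+ 2).

Definition nsq f := \int[mu]_x (f x ^+ 2).

Definition ip f g := \int[mu]_x (f x * g x).

Lemma nsq_ge0 f : 0 <= nsq f.
Proof. by apply: Rint_ge0 => x; exact: sqr_ge0. Qed.

Lemma l2_le f g : measurable_fun setT f -> l2 g ->
  (forall x, `|f x| <= `|g x|) -> l2 f.
Proof.
move=> mf [mg ig] fg; split=> //; apply: (integ_le _ ig).
  exact: measurable_funX.
by move=> x; rewrite normrX -[leRHS]real_normK ?num_real// ler_sqr ?nnegrE// normr_ge0.
Qed.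

Lemma nsq_le f g : l2 f -> l2 g -> (forall x, `|f x| <= `|g x|) ->
  nsq f <= nsq g.
Proof.
move=> [mf i1] [mg i2] fg; apply: Rint_le => // x.
by rewrite -[leLHS]real_normK ?num_real// -[leRHS]real_normK ?num_real// ler_sqr ?nnegrE.
Qed.

Lemma young_sq (x y t : R) : 0 < t -> `|x * y| <= 2^-1 * (t * x ^+ 2 + t^-1 * y ^+ 2).
Proof.
move=> t0; have t1 : t * t^-1 = 1 by rewrite mulfV// gt_eqF.
have ti : 0 < t^-1 by rewrite invr_gt0.
rewrite ler_norml; apply/andP; split.
  have : 0 <= t^-1 * (t * x + y) ^+ 2 by rewrite mulr_ge0 ?sqr_ge0// ltW.
  have -> : t^-1 * (t * x + y) ^+ 2 = (t * t^-1) * t * x ^+ 2 + 2 * (t * t^-1) * (x * y) + t^-1 * y ^+ 2 by ring.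
  rewrite t1; lra.
have : 0 <= t^-1 * (t * x - y) ^+ 2 by rewrite mulr_ge0 ?sqr_ge0// ltW.
have -> : t^-1 * (t * x - y) ^+ 2 = (t * t^-1) * t * x ^+ 2 - 2 * (t * t^-1) * (x * y) + t^-1 * y ^+ 2 by ring.
rewrite t1; lra.
Qed.

Lemma l2M f g : l2 f -> l2 g -> integ (fun x => f x * g x).
Proof.
move=> [mf i1] [mg i2]; apply: (integ_le _ (integZ 2^-1 (integD (integZ 1 i1) (integZ 1^-1 i2)))).
  exact: measurable_funM.
by move=> x; exact: young_sq.
Qed.

Lemma l2Z t f : l2 f -> l2 (fun x => t * f x).
Proof.
move=> [mf i1]; split; first exact: measurable_funM.
by under eq_fun do rewrite exprMn; exact: integZ.
Qed.

Lemma l2D f g : l2 f -> l2 g -> l2 (fun x => f x + g x).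
Proof.
move=> hf hg; have [mf i1] := hf; have [mg i2] := hg.
split; first exact: measurable_funD.
rewrite (_ : (fun x => _) = fun x => f x ^+ 2 + (2 * (f x * g x) + g x ^+ 2)).
  by apply: integD => //; apply: integD => //; apply: integZ; exact: l2M.
by apply/funext => x; ring.
Qed.

Lemma l2_norm f : l2 f -> l2 (fun x => `|f x|).
Proof.
move=> [mf i2]; split; first exact: measurableT_comp.
rewrite (_ : (fun x => _) = fun x => f x ^+ 2)//.
by apply/funext => x; rewrite real_normK ?num_real.
Qed.

Lemma nsq_norm f : nsq (fun x => `|f x|) = nsq f.
Proof. by apply: eq_Rintegral => x _; rewrite real_normK ?num_real. Qed.

Lemma l2N f : l2 f -> l2 (fun x => - f x).
Proof. by move=> hf; under eq_fun do rewrite -mulN1r; exact: l2Z. Qed.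

Lemma l2B f g : l2 f -> l2 g -> l2 (fun x => f x - g x).
Proof. by move=> hf hg; apply: l2D => //; exact: l2N. Qed.

Lemma l2_bM (C : R) f g : measurable_fun setT f -> (forall x, `|f x| <= C) -> l2 g ->
  l2 (fun x => f x * g x).
Proof.
move=> mf fC hg; apply: (@l2_le _ (fun x => C * g x)).
- by case: hg => mg _; exact: measurable_funM.
- exact: l2Z.
- by move=> x; rewrite !normrM ler_wpM2r// (le_trans (fC x))// ler_norm.
Qed.

Lemma ipC f g : ip f g = ip g f.
Proof. by apply: eq_Rintegral => x _; rewrite mulrC. Qed.

Lemma ip_nsq f : ip f f = nsq f.
Proof. by apply: eq_Rintegral => x _; rewrite expr2. Qed.

Lemma ipDl f g h : l2 f -> l2 g -> l2 h ->
  ip (fun x => f x + g x) h = ip f h + ip g h.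
Proof.
move=> hf hg hh; rewrite /ip -RintD; [|exact: l2M|exact: l2M].
by apply: eq_Rintegral => x _; rewrite mulrDl.
Qed.

Lemma ipZl t f g : l2 f -> l2 g -> ip (fun x => t * f x) g = t * ip f g.
Proof.
move=> hf hg; rewrite /ip -RintZ; last exact: l2M.
by apply: eq_Rintegral => x _; rewrite mulrA.
Qed.

Lemma ipBl f g h : l2 f -> l2 g -> l2 h ->
  ip (fun x => f x - g x) h = ip f h - ip g h.
Proof.
move=> hf hg hh; rewrite /ip -RintB; [|exact: l2M|exact: l2M].
by apply: eq_Rintegral => x _; rewrite mulrBl.
Qed.

Lemma ipBr f g h : l2 f -> l2 g -> l2 h ->
  ip h (fun x => f x - g x) = ip h f - ip h g.
Proof. by move=> hf hg hh; rewrite ![ip h _]ipC ipBl. Qed.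

Lemma nsqB f g : l2 f -> l2 g ->
  nsq (fun x => f x - g x) = nsq f - 2 * ip f g + nsq g.
Proof.
move=> hf hg; rewrite /nsq /ip -RintZ; last exact: l2M.
have [[_ f2] [_ g2]] := (hf, hg).
rewrite -RintB//; last by apply: integZ; exact: l2M.
rewrite -RintD//; last by apply: integB => //; apply: integZ; exact: l2M.
by apply: eq_Rintegral => x _; ring.
Qed.

Lemma nsqD_le f g : l2 f -> l2 g ->
  nsq (fun x => f x + g x) <= 2 * nsq f + 2 * nsq g.
Proof.
move=> hf hg; have [[_ f2] [_ g2]] := (hf, hg).
rewrite /nsq -!RintZ// -RintD; [|exact: integZ|exact: integZ].
apply: Rint_le; [by case: (l2D hf hg)|by apply: integD; exact: integZ|].
move=> x; have : 0 <= (f x - g x) ^+ 2 := sqr_ge0 _.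
rewrite !expr2; lra.
Qed.

Lemma nsqZ t f : l2 f -> nsq (fun x => t * f x) = t ^+ 2 * nsq f.
Proof.
move=> [_ f2]; rewrite /nsq -RintZ//.
by apply: eq_Rintegral => x _; rewrite exprMn.
Qed.

Lemma nsqN f : nsq (fun x => - f x) = nsq f.
Proof. by apply: eq_Rintegral => x _; rewrite sqrrN. Qed.

Lemma nsqBC f g : nsq (fun x => f x - g x) = nsq (fun x => g x - f x).
Proof. by rewrite -nsqN; apply: eq_Rintegral => x _; rewrite opprB. Qed.

Lemma ip_young t f g : 0 < t -> l2 f -> l2 g ->
  `|ip f g| <= 2^-1 * (t * nsq f + t^-1 * nsq g).
Proof.
move=> t0 hf hg; have [[_ f2] [_ g2]] := (hf, hg).
rewrite /nsq -!RintZ// -RintD; [|exact: integZ|exact: integZ].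
rewrite -RintZ; last by apply: integD; exact: integZ.
apply: Rint_abs_le; [exact: l2M|by apply: integZ; apply: integD; exact: integZ|].
by move=> x; exact: young_sq.
Qed.

Lemma integ_indic A : measurable A -> (mu A < +oo)%E -> integ (\1_A).
Proof.
move=> mA muA; apply/integrableP; split; first exact/measurable_EFinP.
rewrite (eq_integral (fun x => (\1_A x)%:E)); last first.
  by move=> t _; rewrite gee0_abs// lee_fin.
by rewrite integral_indic// setIT.
Qed.

Lemma l2_indic A : measurable A -> (mu A < +oo)%E -> l2 (\1_A).
Proof.
move=> mA muA; split; first exact: measurable_indic.
rewrite (_ : (fun x => _) = \1_A); first exact: integ_indic.
by apply/funext => x; rewrite indicE; case: (_ \in _); rewrite ?expr1n ?expr0n.
Qed.

Lemma l2_bounded_support (C : R) A f : measurable A -> (mu A < +oo)%E ->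
  measurable_fun setT f -> (forall x, `|f x| <= C) ->
  (forall x, ~ A x -> f x = 0) -> l2 f.
Proof.
move=> mA muA mf fC fA.
apply: (@l2_le _ (fun x => C * \1_A x)) => //.
  by apply: l2Z; exact: l2_indic.
move=> x; rewrite indicE; case: (boolP (x \in A)) => xA.
  by rewrite mulr1 (le_trans (fC x))// ler_norm.
by rewrite mulr0 normr0 fA ?normr0//; move: xA; rewrite notin_setE.
Qed.

Lemma integ_bounded_support (C : R) A f : measurable A -> (mu A < +oo)%E ->
  measurable_fun setT f -> (forall x, `|f x| <= C) ->
  (forall x, ~ A x -> f x = 0) -> integ f.
Proof.
move=> mA muA mf fC fA.
apply: (@integ_le _ (fun x => C * \1_A x)) => //.
  by apply: integZ; exact: integ_indic.
move=> x; rewrite indicE; case: (boolP (x \in A)) => xA; first by rewrite mulr1.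
by rewrite mulr0 fA ?normr0//; move: xA; rewrite notin_setE.
Qed.

Lemma l2dct (f_ : nat -> T -> R) f g : (forall n, measurable_fun setT (f_ n)) ->
  (forall x, f_ ^~ x @ \oo --> f x) -> l2 g ->
  (forall n x, `|f_ n x| <= g x) ->
  l2 f /\ (fun n => nsq (fun x => f_ n x - f x)) @ \oo --> 0.
Proof.
move=> mf_ f_f hg fg.
have g0 x : 0 <= g x by rewrite (le_trans _ (fg 0 x)).
have mf : measurable_fun setT f by apply: measurable_fun_cvg mf_ _ => x _; exact: f_f.
have fgl x : `|f x| <= g x.
  by apply: (@cvgn_le _ (fun n => `|f_ n x|)) => //; exact: cvg_norm.
have hf : l2 f.
  by apply: (l2_le mf hg) => x; rewrite (ger0_norm (g0 _)).
split => //.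
have ig : integ (fun x => 4 * g x ^+ 2) by apply: integZ; case: hg.
have [] := @Rdct (fun n x => (f_ n x - f x) ^+ 2) (fun=> 0) _ _ _ ig _.
- by move=> n; apply: measurable_funX; exact: measurable_funB.
- move=> x; rewrite [X in _ --> X](_ : _ = (f x - f x) * (f x - f x)); last by rewrite subrr mul0r.
  by apply: cvgM; apply: cvgB => //; exact: cvg_cst.
- move=> n x; rewrite normrX.
  have : `|f_ n x - f x| <= 2 * g x.
    by rewrite (le_trans (ler_normB _ _))// mulr2n mulrDl mul1r lerD.
  have -> : 4 * g x ^+ 2 = (2 * g x) ^+ 2 by ring.
  by rewrite ler_sqr ?nnegrE// mulr_ge0.
by move=> _; rewrite Rint0.
Qed.

Lemma ip_cvg (f_ : nat -> T -> R) f g : (forall n, l2 (f_ n)) -> l2 f -> l2 g ->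
  (fun n => nsq (fun x => f_ n x - f x)) @ \oo --> 0 ->
  (fun n => ip (f_ n) g) @ \oo --> ip f g.
Proof.
move=> hf_ hf hg c; apply/cvgrPdist_le => e e0.
pose t := (nsq g + 1) / e.
have g1 : 0 < nsq g + 1 by rewrite ltr_wpDl// nsq_ge0.
have t0 : 0 < t by rewrite divr_gt0.
have /cvgrPdist_le/(_ (e / t)) := c.
rewrite divr_gt0// => /(_ isT); apply: filterS => n.
rewrite sub0r normrN ger0_norm ?nsq_ge0// => nn.
rewrite distrC -ipBl// (le_trans (ip_young t0 _ hg))//; first exact: l2B.
have : t * nsq (fun x => f_ n x - f x) <= e.
  by rewrite mulrC -ler_pdivlMr.
have : t^-1 * nsq g <= e.
  rewrite /t invf_div mulrAC ler_pdivrMr// ler_wpM2l// ?ltW// ltrDl//.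
lra.
Qed.

Lemma l2_fatou (C : R) (f_ : nat -> T -> R) f : (forall n, l2 (f_ n)) ->
  (forall x, f_ ^~ x @ \oo --> f x) -> (forall n, nsq (f_ n) <= C) ->
  l2 f /\ nsq f <= C.
Proof.
move=> hf_ f_f fC.
have mf : measurable_fun setT f.
  by apply: (@measurable_fun_cvg _ _ _ _ f_) => [m|x _]; [case: (hf_ m)|exact: f_f].
have le : (\int[mu]_x (f x ^+ 2)%:E <= C%:E)%E.
  rewrite (eq_integral (fun x => limn_einf (fun n => (f_ n x ^+ 2)%:E))); last first.
    move=> x _; apply/esym; apply: (cvg_limn_einf_sup _).1; apply: cvg_EFin; first exact: nearW.
    by rewrite expr2; under eq_fun do rewrite /= expr2; apply: cvgM.
  apply: (le_trans (fatou _ _ _ _)) => //.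
  - by move=> n; apply/measurable_EFinP; apply: measurable_funX; case: (hf_ n).
  - by move=> n x _; rewrite lee_fin sqr_ge0.
  rewrite limn_einf_lim; apply: lime_le; first exact: is_cvg_einfs.
  apply: nearW => n; apply: (@le_trans _ _ (\int[mu]_x (f_ n x ^+ 2)%:E)%E).
    by apply: ereal_inf_lbound; exists n => /=.
  case: (hf_ n) => _ i; rewrite -(fineK (integrable_fin_num measurableT i)).
  by rewrite lee_fin; exact: fC.
have hf : l2 f.
  split => //; apply/integrableP; split.
    by apply/measurable_EFinP; exact: measurable_funX.
  rewrite (eq_integral (fun x => (f x ^+ 2)%:E)).
    by rewrite (le_lt_trans le)// ltry.
  by move=> x _ /=; rewrite ger0_norm// sqr_ge0.
split=> //; case: hf => _ i.
by rewrite -lee_fin /nsq /Rintegral fineK// integrable_fin_num.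
Qed.

End square_integrable.

(** * Lebesgue measure: translations, boxes and slabs *)

Section product_invariance.
Context d1 d2 (T1 : measurableType d1) (T2 : measurableType d2) (R : realType).
Variables (m1 : {sigma_finite_measure set T1 -> \bar R})
  (m2 : {sigma_finite_measure set T2 -> \bar R}).
Variables (f1 : T1 -> T1) (f2 : T2 -> T2).
Hypotheses (mf1 : measurable_fun setT f1) (mf2 : measurable_fun setT f2).

Let f (z : T1 * T2) := (f1 z.1, f2 z.2).

Let mf : measurable_fun setT f.
Proof.
apply: measurable_fun_pair => /=; first exact: measurableT_comp.
exact: measurableT_comp.
Qed.

(** By uniqueness of the product measure it suffices to look at measurable
    rectangles. *)
Lemma product_measure_invariant :
  (forall A, measurable A -> m1 (f1 @^-1` A) = m1 A) ->
  (forall A, measurable A -> m2 (f2 @^-1` A) = m2 A) ->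
  forall X, measurable X -> (m1 \x m2)%E (f @^-1` X) = (m1 \x m2)%E X.
Proof.
move=> h1 h2 X mX; apply/esym.
apply: (@product_measure_unique _ _ _ _ _ m1 m2 (pushforward (m1 \x m2)%E f)) => //.
move=> A B mA mB; change ((m1 \x m2)%E ((f1 @^-1` A) `*` (f2 @^-1` B)) = (m1 A * m2 B)%E).
have m1A : measurable (f1 @^-1` A) by rewrite -[X in measurable X]setTI; exact: mf1.
have m2B : measurable (f2 @^-1` B) by rewrite -[X in measurable X]setTI; exact: mf2.
rewrite product_measure1E; [|exact: m1A|exact: m2B].
by congr (_ * _)%E; [exact: h1|exact: h2].
Qed.

End product_invariance.

Section translation_invariance.
Context (R : realType).

Lemma lebesgue_measure_translate (c : R) (A : set R) : measurable A ->
  pushforward (@lebesgue_measure R) (fun x => x + c : measurableTypeR R) A =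
  lebesgue_measure A.
Proof.
move=> mA; apply/esym/lebesgue_measure_unique => //=.
  exact: measurable_funD.
move=> _ _ [[a b]] _ <-; rewrite /pushforward.
have -> : (fun x => x + c) @^-1` `]a, b]%classic = `]a - c, b - c]%classic.
  by apply/seteqP; split => x /=; rewrite !in_itv/= ltrBlDr lerBrDr.
rewrite !lebesgue_measure_itv/= !lte_fin ltrD2r -!EFinB.
by rewrite (_ : b - c - (a - c) = b - a)//; ring.
Qed.

Lemma measurable_translate_rV n (v : 'rV[R]_n) :
  measurable_fun setT (fun w : 'rV[R]_n => w + v).
Proof.
apply: measurable_fun_rV => i; under eq_fun do rewrite mxE.
by apply: measurable_funD => //; exact: measurable_coor.
Qed.

Lemma lebesgue_rV_translate n (v : 'rV[R]_n) (A : set 'rV[R]_n) : measurable A ->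
  lebesgue_rV R n ((fun w => w + v) @^-1` A) = lebesgue_rV R n A.
Proof.
elim: n v A => [|n IH] v A mA.
  by congr (_ _); apply/seteqP; split => w /=; rewrite (_ : w + v = w)//; apply/rowP => -[].
pose q := row_uncons v.
have mpre : measurable (@row_cons R n @^-1` A).
  by rewrite -[X in measurable X]setTI; exact: measurable_row_cons.
transitivity ((lebesgue_measure \x lebesgue_rV R n)%E
  ((fun z => (z.1 + q.1, z.2 + q.2)) @^-1` (@row_cons R n @^-1` A))).
  rewrite /= /lebesgue_rV_step /pushforward; congr (product_measure1 _ _ _).
  apply/seteqP; split => -[a w] /=.
    rewrite (_ : row_cons _ + v = row_cons (a + q.1, w + q.2))//.
    apply/rowP => i; rewrite /row_cons !mxE/=.
    by case: unliftP => [j ->|->]; rewrite ?mxE.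
  rewrite (_ : row_cons _ + v = row_cons (a + q.1, w + q.2))//.
  apply/rowP => i; rewrite /row_cons !mxE/=.
  by case: unliftP => [j ->|->]; rewrite ?mxE.
rewrite (@product_measure_invariant _ _ _ _ _ lebesgue_measure (lebesgue_rV R n)
  (fun x => x + q.1) (fun w => w + q.2))//.
- exact: measurable_funD.
- exact: measurable_translate_rV.
- by move=> B mB; exact: (lebesgue_measure_translate q.1 mB).
- by move=> B mB; exact: IH.
Qed.

Lemma measurable_coor_set n (I : 'I_n -> set R) : (forall i, measurable (I i)) ->
  measurable [set w : 'rV[R]_n | forall i, I i (w 0 i)].
Proof.
move=> mI; rewrite (_ : mkset _ = \bigcap_(i in setT) ((fun w : 'rV[R]_n => w 0 i) @^-1` I i)).
  apply: fin_bigcap_measurable => // i _; rewrite -[X in measurable X]setTI.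
  exact: measurable_coor.
by apply/seteqP; split => [w h i _|w h i]; exact: h.
Qed.

Lemma lebesgue_rV_box n (I : 'I_n -> set R) : (forall i, measurable (I i)) ->
  lebesgue_rV R n [set w | forall i, I i (w 0 i)] =
  (\prod_(i < n) lebesgue_measure (I i))%E.
Proof.
elim: n I => [|n IH] I mI.
  rewrite big_ord0 /= diracE; case: (boolP (_ \in _)) => //.
  by rewrite notin_setE => /(_ (fun i => _))[] => -[].
rewrite big_ord_recl -IH//.
transitivity ((lebesgue_measure \x lebesgue_rV R n)%E
    (I ord0 `*` [set w : 'rV[R]_n | forall i, I (lift ord0 i) (w 0 i)])).
  rewrite /= /lebesgue_rV_step /pushforward; congr (product_measure1 _ _ _).
  apply/seteqP; split => -[a w] /=.
    move=> h; split.
      by have := h ord0; rewrite /row_cons mxE unlift_none.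
    by move=> i; have := h (lift ord0 i); rewrite /row_cons mxE liftK.
  move=> [h0 h] i; rewrite /row_cons mxE.
  by case: unliftP => [j ->|->] //=.
have m2 := measurable_coor_set (fun i => mI (lift ord0 i)).
rewrite product_measure1E; [by []|exact: mI|exact: m2].
Qed.

End translation_invariance.

Section space.
Context (R : realType) (N l : nat).
Local Notation E := ('rV[R]_N * 'rV[R]_l)%type.
Local Notation mu := (lebesgue_space R N l).
Implicit Types (z s : E) (f g : E -> R).

Definition coorx (i : 'I_N) z : R := z.1 0 i.
Definition coory (j : 'I_l) z : R := z.2 0 j.

Lemma measurable_coorx i : measurable_fun setT (coorx i).
Proof. exact: (measurableT_comp (measurable_coor i) measurable_fst). Qed.

Lemma measurable_coory j : measurable_fun setT (coory j).
Proof. exact: (measurableT_comp (measurable_coor j) measurable_snd). Qed.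

Lemma measurable_translate s : measurable_fun setT (fun z => z + s).
Proof.
apply: measurable_fun_pair => /=.
  exact: (measurableT_comp (measurable_translate_rV s.1) measurable_fst).
exact: (measurableT_comp (measurable_translate_rV s.2) measurable_snd).
Qed.

Lemma measurable_fun_translate s f : measurable_fun setT f ->
  measurable_fun setT (fun z => f (z + s)).
Proof. by move=> mf; exact: (measurableT_comp mf (measurable_translate s)). Qed.

Lemma lebesgue_space_translate s (A : set E) : measurable A ->
  mu ((fun z => z + s) @^-1` A) = mu A.
Proof.
move=> mA; apply: (@product_measure_invariant _ _ _ _ _ (lebesgue_rV R N) (lebesgue_rV R l)
  (fun x => x + s.1) (fun y => y + s.2)) => //.
- exact: measurable_translate_rV.
- exact: measurable_translate_rV.
- by move=> *; exact: lebesgue_rV_translate.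
- by move=> *; exact: lebesgue_rV_translate.
Qed.

Lemma ge0_integral_translate s (f : E -> \bar R) : measurable_fun setT f ->
  (forall z, (0 <= f z)%E) ->
  (\int[mu]_z f (z + s)%R = \int[mu]_z f z)%E.
Proof.
move=> mf f0; have := @ge0_integral_pushforward _ _ _ _ _ _ (measurable_translate s) mu setT f measurableT mf (fun z _ => f0 z).
rewrite preimage_setT => <-.
apply: eq_measure_integral; first exact: measurable_translate.
by move=> mt A mA _; exact: lebesgue_space_translate.
Qed.

Lemma integ_translate s f : integ mu f -> integ mu (fun z => f (z + s)).
Proof.
move=> /integrableP[/measurable_EFinP mf fi]; apply/integrableP; split.
  by apply/measurable_EFinP; exact: measurable_fun_translate.
rewrite (@ge0_integral_translate s (fun z => `|(f z)%:E|%E))//.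
by apply/measurable_EFinP; exact: measurableT_comp.
Qed.

Lemma Rint_translate s f : integ mu f -> \int[mu]_z f (z + s) = \int[mu]_z f z.
Proof.
move=> hf; have mf := integ_meas hf.
have h := @integral_pushforward _ _ _ _ _ _ (measurable_translate s) mu setT (EFin \o f)
  ((measurable_EFinP _ _).2 mf) (integ_translate s hf) measurableT.
rewrite /Rintegral; congr fine; rewrite preimage_setT in h; rewrite -[LHS]h.
apply: eq_measure_integral; first exact: measurable_translate.
by move=> mt A mA _; exact: lebesgue_space_translate.
Qed.

Lemma l2_translate s f : l2 mu f -> l2 mu (fun z => f (z + s)).
Proof.
move=> [mf i2]; split; first exact: measurable_fun_translate.
exact: (integ_translate s i2).
Qed.

Lemma nsq_translate s f : l2 mu f -> nsq mu (fun z => f (z + s)) = nsq mu f.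
Proof. by move=> [mf i2]; exact: (Rint_translate s i2). Qed.

Lemma ip_translate s f g : l2 mu f -> l2 mu g ->
  ip mu (fun z => f (z + s)) (fun z => g (z + s)) = ip mu f g.
Proof. by move=> hf hg; exact: (Rint_translate s (l2M hf hg)). Qed.

Definition box (r : R) : set E :=
  [set z : E | (forall i, `|z.1 0 i| <= r) /\ (forall j, `|z.2 0 j| <= r)].

Lemma lebesgue_space_box (I : 'I_N -> set R) (J : 'I_l -> set R) :
  (forall i, measurable (I i)) -> (forall j, measurable (J j)) ->
  let B := [set z : E | (forall i, I i (z.1 0 i)) /\ (forall j, J j (z.2 0 j))] in
  measurable B /\ mu B =
  ((\prod_(i < N) lebesgue_measure (I i)) *
   (\prod_(j < l) lebesgue_measure (J j)))%E.
Proof.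
move=> mI mJ B; have m1 := measurable_coor_set mI; have m2 := measurable_coor_set mJ.
split; first exact: (measurableX m1 m2).
rewrite -!lebesgue_rV_box//.
exact: (@product_measure1E _ _ _ _ _ (lebesgue_rV R N) (lebesgue_rV R l) _ _ m1 m2).
Qed.

Lemma prode_fin_num (n : nat) (F : 'I_n -> \bar R) (P : pred 'I_n) :
  (forall i, F i \is a fin_num) -> (\prod_(i < n | P i) F i)%E \is a fin_num.
Proof. by move=> h; elim/big_ind : _ => // x y; exact: fin_numM. Qed.

Lemma eq_leE (x y : \bar R) : x = y -> (x <= y)%E.
Proof. by move=> ->. Qed.

Lemma lebesgue_segment (a b : R) :
  lebesgue_measure `[a, b]%classic = (Num.max 0 (b - a))%:E.
Proof.
rewrite lebesgue_measure_itv/= lte_fin; case: ltP => ab.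
  by rewrite max_r// subr_ge0 ltW.
by rewrite max_l// subr_le0.
Qed.

Lemma measurable_box r : measurable (box r) /\ (mu (box r) < +oo)%E.
Proof.
have [mB] := @lebesgue_space_box (fun=> `[-r, r]%classic) (fun=> `[-r, r]%classic)
  (fun=> measurable_itv _) (fun=> measurable_itv _).
rewrite (_ : mkset _ = box r) in mB *; last first.
  apply/seteqP; split => z [h1 h2]; split => i; [have := h1 i|have := h2 i|have := h1 i|have := h2 i];
  by rewrite /= in_itv/= ler_norml.
move=> ->; split => //; rewrite ltey_eq fin_numM//;
  by apply: prode_fin_num => i; rewrite lebesgue_segment.
Qed.

Definition strip (r : R) (j : 'I_l) (t : R) : set E := box r `&` [set z : E | 0 <= z.2 0 j <= t].

(** Cutoffs along the boundary vary only in such slabs; their measure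
    compensates one power of the slope. *)
Lemma measure_strip r (j : 'I_l) : exists2 C, 0 <= C & forall t, 0 <= t ->
  measurable (strip r j t) /\ (mu (strip r j t) <= (C * t)%:E)%E.
Proof.
pose c := Num.max 0 (r - - r).
exists (c ^+ N * c ^+ l.-1) => [|t t0].
  by rewrite mulr_ge0// exprn_ge0// le_max lexx.
pose J k := if k == j then `[0, t]%classic else `[-r, r]%classic.
have mJ k : measurable (J k) by rewrite /J; case: (k == j); exact: measurable_itv.
have [mB muB] := @lebesgue_space_box (fun=> `[-r, r]%classic) J (fun=> measurable_itv _) mJ.
have mst : measurable (strip r j t).
  apply: measurableI; first exact: (measurable_box r).1.
  rewrite (_ : mkset _ = @coory j @^-1` `[0, t]); last first.
    by apply/seteqP; split => z /=; rewrite in_itv.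
  by rewrite -[X in measurable X]setTI; exact: (measurable_coory j measurableT (measurable_itv _)).
split => //.
have sub : strip r j t `<=` [set z : E | (forall i, `[-r, r]%classic (z.1 0 i)) /\ (forall k, J k (z.2 0 k))].
  move=> z [[h1 h2] h3]; split=> k.
    by have := h1 k; rewrite /= in_itv/= ler_norml.
  by rewrite /J; case: eqP => [->|_]; [rewrite /= in_itv|have := h2 k; rewrite /= in_itv/= ler_norml].
apply: (le_trans (le_measure mu (mem_set mst) (mem_set mB) sub)).
apply: (@le_trans _ _ _ _ _ (eq_leE muB)).
rewrite (eq_bigr (fun=> c%:E)) => [|i _]; last by rewrite lebesgue_segment.
rewrite (bigD1 j)//= {1}/J eqxx lebesgue_segment subr0 max_r//.
rewrite [X in (_ * (_ * X))%E](eq_bigr (fun=> c%:E)) => [|k /negPf jk]; last by rewrite /J jk lebesgue_segment.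
have big (I : finType) (P : pred I) : (\prod_(i | P i) c%:E)%E = (c ^+ #|P|)%:E.
  by rewrite -prodr_const; elim/big_rec2 : _ => // i y x _ ->.
rewrite !big -!EFinM lee_fin card_ord cardC1 card_ord.
by rewrite [t * _]mulrC mulrA.
Qed.

Lemma lebesgue_space_box_gt0 (a b : 'I_N -> R) (c d : 'I_l -> R) :
  (forall i, a i < b i) -> (forall j, c j < d j) ->
  let B := [set z : E | (forall i, a i < z.1 0 i < b i) /\
                        (forall j, c j < z.2 0 j < d j)] in
  measurable B /\ (0 < mu B)%E.
Proof.
move=> ab cd B.
have [mB muB] := @lebesgue_space_box (fun i => `]a i, b i[%classic)
  (fun j => `]c j, d j[%classic)
  (fun=> measurable_itv _) (fun=> measurable_itv _).
have BE : B = [set z : E | (forall i, `]a i, b i[%classic (z.1 0 i)) /\ (forall j, `]c j, d j[%classic (z.2 0 j))].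
  by apply/seteqP; split => z [h1 h2]; split => i; [have := h1 i|have := h2 i|have := h1 i|have := h2 i]; rewrite /= in_itv.
rewrite BE; split => //; rewrite muB.
rewrite mule_gt0//; elim/big_ind : _ => // [x y x0 y0|i _]; rewrite ?mule_gt0// lebesgue_measure_itv/= lte_fin.
  by rewrite ab -EFinB lte_fin subr_gt0.
by rewrite cd -EFinB lte_fin subr_gt0.
Qed.

End space.

(** * The functions exp (-1/t) / t^n *)

Section flat_functions.
Context (R : realType).
Implicit Types (t : R) (n : nat).

(** The functions [t^-n exp (-1/t)], extended by [0] to [t <= 0]. The factor
    [t^-n] is part of the family because it appears when differentiating. *)
Definition flat n t : R := if 0 < t then t^-1 ^+ n * expR (- t^-1) else 0.

Lemma flat_gt0E n t : 0 < t -> flat n t = t^-1 ^+ n * expR (- t^-1).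
Proof. by rewrite /flat => ->. Qed.

Lemma flat_le0 n t : t <= 0 -> flat n t = 0.
Proof. by rewrite /flat ltNge => ->. Qed.

Lemma flat_ge0 n t : 0 <= flat n t.
Proof.
rewrite /flat; case: ifPn => // t0.
by rewrite mulr_ge0 ?expR_ge0// exprn_ge0// invr_ge0 ltW.
Qed.

Lemma flat_gt0 n t : 0 < t -> 0 < flat n t.
Proof. by move=> t0; rewrite flat_gt0E// mulr_gt0 ?expR_gt0// exprn_gt0// invr_gt0. Qed.

Lemma flat0_le1 t : flat 0 t <= 1.
Proof.
have [t0|t0] := leP t 0; first by rewrite flat_le0.
by rewrite flat_gt0E// expr0 mul1r -expR0 ler_expR oppr_le0 invr_ge0 ltW.
Qed.

Lemma expn_expRN_le m (x : R) : 0 < x -> x ^+ m.+1 * expR (- x) <= m.+1%:R ^+ m.+1.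
Proof.
move=> x0; rewrite expRN ler_pdivrMr ?expR_gt0//.
have -> : x = m.+1%:R * (x / m.+1%:R) by rewrite mulrC divfK// pnatr_eq0.
rewrite expRM_natl exprMn ler_wpM2l// lerXn2r ?nnegrE ?expR_ge0 ?divr_ge0 ?ltW//.
by rewrite (lt_le_trans _ (expR_ge1Dx _))// ltrDr.
Qed.

Lemma flat_le_sqr n t : flat n t <= n.+2%:R ^+ n.+2 * t ^+ 2.
Proof.
have [t0|t0] := leP t 0; first by rewrite flat_le0// mulr_ge0 ?sqr_ge0.
have ti : 0 < t^-1 by rewrite invr_gt0.
have := expn_expRN_le n.+1 ti; rewrite -[in X in X -> _](ler_pM2r (x := t ^+ 2)) ?exprn_gt0//.
apply: le_trans; rewrite flat_gt0E//.
have -> : t^-1 ^+ n.+2 * expR (- t^-1) * t ^+ 2 = (t^-1 * t) * (t^-1 * t) * (t^-1 ^+ n * expR (- t^-1)).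
  by rewrite 2!exprS; ring.
by rewrite mulVf ?gt_eqF// !mul1r.
Qed.

Lemma flat2_le (b t : R) : 0 <= b -> t <= b -> flat 2 t <= 4 ^+ 4 * b ^+ 2.
Proof.
move=> b0 tb; have [t0|t0] := leP t 0; first by rewrite flat_le0// mulr_ge0 ?sqr_ge0// exprn_ge0.
rewrite (le_trans (flat_le_sqr 2 t))// ler_wpM2l ?exprn_ge0// lerXn2r// nnegrE ltW//.
Qed.

(** At [t = 0] the difference quotient tends to [0] by the bound
    [flat_le_sqr]. *)
Lemma is_derive_flat n t :
  is_derive t (1 : R) (flat n) (flat n.+2 t - n%:R * flat n.+1 t).
Proof.
have [t0|t0|->] := ltgtP t 0.
- rewrite !flat_le0 ?ltW// mulr0 subr0.
  have h : \near t, cst 0 t = flat n t.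
    near=> x; rewrite flat_le0//; apply: ltW; near: x; exact: lt_nbhsl.
  exact: (near_eq_is_derive h (is_derive_cst _ _ _)).
- pose G (y : R) := y ^+ n * expR (- y).
  have h : \near t, (G \o GRing.inv) t = flat n t.
    near=> x; rewrite flat_gt0E//; near: x; exact: lt_nbhsr.
  apply: (near_eq_is_derive h).
  have tn0 : t != 0 by rewrite gt_eqF.
  have dV : is_derive t (1 : R) (GRing.inv : R -> R) (- t ^- 2).
    have := @is_deriveV R id t _ 1 tn0 (is_derive_id t 1).
    by rewrite /GRing.scale/= mulr1.
  have dG y : is_derive y (1 : R) G (y ^+ n * - expR (- y) + expR (- y) * (n%:R * y ^+ n.-1)).
    have d1 : is_derive y (1 : R) (fun y => y ^+ n) (n%:R * y ^+ n.-1).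
      apply: DeriveDef; first exact: exprn_derivable.
      by rewrite exp_derive /GRing.scale/= mulr1.
    have d2 : is_derive y (1 : R) (fun y => expR (- y)) (- expR (- y)).
      rewrite -mulrN1.
      exact: (@is_derive1_comp R expR -%R y _ _ (is_derive_expR (- y)) (is_deriveNid y 1)).
    exact: is_deriveM.
  apply: (is_derive_eq (@is_derive1_comp R G GRing.inv t _ _ (dG (t^-1)) dV)).
  rewrite /G !flat_gt0E// /GRing.scale/=.
  case: (n) => [|k] /=; first by rewrite !expr0; field.
  by rewrite (exprS _ k.+2) (exprS _ k.+1) !(exprS _ k); field.
- rewrite !flat_le0// mulr0 subr0.
  have c : (fun h => h^-1 *: (flat n (h *: 1 + 0) - flat n 0)) @ 0^' --> (0:R).
    apply/cvgrPdist_le => e e0; near=> h.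
    rewrite sub0r normrN [flat n 0]flat_le0// subr0 addr0 /GRing.scale/= mulr1.
    have h0 : h != 0 by near: h; exact: nbhs_dnbhs_neq.
    rewrite normrM normfV ger0_norm ?flat_ge0// ler_pdivrMl ?normr_gt0//.
    rewrite (le_trans (flat_le_sqr _ _))// -[h ^+ 2]real_normK ?num_real// expr2.
    rewrite mulrA mulrC ler_wpM2l// -ler_pdivlMl ?exprn_gt0// mulrC.
    by rewrite ltW//; near: h; apply: dnbhs0_lt; rewrite divr_gt0// exprn_gt0.
  apply: DeriveDef; first by apply/cvg_ex; exists 0.
  exact/cvg_lim.
Unshelve. all: by end_near.
Qed.

Lemma derivable_flat n t : derivable (flat n) t 1.
Proof. by have := is_derive_flat n t => -[]. Qed.

Lemma derive_flat n t : 'D_1 (flat n) t = flat n.+2 t - n%:R * flat n.+1 t.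
Proof. by have := is_derive_flat n t => -[]. Qed.

Lemma continuous_flat n : continuous (flat n).
Proof.
by move=> t; apply/differentiable_continuous/derivable1_diffP/derivable_flat.
Qed.

Lemma measurable_flat n : measurable_fun setT (flat n).
Proof. exact: (continuous_measurable_fun (@continuous_flat n)). Qed.

End flat_functions.

(** * An algebra of smooth functions *)

Section test_functions.
Context (R : realType) (N l : nat).
Local Notation E := ('rV[R]_N * 'rV[R]_l)%type.
Local Notation mu := (lebesgue_space R N l).
Implicit Types (z v s : E) (f g phi : E -> R).

(** An explicit algebra of smooth functions. It is closed under directional
    derivatives by construction, which makes smoothness and measurability
    automatic, and rich enough for all cutoffs, mollifiers and barriers used
    below. *)
Inductive elem : (E -> R) -> Prop :=
| elem_x i : elem (fun z => z.1 0 i)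
| elem_y j : elem (fun z => z.2 0 j)
| elem_cst c : elem (fun=> c)
| elem_add f g : elem f -> elem g -> elem (fun z => f z + g z)
| elem_mul f g : elem f -> elem g -> elem (fun z => f z * g z)
| elem_flat n f : elem f -> elem (fun z => flat n (f z))
| elem_exp f : elem f -> elem (fun z => expR (f z))
| elem_ln f : elem f -> (forall z, 0 < f z) -> elem (fun z => ln (f z)).

Lemma differentiable_coorx i z : differentiable (fun z : E => z.1 0 i) z.
Proof.
have @f : {linear E -> R}.
  by exists (fun z : E => z.1 0 i); do 2![eexists]; do ?[constructor];
     rewrite ?mxE// => ? *; rewrite ?mxE//; move=> ?; rewrite !mxE.
rewrite (_ : (fun _ => _) = f) //; apply: linear_differentiable => x.
apply: (@continuous_comp _ _ _ (fun z : E => z.1) (fun w : 'rV[R]_N => w 0 i)).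
  exact: cvg_fst.
exact: coord_continuous.
Qed.

Lemma differentiable_coory i z : differentiable (fun z : E => z.2 0 i) z.
Proof.
have @f : {linear E -> R}.
  by exists (fun z : E => z.2 0 i); do 2![eexists]; do ?[constructor];
     rewrite ?mxE// => ? *; rewrite ?mxE//; move=> ?; rewrite !mxE.
rewrite (_ : (fun _ => _) = f) //; apply: linear_differentiable => x.
apply: (@continuous_comp _ _ _ (fun z : E => z.2) (fun w : 'rV[R]_l => w 0 i)).
  exact: cvg_snd.
exact: coord_continuous.
Qed.

Lemma elem_differentiable f : elem f -> forall z, differentiable f z.
Proof.
elim=> {f}.
- exact: differentiable_coorx.
- exact: differentiable_coory.
- by move=> c z; exact: differentiable_cst.
- by move=> f g _ hf _ hg z; exact: differentiableD.
- by move=> f g _ hf _ hg z; exact: differentiableM.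
- move=> n f _ hf z; apply: (@differentiable_comp _ _ _ _ f (flat n)) => //.
  exact/derivable1_diffP/derivable_flat.
- move=> f _ hf z; apply: (@differentiable_comp _ _ _ _ f expR) => //.
  by apply/derivable1_diffP; exact: derivable_expR.
- move=> f _ hf f0 z; apply: (@differentiable_comp _ _ _ _ f (@ln R)) => //.
  by apply/derivable1_diffP; have [] := is_derive1_ln (f0 z).
Qed.

Lemma derive_chain (F : R -> R) f v z : differentiable f z ->
  derivable F (f z) 1 -> 'D_v (F \o f) z = 'D_1 F (f z) * 'D_v f z.
Proof.
move=> df dF; have dF' : differentiable F (f z) by exact/derivable1_diffP.
rewrite !deriveE//; last exact: differentiable_comp.
rewrite diff_comp//= -[in LHS](mulr1 ('d f z v)).
by rewrite -[_ * 1]/(_ *: 1) linearZ/= /GRing.scale/= mulrC.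
Qed.

Lemma derive_coorx i v : 'D_v (fun z : E => z.1 0 i) = fun=> v.1 0 i.
Proof.
apply/funext => z; rewrite /derive.
apply: (@cvg_lim _ _ _) => //; apply: cvg_near_cst; near=> h.
rewrite /= !mxE addrK scalerA mulVf ?scale1r//.
by near: h; exact: nbhs_dnbhs_neq.
Unshelve. all: by end_near.
Qed.

Lemma derive_coory j v : 'D_v (fun z : E => z.2 0 j) = fun=> v.2 0 j.
Proof.
apply/funext => z; rewrite /derive.
apply: (@cvg_lim _ _ _) => //; apply: cvg_near_cst; near=> h.
rewrite /= !mxE addrK scalerA mulVf ?scale1r//.
by near: h; exact: nbhs_dnbhs_neq.
Unshelve. all: by end_near.
Qed.

Lemma elem_derivable f v z : elem f -> derivable f z v.
Proof. by move=> hf; apply: diff_derivable; exact: elem_differentiable. Qed.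

Lemma derive_add f g v : elem f -> elem g ->
  'D_v (fun z => f z + g z) = fun z => 'D_v f z + 'D_v g z.
Proof. by move=> hf hg; apply/funext => z; rewrite -deriveD//; exact: elem_derivable. Qed.

Lemma derive_mul f g v : elem f -> elem g ->
  'D_v (fun z => f z * g z) = fun z => f z * 'D_v g z + g z * 'D_v f z.
Proof.
by move=> hf hg; apply/funext => z; rewrite -[LHS]/('D_v (f * g) z) deriveM//; exact: elem_derivable.
Qed.

Lemma derive_flat_comp n f v : elem f -> 'D_v (fun z => flat n (f z)) =
  fun z => (flat n.+2 (f z) - n%:R * flat n.+1 (f z)) * 'D_v f z.
Proof.
move=> hf; apply/funext => z; rewrite -derive_flat.
rewrite -(@derive_chain (flat n) f)//; first exact: elem_differentiable.
exact: derivable_flat.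
Qed.

Lemma derive_expR_comp f v : elem f -> 'D_v (fun z => expR (f z)) =
  fun z => expR (f z) * 'D_v f z.
Proof.
move=> hf; apply/funext => z.
rewrite -[LHS]/('D_v (expR \o f) z) derive_chain//; last exact: elem_differentiable.
by congr (_ * _); have [] := is_derive_expR (f z).
Qed.

Lemma derive_ln_comp f v : elem f -> (forall z, 0 < f z) ->
  'D_v (fun z => ln (f z)) = fun z => expR (- ln (f z)) * 'D_v f z.
Proof.
move=> hf f0; apply/funext => z; have [d1 d2] := is_derive1_ln (f0 z).
rewrite -[LHS]/('D_v (@ln R \o f) z) derive_chain//; last exact: elem_differentiable.
by rewrite d2 expRN lnK ?posrE.
Qed.

Lemma elem_opp f : elem f -> elem (fun z => - f z).
Proof. by move=> hf; under eq_fun do rewrite -mulN1r; apply: elem_mul => //; exact: elem_cst. Qed.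

Lemma elem_sub f g : elem f -> elem g -> elem (fun z => f z - g z).
Proof. by move=> hf hg; apply: elem_add => //; exact: elem_opp. Qed.

Lemma elem_scale c f : elem f -> elem (fun z => c * f z).
Proof. by move=> hf; apply: elem_mul => //; exact: elem_cst. Qed.

Lemma elem_sum (I : Type) (r : seq I) (P : pred I) (F : I -> E -> R) :
  (forall i, elem (F i)) -> elem (fun z => \sum_(i <- r | P i) F i z).
Proof.
move=> hF; elim: r => [|i r IH].
  by under eq_fun do rewrite big_nil; exact: elem_cst.
under eq_fun do rewrite big_cons; case: (P i) => //.
exact: elem_add.
Qed.

Lemma elem_exprn f n : elem f -> elem (fun z => f z ^+ n).
Proof.
move=> hf; elim: n => [|n IH]; first by under eq_fun do rewrite expr0; exact: elem_cst.
by under eq_fun do rewrite exprS; exact: elem_mul.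
Qed.

(** The factor [t^-n] in [flat], and inverses written as [expR (- ln f)], are
    what makes the class closed. *)
Lemma elem_derive v f : elem f -> elem ('D_v f).
Proof.
elim=> {f}.
- by move=> i; rewrite derive_coorx; exact: elem_cst.
- by move=> i; rewrite derive_coory; exact: elem_cst.
- by move=> c; rewrite (_ : 'D_v _ = fun=> 0); [exact: elem_cst|apply/funext => z; rewrite derive_cst].
- by move=> f g ? hf ? hg; rewrite derive_add//; exact: elem_add.
- move=> f g ? hf ? hg; rewrite derive_mul//.
  by apply: elem_add; exact: elem_mul.
- move=> n f ef hf; rewrite derive_flat_comp//; apply: elem_mul => //.
  by apply: elem_sub; [|apply: elem_scale]; exact: elem_flat.
- by move=> f ef hf; rewrite derive_expR_comp//; apply: elem_mul => //; exact: elem_exp.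
- move=> f ef hf f0; rewrite derive_ln_comp//; apply: elem_mul => //.
  by apply: elem_exp; apply: elem_opp; exact: elem_ln.
Qed.

Lemma elem_smooth f : elem f -> smooth f.
Proof.
move=> hf ss z; apply: elem_differentiable.
elim: ss => //= v ss IH; exact: elem_derive.
Qed.

Lemma elem_measurable f : elem f -> measurable_fun setT f.
Proof.
elim=> {f}.
- exact: measurable_coorx.
- exact: measurable_coory.
- by move=> c; exact: measurable_cst.
- by move=> f g _ hf _ hg; exact: measurable_funD.
- by move=> f g _ hf _ hg; exact: measurable_funM.
- by move=> n f _ hf; apply: (measurableT_comp (@measurable_flat _ n)).
- by move=> f _ hf; apply: (measurableT_comp (@measurable_expR _)).
- by move=> f _ hf _; apply: (measurableT_comp (@measurable_ln _)).
Qed.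

Lemma elem_continuous f : elem f -> continuous f.
Proof. by move=> hf z; apply/differentiable_continuous/elem_differentiable. Qed.

Lemma elem_translate s f : elem f -> elem (fun z => f (z + s)).
Proof.
elim=> {f}.
- move=> i; under eq_fun do rewrite mxE.
  by apply: elem_add; [exact: elem_x|exact: elem_cst].
- move=> i; under eq_fun do rewrite mxE.
  by apply: elem_add; [exact: elem_y|exact: elem_cst].
- by move=> c; exact: elem_cst.
- by move=> f g ? hf ? hg; exact: elem_add.
- by move=> f g ? hf ? hg; exact: elem_mul.
- by move=> n f ? hf; exact: elem_flat.
- by move=> f ? hf; exact: elem_exp.
- by move=> f ? hf f0; exact: (elem_ln hf (fun z => f0 (z + s))).
Qed.

Lemma elem_reflect s f : elem f -> elem (fun z => f (s - z)).
Proof.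
elim=> {f}.
- move=> i; under eq_fun do rewrite !mxE.
  by apply: elem_add; [exact: elem_cst|apply: elem_opp; exact: elem_x].
- move=> i; under eq_fun do rewrite !mxE.
  by apply: elem_add; [exact: elem_cst|apply: elem_opp; exact: elem_y].
- by move=> c; exact: elem_cst.
- by move=> f g ? hf ? hg; exact: elem_add.
- by move=> f g ? hf ? hg; exact: elem_mul.
- by move=> n f ? hf; exact: elem_flat.
- by move=> f ? hf; exact: elem_exp.
- by move=> f ? hf f0; exact: (elem_ln hf (fun z => f0 (s - z))).
Qed.

Lemma derive_translate s v f z : 'D_v (fun z => f (z + s)) z = 'D_v f (z + s).
Proof.
rewrite /derive.
suff -> : (fun h : R => h^-1 *: (((fun z => f (z + s)) \o shift z) (h *: v) - f (z + s))) =
  (fun h : R => h^-1 *: ((f \o shift (z + s)) (h *: v) - f (z + s))) by [].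
by apply/funext => h /=; rewrite addrA.
Qed.

Lemma derive_reflect s v f z : elem f -> 'D_v (fun z => f (s - z)) z = - 'D_v f (s - z).
Proof.
move=> hf; have -> : 'D_v (fun z => f (s - z)) z = 'D_(- v) f (s - z).
  rewrite /derive.
  suff -> : (fun h : R => h^-1 *: (((fun z => f (s - z)) \o shift z) (h *: v) - f (s - z))) =
    (fun h : R => h^-1 *: ((f \o shift (s - z)) (h *: - v) - f (s - z))) by [].
  by apply/funext => h /=; rewrite scalerN opprD addrCA.
rewrite !deriveE; [|exact: elem_differentiable|exact: elem_differentiable].
exact: linearN.
Qed.

Lemma derive_addE f g v z : elem f -> elem g ->
  'D_v (fun z => f z + g z) z = 'D_v f z + 'D_v g z.
Proof. by move=> eF eK; exact: (congr1 (@^~ z) (derive_add v eF eK)). Qed.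

Lemma derive_mulE f g v z : elem f -> elem g ->
  'D_v (fun z => f z * g z) z = f z * 'D_v g z + g z * 'D_v f z.
Proof. by move=> eF eK; exact: (congr1 (@^~ z) (derive_mul v eF eK)). Qed.

Lemma derive_scaleE c f v z : elem f -> 'D_v (fun z => c * f z) z = c * 'D_v f z.
Proof.
move=> eF; rewrite derive_mulE//; last exact: elem_cst.
by rewrite derive_cst mulr0 addr0.
Qed.

Lemma derive_flatE n f v z : elem f -> 'D_v (fun z => flat n (f z)) z =
  (flat n.+2 (f z) - n%:R * flat n.+1 (f z)) * 'D_v f z.
Proof. by move=> eF; exact: (congr1 (@^~ z) (derive_flat_comp n v eF)). Qed.

Lemma derive_xE i v z : 'D_v (fun z : E => z.1 0 i) z = v.1 0 i.
Proof. exact: (congr1 (@^~ z) (derive_coorx i v)). Qed.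

Lemma derive_yE j v z : 'D_v (fun z : E => z.2 0 j) z = v.2 0 j.
Proof. exact: (congr1 (@^~ z) (derive_coory j v)). Qed.

Lemma derive_sqE f v z : elem f -> 'D_v (fun z => f z ^+ 2) z = 2 * f z * 'D_v f z.
Proof.
move=> eF; rewrite (_ : (fun z => f z ^+ 2) = fun z => f z * f z)//.
by rewrite derive_mulE//; ring.
Qed.

Lemma derive_sumE (I : Type) (r : seq I) (F : I -> E -> R) v z : (forall i, elem (F i)) ->
  'D_v (fun z => \sum_(i <- r) F i z) z = \sum_(i <- r) 'D_v (F i) z.
Proof.
move=> eF; elim: r => [|i r IH].
  rewrite (_ : (fun z : E => _) = fun=> 0); last by apply/funext => w; rewrite big_nil.
  by rewrite derive_cst big_nil.
rewrite (_ : (fun z : E => _) = fun z => F i z + \sum_(k <- r) F k z); last first.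
  by apply/funext => w; rewrite big_cons.
by rewrite derive_addE ?IH ?big_cons//; exact: elem_sum.
Qed.

End test_functions.

(** * Test functions *)

Section bounded_support.
Context (R : realType) (N l : nat).
Local Notation E := ('rV[R]_N * 'rV[R]_l)%type.
Local Notation mu := (lebesgue_space R N l).
Local Notation box := (@box R N l).
Implicit Types (z v s : E) (f g phi : E -> R).

Lemma compact_box r : compact (box r).
Proof.
rewrite (_ : box r = [set w : 'rV[R]_N | forall i, `[-r, r]%classic (w 0 i)] `*`
  [set w : 'rV[R]_l | forall i, `[-r, r]%classic (w 0 i)]).
  by apply: compact_setX; [apply: (@rV_compact R N (fun=> `[-r, r]%classic))|apply: (@rV_compact R l (fun=> `[-r, r]%classic))] => i; exact: segment_compact.
apply/seteqP; split => z [h1 h2]; split => i; [have := h1 i|have := h2 i|have := h1 i|have := h2 i];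
  by rewrite /= in_itv/= ler_norml.
Qed.

Lemma closed_box r : closed (box r).
Proof.
apply: compact_closed; last exact: compact_box.
by apply: norm_hausdorff.
Qed.

Definition vanishes_off r f := forall z, ~ box r z -> f z = 0.

(** In place of compact support: bounded support, which is preserved by all
    the operations below and is easier to exhibit. *)
Definition tfun f := elem f /\ exists r, vanishes_off r f.

Lemma box_le r r' : r <= r' -> box r `<=` box r'.
Proof. by move=> rr z [h1 h2]; split => i; rewrite (le_trans _ rr). Qed.

Lemma vanishes_off_le r r' f : r <= r' -> vanishes_off r f -> vanishes_off r' f.
Proof. by move=> rr hf z nz; apply: hf => /(box_le rr). Qed.

Lemma tfun_add f g : tfun f -> tfun g -> tfun (fun z => f z + g z).
Proof.
move=> [ef [r hr]] [eg [r' hr']]; split; first exact: elem_add.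
exists (Num.max r r') => z nz.
have m1 : r <= Num.max r r' by rewrite le_max lexx.
have m2 : r' <= Num.max r r' by rewrite le_max lexx orbT.
by rewrite (vanishes_off_le m1 hr nz) (vanishes_off_le m2 hr' nz) addr0.
Qed.

Lemma tfun_mull f g : tfun f -> elem g -> tfun (fun z => g z * f z).
Proof.
move=> [ef [r hr]] eg; split; first exact: elem_mul.
by exists r => z nz; rewrite hr// mulr0.
Qed.

Lemma tfun_mulr f g : tfun f -> elem g -> tfun (fun z => f z * g z).
Proof. by move=> hf eg; under eq_fun do rewrite mulrC; exact: tfun_mull. Qed.

Lemma tfun_scale c f : tfun f -> tfun (fun z => c * f z).
Proof. by move=> hf; apply: tfun_mull => //; exact: elem_cst. Qed.

Lemma tfun0 : tfun (fun=> 0).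
Proof. by split; [exact: elem_cst|exists 0]. Qed.

Lemma vanishes_off_derive r f v : vanishes_off r f -> vanishes_off r ('D_v f).
Proof.
move=> hr z nz; have : \near z, cst 0 z = f z.
  have ob : open (~` box r) by rewrite openC; exact: closed_box.
  apply: filterS (open_nbhs_nbhs (conj ob nz)) => w nw.
  by rewrite hr.
by move=> /(near_eq_derive v) <-; rewrite derive_cst.
Qed.

Lemma tfun_derive v f : tfun f -> tfun ('D_v f).
Proof.
move=> [ef [r hr]]; split; first exact: elem_derive.
by exists r; exact: vanishes_off_derive.
Qed.

Lemma tfun_bounded f : tfun f -> exists2 C, 0 <= C & forall z, `|f z| <= C.
Proof.
move=> [ef [r hr]].
have : compact (f @` box r).
  apply: continuous_compact; last exact: compact_box.
  by apply: continuous_subspaceT; exact: elem_continuous.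
move=> /compact_bounded [M [_ hM]]; exists (`|M| + 1) => [|z]; first by rewrite addr_ge0.
have [bz|nbz] := pselect (box r z); last by rewrite hr// normr0 addr_ge0.
apply: (hM (`|M| + 1)); last by exists z.
by rewrite (le_lt_trans (ler_norm M))// ltrDl.
Qed.

Lemma tfun_l2 f : tfun f -> l2 mu f.
Proof.
move=> hf; have [C _ hC] := tfun_bounded hf; have [ef [r hr]] := hf.
apply: (l2_bounded_support (measurable_box _ _ r).1 (measurable_box _ _ r).2 _ hC hr).
exact: elem_measurable.
Qed.

Lemma tfun_integ f : tfun f -> integ mu f.
Proof.
move=> hf; have [C _ hC] := tfun_bounded hf; have [ef [r hr]] := hf.
apply: (integ_bounded_support (measurable_box _ _ r).1 (measurable_box _ _ r).2 _ hC hr).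
exact: elem_measurable.
Qed.

Lemma box_translate r t z s : box r (z + s) -> box t s -> box (r + t) z.
Proof.
move=> [h1 h2] [g1 g2]; split => i.
  rewrite (_ : z.1 0 i = (z + s).1 0 i - s.1 0 i); last by rewrite !mxE addrK.
  by rewrite (le_trans (ler_normB _ _))// lerD.
rewrite (_ : z.2 0 i = (z + s).2 0 i - s.2 0 i); last by rewrite !mxE addrK.
by rewrite (le_trans (ler_normB _ _))// lerD.
Qed.

Lemma exists_box z : exists2 r, 0 <= r & box r z.
Proof.
exists (\sum_i `|z.1 0 i| + \sum_j `|z.2 0 j|).
  by rewrite addr_ge0//; apply: sumr_ge0.
split => i.
  rewrite (bigD1 i)//= -addrA lerDl addr_ge0//; apply: sumr_ge0 => //.
rewrite (bigD1 i (P := xpredT) (F := fun j => `|z.2 0 j|))//= addrCA lerDl addr_ge0//; apply: sumr_ge0 => //.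
Qed.

Lemma tfun_translate s f : tfun f -> tfun (fun z => f (z + s)).
Proof.
move=> [ef [r hr]]; split; first exact: elem_translate.
have [t t0 bs] := exists_box s; exists (r + t) => z nz.
by apply: hr => /box_translate /(_ bs).
Qed.

Lemma box_opp r z : box r (- z) <-> box r z.
Proof. by split => -[h1 h2]; split => i; [have := h1 i|have := h2 i|have := h1 i|have := h2 i]; rewrite !mxE normrN. Qed.

Lemma tfun_reflect s f : tfun f -> tfun (fun z => f (s - z)).
Proof.
move=> [ef [r hr]]; split; first exact: elem_reflect.
have [t t0 bs] := exists_box s; exists (r + t) => z nz.
apply: hr; rewrite -box_opp opprB => h; apply: nz.
by apply: (box_translate h); rewrite box_opp.
Qed.

Lemma tfun_test (hl : (1 <= l)%N) t f : tfun f -> 0 < t ->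
  (forall z, z.2 0 (last_index hl) <= t -> f z = 0) ->
  test_function (half_space hl) f.
Proof.
move=> [ef [r hr]] t0 ht; split; first exact: elem_smooth.
  apply: (@subclosed_compact _ _ (box r)); [exact: closed_closure|exact: compact_box|].
  rewrite ((closure_id (box r)).1 (@closed_box r)).
  apply: closureS => z /= fz; apply: contrapT => /hr/eqP.
  by rewrite (negPf fz).
have cl : closed [set z : E | t <= z.2 0 (last_index hl)].
  apply: (@preimage_closed _ _ (fun z : E => z.2 0 (last_index hl)) [set x | t <= x]).
    by move=> z _; have := elem_continuous (@elem_y R N l (last_index hl)); apply.
  exact: closed_ge.
apply: (@subset_trans _ [set z : E | t <= z.2 0 (last_index hl)]); last first.
  by move=> z /= /(lt_le_trans t0).
rewrite ((closure_id _).1 cl).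
apply: closureS => z /= fz; rewrite leNgt; apply: contra fz => /ltW/ht ->.
by [].
Qed.

End bounded_support.

(** * Density of test functions *)

Section density.
Context (R : realType) (N l : nat).
Local Notation E := ('rV[R]_N * 'rV[R]_l)%type.
Local Notation mu := (lebesgue_space R N l).
Local Notation box := (@box R N l).
Implicit Types (z v s : E) (f g phi : E -> R).

Definition qx z : R := \sum_i z.1 0 i ^+ 2.
Definition qy z : R := \sum_j z.2 0 j ^+ 2.

Lemma elem_qx : elem qx.
Proof. by apply: elem_sum => i; apply: elem_exprn; exact: elem_x. Qed.

Lemma elem_qy : elem qy.
Proof. by apply: elem_sum => i; apply: elem_exprn; exact: elem_y. Qed.

Lemma qx_ge0 z : 0 <= qx z. Proof. by apply: sumr_ge0 => i _; exact: sqr_ge0. Qed.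
Lemma qy_ge0 z : 0 <= qy z. Proof. by apply: sumr_ge0 => i _; exact: sqr_ge0. Qed.

Lemma derive_qx v z : 'D_v qx z = 2 * \sum_i v.1 0 i * z.1 0 i.
Proof.
rewrite /qx derive_sumE; last by move=> i; apply: elem_exprn; exact: elem_x.
rewrite mulr_sumr; apply: eq_bigr => i _.
by rewrite derive_sqE ?derive_xE; [ring|exact: elem_x].
Qed.

Lemma derive_qy v z : 'D_v qy z = 2 * \sum_j v.2 0 j * z.2 0 j.
Proof.
rewrite /qy derive_sumE; last by move=> i; apply: elem_exprn; exact: elem_y.
rewrite mulr_sumr; apply: eq_bigr => i _.
by rewrite derive_sqE ?derive_yE; [ring|exact: elem_y].
Qed.

Lemma qx_ge z i : z.1 0 i ^+ 2 <= qx z.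
Proof. by rewrite /qx (bigD1 i)//= lerDl; apply: sumr_ge0 => k _; exact: sqr_ge0. Qed.

Lemma qy_ge z i : z.2 0 i ^+ 2 <= qy z.
Proof. by rewrite /qy (bigD1 i)//= lerDl; apply: sumr_ge0 => k _; exact: sqr_ge0. Qed.

Lemma sqr_lt_sqr (x e : R) : 0 <= e -> x ^+ 2 < e ^+ 2 -> `|x| <= e.
Proof.
move=> e0; rewrite -[x ^+ 2]real_normK ?num_real// ltr_sqr ?nnegrE// => /ltW.
exact.
Qed.

Lemma sqr_lt_abs (x r : R) : x ^+ 2 < r -> `|x| <= r + 1.
Proof.
move=> xr; rewrite leNgt; apply/negP => h.
have r0 : 0 < r by rewrite (le_lt_trans _ xr)// sqr_ge0.
have : (r + 1) ^+ 2 < `|x| ^+ 2 by rewrite ltr_sqr ?nnegrE// addr_ge0// ltW.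
rewrite real_normK ?num_real//; have : 0 <= r * r by rewrite mulr_ge0// ltW.
rewrite [(r + 1) ^+ 2]expr2; lra.
Qed.

Definition bump r z := flat 0 (r - (qx z + qy z)).

Lemma elem_bump r : elem (bump r).
Proof.
apply: elem_flat; apply: elem_sub; first exact: elem_cst.
by apply: elem_add; [exact: elem_qx|exact: elem_qy].
Qed.

Lemma bump_ge0 r z : 0 <= bump r z. Proof. exact: flat_ge0. Qed.

Lemma flat_gt0P n (t : R) : 0 < flat n t -> 0 < t.
Proof. by rewrite /flat; case: ifP => //; rewrite ltxx. Qed.

Lemma tfun_bump r : tfun (bump r).
Proof.
split; first exact: elem_bump.
exists (r + 1) => z nz; apply: flat_le0; rewrite subr_le0 leNgt; apply/negP => h.
apply: nz; split => i; apply: sqr_lt_abs; apply: (le_lt_trans _ h).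
  by rewrite (le_trans (qx_ge z i))// lerDl qy_ge0.
by rewrite (le_trans (qy_ge z i))// lerDr qx_ge0.
Qed.

Lemma flat0_cvg1 (c : R) : 0 < c -> (fun n => flat 0 (n%:R * c)) @ \oo --> (1 : R).
Proof.
move=> c0; apply: cvgn_shiftS.
rewrite (_ : (fun n => _) = fun n => expR (- (c^-1 * (n.+1%:R)^-1))); last first.
  by apply/funext => n; rewrite flat_gt0E ?mulr_gt0// expr0 mul1r invfM [c^-1 * _]mulrC.
have : (fun n => expR (- (c^-1 * (n.+1%:R)^-1))) @ \oo --> expR (0 : R).
  apply: continuous_cvg; first exact: continuous_expR.
  rewrite -[X in _ --> X]oppr0; apply: cvgN; rewrite -(mulr0 c^-1).
  by apply: cvgMl_tmp; exact: cvg_harmonic.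
by rewrite expR0.
Qed.

(** Positivity sets of nonnegative tests play the role of open boxes. *)
Definition posset (A : set E) :=
  exists2 phi, tfun phi & (forall z, 0 <= phi z) /\ A = [set z | 0 < phi z].

Lemma posset_measurable A : posset A -> measurable A.
Proof.
move=> [phi [ef _] [_ ->]]; rewrite (_ : mkset _ = phi @^-1` `]0, +oo[).
  by rewrite -[X in measurable X]setTI; apply: elem_measurable => //; exact: measurable_itv.
by apply/seteqP; split => z /=; rewrite in_itv/= andbT.
Qed.

Lemma posset_setI A B : posset A -> posset B -> posset (A `&` B).
Proof.
move=> [f tf [f0 ->]] [g tg [g0 ->]].
exists (fun z => f z * g z); first by apply: tfun_mulr => //; case: tg.
split=> [z|]; first exact: mulr_ge0.
apply/seteqP; split => z /=.
  by move=> [? ?]; exact: mulr_gt0.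
move: (f0 z); rewrite le_eqVlt => /predU1P[<-|fz]; first by rewrite mul0r ltxx.
by rewrite pmulr_rgt0.
Qed.

Lemma posset_bump r : posset [set z | 0 < bump r z].
Proof. by exists (bump r); [exact: tfun_bump|split => // z; exact: bump_ge0]. Qed.

Lemma bump_exhaust z : \forall n \near \oo, 0 < bump n%:R z.
Proof.
near=> n; apply: flat_gt0; rewrite subr_gt0.
by near: n; exact: nbhs_infty_gtr.
Unshelve. all: by end_near.
Qed.

Lemma posset_cover_coor (c : E -> R) t : elem c ->
  <<s posset >> [set z | t < c z].
Proof.
move=> ec.
rewrite (_ : mkset _ = \bigcup_n [set z | 0 < flat 0 (c z - t) * bump n%:R z]).
  apply: sigma_algebra_bigcup => n; apply: sub_gen_smallest.
  exists (fun z => flat 0 (c z - t) * bump n%:R z).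
    apply: tfun_mull; first exact: tfun_bump.
    by apply: elem_flat; apply: elem_sub => //; exact: elem_cst.
  by split => // z; rewrite mulr_ge0// flat_ge0.
apply/seteqP; split => z /=.
  move=> tz; have [n _ hn] := bump_exhaust z; exists n => //=.
  by rewrite mulr_gt0//; [apply: flat_gt0; rewrite subr_gt0|exact: (hn n (leqnn n))].
move=> [n _ /= h]; rewrite -subr_gt0; apply: (@flat_gt0P 0).
by rewrite lt_neqAle flat_ge0 andbT; apply/eqP => h0; move: h; rewrite -h0 mul0r ltxx.
Qed.

(** Coordinate half spaces are exhausted by positivity sets, so these generate
    the measurable sets; they are stable under intersection, as the monotone
    class theorem requires. *)
Lemma measurable_possetE : @measurable _ E = <<s posset >>.
Proof.
apply/seteqP; split; last first.
  apply: smallest_sub; first exact: sigma_algebra_measurable.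
  exact: posset_measurable.
pose T' := g_sigma_algebraType posset.
have mc (c : E -> R) : elem c -> measurable_fun [set: T'] c.
  move=> ec; apply: (measurability _ (RGenOInfty.measurableE R)) => _ [_ [x ->] <-].
  rewrite setTI (_ : _ @^-1` _ = [set z | x < c z]); first exact: posset_cover_coor.
  by apply/seteqP; split => z /=; rewrite in_itv/= andbT.
have mid : measurable_fun [set: T'] (fun z : T' => ((z : E).1, (z : E).2)).
  apply: measurable_fun_pair.
    by apply: measurable_fun_rV => i; apply: mc; exact: elem_x.
  by apply: measurable_fun_rV => i; apply: mc; exact: elem_y.
move=> A mA; have := mid measurableT A mA; rewrite setTI.
by rewrite (_ : _ @^-1` A = A)//; apply/seteqP; split => -[].
Qed.

Definition approx f := l2 mu f /\
  forall e, 0 < e -> exists2 phi, tfun phi & nsq mu (fun z => f z - phi z) <= e.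

Lemma approx_tfun f : tfun f -> approx f.
Proof.
move=> tf; split; first exact: tfun_l2.
move=> e e0; exists f => //; rewrite /nsq.
by under eq_Rintegral do rewrite subrr expr2 mul0r; rewrite Rint0 ltW.
Qed.

Lemma approx_add f g : approx f -> approx g -> approx (fun z => f z + g z).
Proof.
move=> [lf af] [lg ag]; split; first exact: l2D.
move=> e e0; have e4 : 0 < e / 4 by rewrite divr_gt0.
have [phi tphi h1] := af _ e4; have [psi tpsi h2] := ag _ e4.
exists (fun z => phi z + psi z); first exact: tfun_add.
rewrite (_ : (fun z => _) = fun z => (f z - phi z) + (g z - psi z)); last first.
  by apply/funext => z; ring.
apply: (le_trans (nsqD_le _ _)); [by apply: l2B => //; exact: tfun_l2|by apply: l2B => //; exact: tfun_l2|].
lra.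
Qed.

Lemma approx_scale c f : approx f -> approx (fun z => c * f z).
Proof.
move=> [lf af]; split; first exact: l2Z.
move=> e e0; have c1 : 0 < c ^+ 2 + 1 by rewrite ltr_wpDl ?sqr_ge0.
have [phi tphi h] := af (e / (c ^+ 2 + 1)) (divr_gt0 e0 c1).
exists (fun z => c * phi z); first exact: tfun_scale.
rewrite (_ : (fun z => _) = fun z => c * (f z - phi z)); last by apply/funext => z; ring.
rewrite nsqZ; last by apply: l2B => //; exact: tfun_l2.
move: h; rewrite ler_pdivlMr// mulrDr mulr1 => h.
by rewrite mulrC (le_trans _ h)// lerDl nsq_ge0.
Qed.

Lemma approx_sub f g : approx f -> approx g -> approx (fun z => f z - g z).
Proof.
move=> hf hg; under eq_fun do rewrite -[X in _ + X]mulN1r.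
by apply: approx_add => //; exact: approx_scale.
Qed.

Lemma approx_cvg (f_ : nat -> E -> R) f : (forall n, approx (f_ n)) -> l2 mu f ->
  (fun n => nsq mu (fun z => f_ n z - f z)) @ \oo --> 0 -> approx f.
Proof.
move=> hf lf c; split => // e e0; have e4 : 0 < e / 4 by rewrite divr_gt0.
have /cvgrPdist_le/(_ _ e4) [n _ /(_ n (leqnn n))/=] := c.
rewrite sub0r normrN ger0_norm ?nsq_ge0// => hn.
have [ln /(_ _ e4) [phi tphi h]] := hf n; exists phi => //.
rewrite (_ : (fun z => _) = fun z => (f z - f_ n z) + (f_ n z - phi z)); last first.
  by apply/funext => z; ring.
apply: (le_trans (nsqD_le _ _)); [exact: l2B|by apply: l2B => //; exact: tfun_l2|].
rewrite nsqBC; lra.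
Qed.

Lemma posset_lty A : posset A -> (mu A < +oo)%E.
Proof.
move=> pA; have mA := posset_measurable pA; case: pA mA => phi [_ [r hr]] [_ ->] mA.
apply: le_lt_trans (measurable_box _ _ r).2; apply: le_measure; rewrite ?inE//.
  exact: (measurable_box _ _ r).1.
by move=> z /= pz; apply: contrapT => /hr h; move: pz; rewrite h ltxx.
Qed.

(** The functions [flat 0 (n * phi)] increase to the indicator of [phi > 0]. *)
Lemma approx_posset A : posset A -> approx (\1_A).
Proof.
move=> pA; have mA := posset_measurable pA; have fA := posset_lty pA.
case: pA mA fA => phi [ephi [r hr]] [phi0 ->] mA fA.
pose f_ n z := flat 0 (n%:R * phi z).
have af n : approx (f_ n).
  apply: approx_tfun; split; first by apply: elem_flat; exact: elem_scale.
  by exists r => z nz; rewrite /f_ hr// mulr0 flat_le0.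
have [||||] := @l2dct _ E R mu f_ (\1_[set z | 0 < phi z]) (\1_[set z | 0 < phi z]).
- by move=> n; case: (af n) => -[].
- move=> z; rewrite indicE; case: (boolP (z \in _)) => [|].
    by rewrite inE/= => pz; exact: flat0_cvg1.
  rewrite notin_setE/= => pz.
  have e : phi z = 0 by apply/eqP; rewrite eq_le phi0 andbT leNgt; exact/negP.
  by rewrite /f_ e; under eq_fun do rewrite mulr0 flat_le0//; exact: cvg_cst.
- exact: l2_indic.
- move=> n z; rewrite ger0_norm ?flat_ge0// indicE; case: (boolP (z \in _)) => [|].
    by move=> _; exact: flat0_le1.
  rewrite notin_setE/= => pz.
  have e : phi z = 0 by apply/eqP; rewrite eq_le phi0 andbT leNgt; exact/negP.
  by rewrite /f_ e mulr0 flat_le0.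
- by move=> l2i; exact: approx_cvg.
Qed.

Lemma indicB_setC (A B : set E) z : \1_(~` A `&` B) z = \1_B z - \1_(A `&` B) z :> R.
Proof.
rewrite !indicE !in_setI in_setC.
by case: (z \in A); case: (z \in B); rewrite /= ?subrr ?subr0.
Qed.

(** Monotone class argument. Intersecting with [B] keeps the measures finite. *)
Lemma approx_indic A B : measurable A -> posset B -> approx (\1_(A `&` B)).
Proof.
move=> mA; have : <<s posset >> A by rewrite -measurable_possetE.
move: A mA B => A mA B /[swap].
move: A {mA} B.
suff h : forall A, <<s posset >> A -> forall B, posset B -> approx (\1_(A `&` B)).
  by move=> A B pB sA; exact: h.
apply: (@dynkin_induction _ E posset (fun A => forall B, posset B -> approx (\1_(A `&` B)))).
- exact: measurable_possetE.
- exact: posset_setI.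
- by move=> B pB; rewrite setTI; exact: approx_posset.
- by move=> A pA B pB; apply: approx_posset; exact: posset_setI.
- move=> A mA hA B pB.
  rewrite (_ : \1_(_ `&` _) = fun z => \1_B z - \1_(A `&` B) z :> R); last first.
    by apply/funext => z; exact: indicB_setC.
  by apply: approx_sub; [exact: approx_posset|exact: hA].
- move=> F mF tF hF B pB.
  pose f_ n : E -> R := \1_((\bigcup_(k in `I_n) F k) `&` B).
  have mf n : measurable ((\bigcup_(k in `I_n) F k) `&` B).
    apply: measurableI; last exact: posset_measurable.
    by apply: bigcup_measurable => k _; exact: mF.
  have af n : approx (f_ n).
    elim: n => [|n IH].
      rewrite /f_ II0 bigcup_set0 set0I indic0.
      exact: (approx_tfun (tfun0 _ _ _)).
    rewrite (_ : f_ n.+1 = fun z => f_ n z + \1_(F n `&` B) z); last first.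
      apply/funext => z; rewrite /f_ !indicE !in_setI.
      case: (z \in B); rewrite ?andbT ?andbF ?addr0//.
      have -> : (z \in \bigcup_(k in `I_n.+1) F k) = (z \in \bigcup_(k in `I_n) F k) || (z \in F n).
        by rewrite -in_setU; congr (_ \in _); rewrite IIS bigcup_setU bigcup_set1.
      case: (boolP (z \in \bigcup_(k in `I_n) F k)) => [|_]; last by rewrite add0r.
      rewrite inE => -[k /= kn Fk].
      rewrite (_ : (z \in F n) = false) ?addr0//.
      apply/negbTE/negP; rewrite inE => Fn.
      have := tF k n I I; rewrite /= => /(_ (ex_intro _ z (conj Fk Fn))) e.
      by move: kn; rewrite e ltnn.
    by apply: approx_add => //; exact: hF.
  have mU : measurable (\bigcup_k F k `&` B).
    apply: measurableI; last exact: posset_measurable.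
    exact: bigcupT_measurable.
  have fU : (mu (\bigcup_k F k `&` B) < +oo)%E.
    apply: le_lt_trans (posset_lty pB); apply: le_measure; rewrite ?inE//.
    exact: posset_measurable.
  have [||||] := @l2dct _ E R mu f_ (\1_(\bigcup_k F k `&` B)) (\1_(\bigcup_k F k `&` B)).
  + by move=> n; apply: measurable_indic.
  + move=> z; apply: cvg_near_cst.
    have [[[k _ Fk] Bz]|nz] := pselect ((\bigcup_k F k `&` B) z).
      near=> n; rewrite /f_ !indicE [z \in \bigcup_k F k `&` B]mem_set; last by split => //; exists k.
      rewrite mem_set//; split => //; exists k => //=.
      by near: n; exact: nbhs_infty_gt.
    apply: nearW => n; rewrite /f_ !indicE !memNset// => -[[k _ Fk] Bz].
    by apply: nz; split => //; exists k.
  + exact: l2_indic.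
  + move=> n z; rewrite /f_ ger0_norm// !indicE ler_nat.
    case: (boolP (z \in _ `&` B)) => //; rewrite inE => -[[k _ Fk] Bz].
    by rewrite mem_set//; split => //; exists k.
  + by move=> l2i; exact: approx_cvg.
Unshelve. all: by end_near.
Qed.

Import HBNNSimple.

Lemma approx_nonneg f : l2 mu f -> (forall z, 0 <= f z) -> approx f.
Proof.
move=> lf f0; have [mf _] := lf.
have mEf : measurable_fun [set: E] (EFin \o f) by exact/measurable_EFinP.
pose g := nnsfun_approx measurableT mEf.
pose f_ n z := g n z * \1_[set z | 0 < bump n%:R z] z.
have gc z : g ^~ z @ \oo --> f z.
  have := @cvg_nnsfun_approx _ E R setT measurableT _ mEf (fun z _ => f0 z) z I.
  by move=> /fine_cvgP[_].
have gle n z : g n z <= f z.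
  apply: (@le_cvgn _ (fun=> g n z) (fun m => g (m + n)%N z)) => [||m].
  - exact: cvg_cst.
  - by rewrite (cvg_shiftn n (fun m => g m z)).
  - by have /lefP := @nd_nnsfun_approx _ E R setT measurableT _ mEf n (m + n)%N (leq_addl _ _); exact.
have ind (A B : set E) : (fun z => \1_A z * \1_B z) = \1_(A `&` B) :> (E -> R) by rewrite indicI.
have af n : approx (f_ n).
  rewrite /f_; under eq_fun do rewrite fimfunEord mulr_suml.
  elim: (index_enum _) => [|i r IH].
    by under eq_fun do rewrite big_nil; exact: (approx_tfun (tfun0 _ _ _)).
  under eq_fun do rewrite big_cons.
  apply: approx_add => //; under eq_fun do rewrite -mulrA.
  apply: approx_scale; rewrite ind; apply: approx_indic.
    exact: measurable_funPTI.
  exact: posset_bump.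
have [||||] := @l2dct _ E R mu f_ f f.
- by move=> n; case: (af n) => -[].
- move=> z; apply: cvg_trans (gc z); apply: near_eq_cvg.
  have := bump_exhaust z; apply: filterS => n bz.
  by rewrite /f_ indicE mem_set// mulr1.
- exact: lf.
- move=> n z; rewrite ger0_norm; last by rewrite mulr_ge0.
  have i1 : \1_[set z | 0 < bump n%:R z] z <= 1 :> R.
    by rewrite indicE; case: (z \in _); rewrite ?ler01.
  by rewrite (le_trans _ (gle n z))// ler_piMr.
- by move=> _; exact: approx_cvg.
Qed.

(** Splitting into positive and negative parts, approximation by simple
    functions cut off by bumps, and the case of indicators. *)
Lemma density f : l2 mu f -> approx f.
Proof.
move=> lf; have [mf _] := lf.
pose fp z := Num.max (f z) 0; pose fn z := Num.max (- f z) 0.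
have fE z : f z = fp z - fn z.
  by rewrite /fp /fn !maxEle; case: ifPn => h; case: ifPn => k; lra.
have le z : `|fp z| <= `|f z| /\ `|fn z| <= `|f z|.
  by rewrite /fp /fn !maxEle; split; case: ifPn => h; rewrite ?normr0 ?normrN.
rewrite (_ : f = fun z => fp z - fn z); last exact/funext.
apply: approx_sub; apply: approx_nonneg => //.
- by apply: (l2_le _ lf) => [|z]; [exact: measurable_maxr|exact: (le z).1].
- by move=> z; rewrite le_max lexx orbT.
- apply: (l2_le _ lf) => [|z]; last exact: (le z).2.
  by apply: measurable_maxr => //; exact: measurable_funN.
- by move=> z; rewrite le_max lexx orbT.
Qed.

End density.

(** * Continuity of translations *)

Section translations.
Context (R : realType) (N l : nat).
Local Notation E := ('rV[R]_N * 'rV[R]_l)%type.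
Local Notation mu := (lebesgue_space R N l).
Local Notation box := (@box R N l).
Implicit Types (z v s : E) (f g phi psi : E -> R).

Lemma box_norm r s : 0 <= r -> box r s -> `|s| <= r.
Proof.
move=> r0 [h1 h2]; rewrite prod_normE ge_max; apply/andP; split.
  rewrite [leLHS]mx_normrE; apply: bigmax_le => // -[i j] _ /=.
  by rewrite ord1.
rewrite [leLHS]mx_normrE; apply: bigmax_le => // -[i j] _ /=.
by rewrite ord1.
Qed.

Lemma box_scale r t (e : E) : box r e -> box (`|t| * r) (t *: e).
Proof. by move=> [h1 h2]; split => i; rewrite mxE normrM ler_wpM2l. Qed.

Lemma cvg_translate f z (s_ : nat -> E) : continuous f ->
  (forall n, box n.+1%:R^-1 (s_ n)) ->
  (fun n => f (z + s_ n)) @ \oo --> f z.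
Proof.
move=> cf hs; apply: (@cvg_comp _ _ _ (fun n => z + s_ n) f _ (nbhs z)); last exact: cf.
suff : (fun n => z + s_ n) @ \oo --> z + 0 by rewrite addr0.
apply: cvgD; first exact: cvg_cst.
apply/cvgrPdist_le => e e0; near=> n.
rewrite sub0r normrN (le_trans (box_norm _ (hs n)))//.
near: n; have := @cvg_harmonic R => /cvgrPdist_le/(_ e e0); apply: filterS => n.
by rewrite /harmonic/= sub0r normrN ger0_norm.
Unshelve. all: by end_near.
Qed.

(** By density it is enough to treat test functions, which are continuous with
    bounded support. *)
Lemma l2_translate_continuous f : l2 mu f -> forall e, 0 < e ->
  exists2 d, 0 < d & forall s, box d s -> nsq mu (fun z => f (z + s) - f z) <= e.
Proof.
move=> lf e e0; have e8 : 0 < e / 10 by rewrite divr_gt0.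
have [_ /(_ _ e8) [phi tphi hphi]] := density lf.
have lphi := tfun_l2 tphi.
suff [d d0 hd] : exists2 d, 0 < d & forall s, box d s ->
    nsq mu (fun z => phi (z + s) - phi z) <= e / 10.
  exists d => // s /hd h.
  rewrite (_ : (fun z => _) = fun z => (f (z + s) - phi (z + s)) +
    ((phi (z + s) - phi z) + (phi z - f z))); last by apply/funext => z; ring.
  have l1 : l2 mu (fun z => f (z + s) - phi (z + s)).
    by apply: l2B; apply: (l2_translate s).
  have l3 : l2 mu (fun z => phi (z + s) - phi z).
    by apply: l2B => //; apply: (l2_translate s).
  have l4 : l2 mu (fun z => phi z - f z) by exact: l2B.
  have := nsqD_le l1 (l2D l3 l4); have := nsqD_le l3 l4.
  have -> : nsq mu (fun z => f (z + s) - phi (z + s)) = nsq mu (fun z => f z - phi z).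
    exact: (nsq_translate s (l2B lf lphi)).
  rewrite [nsq mu (fun z => phi z - f z)]nsqBC; lra.
apply: contrapT => hn.
have hn' n : exists s, box n.+1%:R^-1 s /\ e / 10 < nsq mu (fun z => phi (z + s) - phi z).
  apply: contrapT => hs; apply: hn; exists n.+1%:R^-1; first by rewrite invr_gt0.
  move=> s bs; rewrite leNgt; apply/negP => h; apply: hs; by exists s.
have [s_ hs_] := choice hn'.
have [C C0 hC] := tfun_bounded tphi; have [ephi [r hr]] := tphi.
have [||||_ c] := @l2dct _ E R mu (fun n z => phi (z + s_ n)) phi (fun z => C * \1_(box (`|r| + 1)) z).
- by move=> n; apply: measurable_fun_translate; exact: elem_measurable.
- move=> z; apply: cvg_translate; first exact: elem_continuous.
  by move=> n; case: (hs_ n).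
- by apply: l2Z; apply: l2_indic; case: (measurable_box N l (`|r| + 1)).
- move=> n z; rewrite indicE; case: (boolP (z \in _)) => [_|]; first by rewrite mulr1.
  rewrite notin_setE => nz; rewrite mulr0 hr ?normr0// => h; apply: nz.
  have [hsn _] := hs_ n; apply: (@box_le _ _ _ (r + n.+1%:R^-1)).
    by rewrite lerD ?ler_norm// invf_le1// ler1n.
  exact: (box_translate h hsn).
have e92 : 0 < e / 10 by [].
have /cvgrPdist_lt/(_ _ e92) [n _ /(_ n (leqnn n))/=] := c.
rewrite sub0r normrN ger0_norm ?nsq_ge0//.
by have [_] := hs_ n => /lt_trans h /h; rewrite ltxx.
Qed.

Lemma bump_cvg1 z : (fun n => bump n%:R z) @ \oo --> (1 : R).
Proof.
apply/cvgrPdist_le => e e0; near=> n.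
have h : 0 < n%:R - (qx z + qy z).
  by rewrite subr_gt0; near: n; exact: nbhs_infty_gtr.
rewrite ger0_norm ?subr_ge0 ?flat0_le1// /bump flat_gt0E// expr0 mul1r.
apply: (@le_trans _ _ (n%:R - (qx z + qy z))^-1).
  by rewrite lerBlDr -lerBlDl -[leLHS]/(1 - _) expR_ge1Dx.
rewrite -[leRHS]invrK lef_pV2 ?posrE ?invr_gt0// lerBrDr.
near: n; exact: nbhs_infty_ger.
Unshelve. all: by end_near.
Qed.

Lemma is_derive_line f v z (t : R) : elem f ->
  is_derive t (1 : R) (fun t => f (z + t *: v)) ('D_v f (z + t *: v)).
Proof.
move=> ef; have := @elem_derivable _ _ _ f v (z + t *: v) ef.
have e : (fun h : R => h^-1 *: ((f \o shift (z + t *: v)) (h *: v) - f (z + t *: v))) =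
   (fun h : R => h^-1 *: (((fun t => f (z + t *: v)) \o shift t) (h *: 1) - f (z + t *: v))).
  apply/funext => h /=; congr (_ *: (f _ - _)).
  by rewrite [h *: 1]mulr1 scalerDl addrCA.
rewrite /derivable e => h; apply: DeriveDef => //.
by rewrite /derive -e.
Qed.

(** The constant is not sharp: two applications of the mean value theorem
    suffice. *)
Lemma taylor2 (g g1 g2 : R -> R) (C h : R) : 0 <= h ->
  (forall t, is_derive t (1 : R) g (g1 t)) ->
  (forall t, is_derive t (1 : R) g1 (g2 t)) -> (forall t, `|g2 t| <= C) ->
  `|g h - g 0 - h * g1 0| <= C * h ^+ 2.
Proof.
move=> h0 d1 d2 gC.
have c1 : {within `[0, h], continuous g}.
  apply: derivable_within_continuous => x _; by have [] := d1 x.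
have [x xh ->] := MVT_segment h0 (fun x _ => d1 x) c1.
have x0 : 0 <= x by move: xh; rewrite in_itv/= => /andP[].
have xh' : x <= h by move: xh; rewrite in_itv/= => /andP[].
have c2 : {within `[0, x], continuous g1}.
  apply: derivable_within_continuous => y _; by have [] := d2 y.
have [y _ e] := MVT_segment x0 (fun x _ => d2 x) c2.
have -> : g1 x * (h - 0) - h * g1 0 = (g1 x - g1 0) * h by ring.
rewrite e subr0 !normrM (ger0_norm h0) (ger0_norm x0).
by rewrite expr2 mulrA ler_wpM2r// ler_pM.
Qed.

Lemma derive_opp_dir v f z : elem f -> 'D_(- v) f z = - 'D_v f z.
Proof.
by move=> ef; rewrite !deriveE ?linearN//; exact: elem_differentiable.
Qed.

End translations.

(** * Weak derivatives and difference quotients *)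

Section weak_derivative.
Context (R : realType) (N l : nat).
Local Notation E := ('rV[R]_N * 'rV[R]_l)%type.
Local Notation mu := (lebesgue_space R N l).
Local Notation box := (@box R N l).
Implicit Types (z v s : E) (a f g phi psi : E -> R).

Definition locally_bounded a :=
  forall r, exists2 C, 0 <= C & forall z, box r z -> `|a z| <= C.

(** [K] is the derivative [a D_v W] in the sense of distributions on the whole
    space; the weight [a] is meant to be constant along [v]. *)
Definition wder a v W K :=
  forall phi, tfun phi -> ip mu W (fun z => a z * 'D_v phi z) = - ip mu K phi.

Lemma l2_weight a phi : measurable_fun setT a -> locally_bounded a -> tfun phi ->
  l2 mu (fun z => a z * phi z).
Proof.
move=> ma la tphi; have [C C0 hC] := tfun_bounded tphi.
have [ephi [r hr]] := tphi; have [A A0 hA] := la r.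
apply: (@l2_bounded_support _ _ _ _ (A * C) (box r)).
- exact: (measurable_box N l r).1.
- exact: (measurable_box N l r).2.
- by apply: measurable_funM => //; exact: elem_measurable.
- move=> z; have [bz|/hr ->] := pselect (box r z); last by rewrite mulr0 normr0 mulr_ge0.
  by rewrite normrM ler_pM// hA.
- by move=> z /hr ->; rewrite mulr0.
Qed.

Section translation_estimate.
Variables (a : E -> R) (v : E) (W K : E -> R).
Hypotheses (ma : measurable_fun setT a) (la : locally_bounded a)
  (av : forall z (t : R), a (z + t *: v) = a z)
  (lW : l2 mu W) (lK : l2 mu K) (dW : wder a v W K).

Let sh phi (t : R) z := phi (z + t *: - v).

Let tsh phi t : tfun phi -> tfun (sh phi t).
Proof. by move=> tphi; exact: tfun_translate. Qed.

Let J phi := ip mu W (fun z => a z * phi z).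

Let JD phi psi : tfun phi -> tfun psi -> J (fun z => phi z + psi z) = J phi + J psi.
Proof.
move=> h1 h2; rewrite /J ![ip mu W _]ipC -ipDl//; [|exact: l2_weight|exact: l2_weight].
by congr (ip mu _ W); apply/funext => z; rewrite mulrDr.
Qed.

Let JZ c phi : tfun phi -> J (fun z => c * phi z) = c * J phi.
Proof.
move=> h1; rewrite /J ![ip mu W _]ipC -ipZl//; last exact: l2_weight.
by congr (ip mu _ W); apply/funext => z; rewrite mulrCA.
Qed.

(** The increment of a translated test function is [h] times its derivative up
    to [h ^ 2], uniformly; the derivative is then moved onto [K]. *)
Lemma wder_step phi (T : R) : tfun phi -> 0 <= T ->
  exists2 C, 0 <= C & forall tau h, 0 <= tau -> 0 <= h -> tau + h <= T ->
    `|J (fun z => sh phi (tau + h) z - sh phi tau z) - h * ip mu K (sh phi tau)|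
      <= C * h ^+ 2.
Proof.
move=> tphi T0; have [ephi [r hr]] := tphi.
have [C2 C20 hC2] := tfun_bounded (tfun_derive (- v) (tfun_derive (- v) tphi)).
have [rv rv0 bv] := exists_box (- v).
pose r' := `|r| + T * rv.
have [A A0 hA] := la r'.
have iB : integ mu (fun z => `|W z| * (A * \1_(box r') z)).
  apply: l2M; last by apply: l2Z; apply: l2_indic; case: (measurable_box N l r').
  by apply: (l2_le _ lW) => [|z]; [apply: measurableT_comp => //; case: lW|rewrite normr_id].
pose B := \int[mu]_z (`|W z| * (A * \1_(box r') z)).
have B0 : 0 <= B by apply: Rint_ge0 => z; rewrite !mulr_ge0.
exists (C2 * B); first exact: mulr_ge0.
move=> tau h tau0 h0 tauh.
pose psi z := sh phi tau z.
have tpsi : tfun psi by exact: tsh.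
pose rem z := sh phi (tau + h) z - sh phi tau z - h * 'D_(- v) psi z.
have trem : tfun rem.
  apply: tfun_add; first apply: tfun_add; first exact: tsh.
    by under eq_fun do rewrite -mulN1r; apply: tfun_scale; exact: tsh.
  under eq_fun do rewrite -mulN1r; apply: tfun_scale; apply: tfun_scale.
  exact: tfun_derive.
have remC z : `|rem z| <= C2 * h ^+ 2.
  pose g (t : R) := phi (z + tau *: - v + t *: - v).
  have := @taylor2 R g _ _ C2 h h0 (fun t => is_derive_line (- v) (z + tau *: - v) t ephi)
    (fun t => is_derive_line (- v) (z + tau *: - v) t (elem_derive (- v) ephi)) (fun t => hC2 _).
  rewrite /g scale0r !addr0 -(addrA z (tau *: - v) (h *: - v)) -scalerDl; apply: le_trans.
  by rewrite /rem /psi /sh derive_translate.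
have sup (s : R) z : 0 <= s -> s <= T -> ~ box r' z -> sh phi s z = 0.
  move=> s0 sT nb; apply: hr => h1; apply: nb.
  have h2 := box_scale s bv; apply: (@box_le _ _ _ (r + `|s| * rv)); last first.
    exact: (box_translate h1 h2).
  by rewrite lerD ?ler_norm// ler_wpM2r// ger0_norm.
have remS z : ~ box r' z -> rem z = 0.
  move=> nb; rewrite /rem !sup//; [|by rewrite (le_trans _ tauh)// lerDl|exact: addr_ge0].
  rewrite (@vanishes_off_derive _ _ _ r')//; first by rewrite mulr0 !subr0.
  by move=> w nw; apply: sup => //; rewrite (le_trans _ tauh)// lerDl.
have -> : J (fun z => sh phi (tau + h) z - sh phi tau z) =
    J rem + h * J ('D_(- v) psi).
  rewrite -JZ; last exact: tfun_derive.
  rewrite -JD//; last by apply: tfun_scale; exact: tfun_derive.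
  by congr J; apply/funext => z; rewrite /rem subrK.
have -> : J ('D_(- v) psi) = ip mu K psi.
  rewrite /J (_ : (fun z => _) = fun z => a z * (-1 * 'D_v psi z)); last first.
    by apply/funext => z; rewrite derive_opp_dir ?mulN1r//; case: tpsi.
  have := JZ (-1) (tfun_derive v tpsi); rewrite /J => ->.
  by rewrite dW// mulN1r opprK.
rewrite addrK; apply: (@le_trans _ _ (\int[mu]_z (C2 * h ^+ 2 * (`|W z| * (A * \1_(box r') z))))).
  apply: Rint_abs_le; [by apply: l2M => //; exact: l2_weight|exact: integZ|].
  move=> z; rewrite !normrM; have [bz|nz] := pselect (box r' z); last first.
    by rewrite remS// normr0 !mulr0 !mulr_ge0// sqr_ge0.
  rewrite indicE mem_set// mulr1 [leRHS]mulrCA ler_wpM2l//.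
  by rewrite [leRHS]mulrC ler_pM// hA.
by rewrite RintZ// mulrAC.
Qed.

(** A shift by [t] is a sum of [n] shifts by [t / n]; the total error of
    [wder_step] is of order [1 / n]. *)
Lemma wder_shift_test phi t : tfun phi -> 0 <= t ->
  J (fun z => sh phi t z - phi z) <= 2^-1 * (t ^+ 2 * nsq mu K + nsq mu phi).
Proof.
move=> tphi t0; have [C C0 hC] := wder_step tphi t0.
pose M := 2^-1 * (t ^+ 2 * nsq mu K + nsq mu phi).
have main n : J (fun z => sh phi t z - phi z) <= M + C * t ^+ 2 / n.+1%:R.
  have n0 : n.+1%:R != 0 :> R by rewrite pnatr_eq0.
  pose h := t / n.+1%:R; have h0 : 0 <= h by rewrite divr_ge0.
  have nh : h * n.+1%:R = t by rewrite /h divfK.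
  have step k : (k <= n.+1)%N -> J (fun z => sh phi (h * k%:R) z - phi z) <=
      k%:R * (C * h ^+ 2 + M / n.+1%:R).
    elim: k => [_|k IH kn].
      rewrite mul0r (_ : (fun z => _) = fun z => 0 * phi z); last first.
        by apply/funext => z; rewrite /sh mulr0 scale0r addr0 subrr mul0r.
      by rewrite JZ// mul0r.
    have -> : (fun z => sh phi (h * k.+1%:R) z - phi z) =
        (fun z => (sh phi (h * k%:R + h) z - sh phi (h * k%:R) z) + (sh phi (h * k%:R) z - phi z)).
      by apply/funext => z; rewrite addrA subrK -[k.+1]addn1 natrD mulrDr mulr1.
    have tsub psi : tfun psi -> tfun (fun z => - psi z).
      by move=> tp; under eq_fun do rewrite -mulN1r; exact: tfun_scale.
    rewrite JD; last 2 first.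
    - by apply: tfun_add; [exact: tsh|apply: tsub; exact: tsh].
    - by apply: tfun_add; [exact: tsh|exact: tsub].
    have hk : h * k%:R + h <= t.
      by rewrite -nh -[X in _ + X]mulr1 -mulrDr ler_wpM2l// natr1 ler_nat.
    have := hC (h * k%:R) h (mulr_ge0 h0 (ler0n _ _)) h0 hk.
    move=> /(le_trans (ler_norm _)); rewrite lerBlDr => h1.
    have h2 : h * ip mu K (sh phi (h * k%:R)) <= M / n.+1%:R.
      rewrite /h mulrAC ler_wpM2r ?invr_ge0// -ipZl//; last by apply: tfun_l2; exact: tsh.
      apply: (le_trans (ler_norm _)); apply: (le_trans (ip_young ltr01 _ _)).
      - exact: l2Z.
      - by apply: tfun_l2; exact: tsh.
      by rewrite invr1 !mul1r nsqZ// /sh nsq_translate//; exact: tfun_l2.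
    rewrite -[k.+1]addn1 natrD mulrDl mul1r addrC lerD//; first exact: (IH (ltnW kn)).
    by rewrite (le_trans h1)// lerD.
  have := step n.+1 (leqnn _); rewrite nh => /le_trans; apply.
  rewrite mulrDr [n.+1%:R * (M / _)]mulrCA mulfV// mulr1 addrC lerD2l.
  rewrite /h le_eqVlt; apply/orP; left; apply/eqP; field.
  by [].
rewrite -/M; have : (fun n => M + C * t ^+ 2 / n.+1%:R) @ \oo --> M + C * t ^+ 2 * 0.
  by apply: cvgD; [exact: cvg_cst|apply: cvgMl_tmp; exact: cvg_harmonic].
rewrite mulr0 addr0 => c; apply: (le_cvgn _ c main); exact: cvg_cst.
Qed.

(** The dual estimate [wder_shift_test] gives the bound on the norm: insert
    test functions approximating the difference quotient itself, truncated by
    bumps because it is not yet known to be in L2. *)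
Lemma wder_shift t : 0 <= t ->
  l2 mu (fun z => a z * (W (z + t *: v) - W z)) /\
  nsq mu (fun z => a z * (W (z + t *: v) - W z)) <= t ^+ 2 * nsq mu K.
Proof.
move=> t0; pose D z := a z * (W (z + t *: v) - W z).
have lWt : l2 mu (fun z => W (z + t *: v)) by exact: (l2_translate (t *: v)).
have mD : measurable_fun setT D.
  apply: measurable_funM => //; apply: measurable_funB; [by case: lWt|by case: lW].
have dual phi : tfun phi -> ip mu D phi <= 2^-1 * (t ^+ 2 * nsq mu K + nsq mu phi).
  move=> tphi; apply: le_trans (wder_shift_test tphi t0); rewrite le_eqVlt; apply/orP; left; apply/eqP.
  have la1 := l2_weight ma la tphi.
  have la2 := l2_weight ma la (tsh t tphi).
  transitivity (ip mu (fun z => W (z + t *: v)) (fun z => a z * phi z) - ip mu W (fun z => a z * phi z)).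
    rewrite -ipBl//; apply: eq_Rintegral => z _; rewrite /D; ring.
  have -> : ip mu (fun z => W (z + t *: v)) (fun z => a z * phi z) = J (sh phi t).
    rewrite /J -(ip_translate (t *: v) lW la2); apply: eq_Rintegral => z _.
    by rewrite av /sh -addrA scalerN subrr addr0.
  rewrite /J ![ip mu W _]ipC -ipBl//; congr (ip mu _ W).
  by apply/funext => z; rewrite mulrBr.
pose Dn n z := bump n%:R z * D z.
have lDn n : l2 mu (Dn n).
  have [_ [r hr]] := @tfun_bump R N l n%:R; have [A A0 hA] := la r.
  apply: (@l2_le _ _ _ _ _ (fun z => A * (W (z + t *: v) - W z))).
  - by apply: measurable_funM => //; apply: elem_measurable; exact: elem_bump.
  - by apply: l2Z; exact: l2B.
  - move=> z; rewrite /Dn /D !normrM; have [bz|nz] := pselect (box r z); last first.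
      by rewrite hr// normr0 mul0r mulr_ge0.
    rewrite mulrA ler_wpM2r// -[leRHS]mul1r ler_pM//.
      by rewrite ger0_norm ?bump_ge0 ?flat0_le1.
    by rewrite (le_trans (hA _ bz))// ler_norm.
apply: (l2_fatou lDn) => [z|n].
  rewrite -[X in _ --> X]mul1r; apply: cvgM; [exact: bump_cvg1|exact: cvg_cst].
apply/ler_addgt0Pr => e e0.
have [_ /(_ _ e0) [phi tphi hphi]] := density (lDn n).
have lphi := tfun_l2 tphi.
have bphi : tfun (fun z => bump n%:R z * phi z).
  by apply: tfun_mull => //; exact: elem_bump.
have h1 : ip mu (Dn n) phi <= 2^-1 * (t ^+ 2 * nsq mu K + nsq mu phi).
  rewrite (_ : ip mu (Dn n) phi = ip mu D (fun z => bump n%:R z * phi z)); last first.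
    by apply: eq_Rintegral => z _; rewrite /Dn; ring.
  apply: (le_trans (dual _ bphi)); rewrite ler_wpM2l// lerD2l.
  apply: nsq_le => //; first exact: tfun_l2.
  by move=> z; rewrite normrM ler_piMl// ger0_norm ?bump_ge0 ?flat0_le1.
move: hphi; rewrite nsqB// => h2; lra.
Qed.

End translation_estimate.

End weak_derivative.

(** * Reflections and iterated integrals *)

Section sigma_finite.
Context (R : realType) (N l : nat).
Local Notation E := ('rV[R]_N * 'rV[R]_l)%type.

(** Alias of the product measure that carries the sigma-finite structure
    needed for iterated integrals. *)
Definition space_measure : set E -> \bar R := lebesgue_space R N l.

HB.instance Definition _ := Measure.copy space_measure (lebesgue_space R N l).

Let sigma_finite_space : sigma_finite setT space_measure.
Proof.
exists (fun n => @box R N l n%:R) => [|n]; last first.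
  by have [mb fb] := measurable_box N l (n%:R : R).
apply/seteqP; split => z // _.
have [r r0 bz] := exists_box z; exists (Num.bound r) => //.
by apply: box_le bz; exact/ltW/archi_boundP.
Qed.

HB.instance Definition _ := Measure_isSigmaFinite.Build _ _ _ space_measure
  sigma_finite_space.

End sigma_finite.

Section correlation.
Context (R : realType) (N l : nat).
Local Notation E := ('rV[R]_N * 'rV[R]_l)%type.
Local Notation mu := (lebesgue_space R N l).
Local Notation box := (@box R N l).
Implicit Types (z v s : E) (a f g phi psi F K : E -> R).

Lemma lebesgue_rV_opp n (A : set 'rV[R]_n) : measurable A ->
  lebesgue_rV R n (-%R @^-1` A) = lebesgue_rV R n A.
Proof.
elim: n A => [|n IH] A mA.
  by congr (_ _); apply/seteqP; split => w /=; rewrite (_ : - w = w)//; apply/rowP => -[].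
have mpre : measurable (@row_cons R n @^-1` A).
  by rewrite -[X in measurable X]setTI; exact: measurable_row_cons.
transitivity ((lebesgue_measure \x lebesgue_rV R n)%E
  ((fun q => (- q.1, - q.2)) @^-1` (@row_cons R n @^-1` A))).
  rewrite /= /lebesgue_rV_step /pushforward; congr (product_measure1 _ _ _).
  have e c w : - @row_cons R n (c, w) = row_cons (- c, - w).
    apply/rowP => i; rewrite /row_cons !mxE/=.
    by case: unliftP => [j _|_]; rewrite ?mxE.
  by apply/seteqP; split => -[c w] /=; rewrite e.
rewrite (@product_measure_invariant _ _ _ _ _ lebesgue_measure (lebesgue_rV R n)
  -%R -%R)//.
- apply: measurable_fun_rV => i; under eq_fun do rewrite mxE.
  by apply: measurableT_comp => //; exact: measurable_coor.
- by move=> B mB; exact: (lebesgue_measureN mB).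
Qed.

Lemma measurable_opp_space : measurable_fun [set: E] (fun z : E => - z).
Proof.
apply: measurable_fun_pair => /=; apply: measurable_fun_rV => i; under eq_fun do rewrite mxE.
  by apply: measurableT_comp => //; exact: measurable_coorx.
by apply: measurableT_comp => //; exact: measurable_coory.
Qed.

Lemma lebesgue_space_opp (A : set E) : measurable A ->
  mu ((fun z : E => - z) @^-1` A) = mu A.
Proof.
move=> mA; apply: (@product_measure_invariant _ _ _ _ _ (lebesgue_rV R N) (lebesgue_rV R l)
  -%R -%R) => //.
- apply: measurable_fun_rV => i; under eq_fun do rewrite mxE.
  by apply: measurableT_comp => //; exact: measurable_coor.
- apply: measurable_fun_rV => i; under eq_fun do rewrite mxE.
  by apply: measurableT_comp => //; exact: measurable_coor.
- by move=> *; exact: lebesgue_rV_opp.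
- by move=> *; exact: lebesgue_rV_opp.
Qed.

Lemma integ_opp f : integ mu f -> integ mu (fun z => f (- z)).
Proof.
move=> /integrableP[/measurable_EFinP mf fi]; apply/integrableP; split.
  by apply/measurable_EFinP; exact: (measurableT_comp mf measurable_opp_space).
have mnf : measurable_fun setT (fun z => `|(f z)%:E|%E).
  by apply/measurable_EFinP; exact: measurableT_comp.
have := @ge0_integral_pushforward _ _ _ _ _ _ measurable_opp_space mu setT _ measurableT mnf (fun z _ => abse_ge0 _).
rewrite preimage_setT /= => h; rewrite -[X in (X < _)%E]h.
apply: le_lt_trans fi; rewrite le_eqVlt; apply/orP; left; apply/eqP.
apply: eq_measure_integral; first exact: measurable_opp_space.
by move=> mt A mA _; exact: lebesgue_space_opp.
Qed.

Lemma Rint_opp f : integ mu f -> \int[mu]_z f (- z) = \int[mu]_z f z.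
Proof.
move=> hf; have mf := integ_meas hf.
have h := @integral_pushforward _ _ _ _ _ _ measurable_opp_space mu setT (EFin \o f)
  ((measurable_EFinP _ _).2 mf) (integ_opp hf) measurableT.
rewrite /Rintegral; congr fine; rewrite preimage_setT in h; rewrite -[LHS]h.
apply: eq_measure_integral; first exact: measurable_opp_space.
by move=> mt A mA _; exact: lebesgue_space_opp.
Qed.

Lemma Rint_reflect s f : integ mu f -> \int[mu]_z f (s - z) = \int[mu]_z f z.
Proof.
move=> hf; rewrite -(Rint_translate s hf) -(Rint_opp (integ_translate s hf)).
by apply: eq_Rintegral => z _; rewrite addrC.
Qed.

Let m : {sigma_finite_measure set E -> \bar R} := @space_measure R N l.

Lemma Rfubini (H : E * E -> R) : measurable_fun setT H ->
  (\int[mu]_x \int[mu]_y `|(H (x, y))%:E| < +oo)%E ->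
  (forall x, integ mu (fun y => H (x, y))) ->
  (forall y, integ mu (fun x => H (x, y))) ->
  [/\ integ mu (fun x => \int[mu]_y H (x, y)),
      integ mu (fun y => \int[mu]_x H (x, y)) &
  \int[mu]_x \int[mu]_y H (x, y) = \int[mu]_y \int[mu]_x H (x, y)].
Proof.
move=> mH iH i1 i2.
have mEH : measurable_fun setT (EFin \o H) by exact/measurable_EFinP.
have ip := (@integrable12ltyP _ _ _ _ _ m m _ mEH).2 iH.
have e1 x : (\int[mu]_y H (x, y))%:E = (\int[mu]_y (H (x, y))%:E)%E.
  by rewrite /Rintegral fineK//; exact: (integrable_fin_num measurableT (i1 x)).
have e2 y : (\int[mu]_x H (x, y))%:E = (\int[mu]_x (H (x, y))%:E)%E.
  by rewrite /Rintegral fineK//; exact: (integrable_fin_num measurableT (i2 y)).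
split.
  have := @integrable_fubini_F _ _ _ _ _ m m _ ip.
  by rewrite /integ /fubini_F; apply: eq_integrable => // x _ /=; rewrite e1.
  have mEHs : measurable_fun setT (fun q : E * E => (H (q.2, q.1))%:E).
    apply/measurable_EFinP; apply: (measurableT_comp mH).
    by apply: measurable_fun_pair => /=; [exact: measurable_snd|exact: measurable_fst].
  have maH : measurable_fun setT (fun q => `|(H q)%:E|%E).
    by apply/measurable_EFinP; exact: measurableT_comp.
  have iHs := @fubini_tonelli _ _ _ _ _ m m _ maH (fun _ => abse_ge0 _).
  have ips := (@integrable12ltyP _ _ _ _ _ m m _ mEHs).2.
  rewrite /= -iHs in ips; have := @integrable_fubini_F _ _ _ _ _ m m _ (ips iH).
  by rewrite /integ /fubini_F; apply: eq_integrable => // x _ /=; rewrite e2.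
rewrite /Rintegral; congr fine.
under eq_integral do rewrite e1; under [RHS]eq_integral do rewrite e2.
have h1 := @integral12_prod_meas1 _ _ _ _ _ m m _ ip.
have h2 := @integral21_prod_meas1 _ _ _ _ _ m m _ ip.
by rewrite -[LHS]/(\int[m]_x fubini_F m (EFin \o H) x)%E h1 -h2.
Qed.

End correlation.

(** * Mollified inner products *)

Section mollified_pairing.
Context (R : realType) (N l : nat).
Local Notation E := ('rV[R]_N * 'rV[R]_l)%type.
Local Notation mu := (lebesgue_space R N l).
Local Notation box := (@box R N l).
Implicit Types (z v s : E) (a f g phi psi rho kap F K W Q : E -> R).

Definition corr F K s := ip mu (fun z => F (z + s)) K.

(** The inner product of [K] with the average of the translates of [F] against
    the kernel; the integral over the shift [s] comes last, so that no
    convolution has to be defined pointwise. *)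
Definition mollip kap F K := \int[mu]_s (kap s * corr F K s).

Lemma measurable_addE : measurable_fun [set: E * E] (fun q => q.2 + q.1).
Proof.
apply: measurable_fun_pair => /=; apply: measurable_fun_rV => i; under eq_fun do rewrite mxE.
  apply: measurable_funD.
    exact: (measurableT_comp (measurable_coorx i) measurable_snd).
  exact: (measurableT_comp (measurable_coorx i) measurable_fst).
apply: measurable_funD.
  exact: (measurableT_comp (measurable_coory i) measurable_snd).
exact: (measurableT_comp (measurable_coory i) measurable_fst).
Qed.

Lemma measurable_subE : measurable_fun [set: E * E] (fun q => q.2 - q.1).
Proof.
apply: measurable_fun_pair => /=; apply: measurable_fun_rV => i; under eq_fun do rewrite !mxE.
  apply: measurable_funB.
    exact: (measurableT_comp (measurable_coorx i) measurable_snd).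
  exact: (measurableT_comp (measurable_coorx i) measurable_fst).
apply: measurable_funB.
  exact: (measurableT_comp (measurable_coory i) measurable_snd).
exact: (measurableT_comp (measurable_coory i) measurable_fst).
Qed.

(** Absolute integrability comes from the bound [M] on the inner integral and
    the integrability of the kernel. *)
Lemma kernel_fubini kap (P : E * E -> R) (M : R) : tfun kap ->
  measurable_fun setT P -> (forall s, integ mu (fun z => P (s, z))) ->
  (forall s, \int[mu]_z `|P (s, z)| <= M) ->
  (forall z, integ mu (fun s => kap s * P (s, z))) ->
  [/\ integ mu (fun s => kap s * \int[mu]_z P (s, z)),
      integ mu (fun z => \int[mu]_s (kap s * P (s, z))) &
  \int[mu]_s (kap s * \int[mu]_z P (s, z)) = \int[mu]_z \int[mu]_s (kap s * P (s, z))].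
Proof.
move=> tk mP iP hM iK.
pose H (q : E * E) := kap q.1 * P q.
have mk : measurable_fun setT kap by apply: elem_measurable; case: tk.
have mH : measurable_fun setT H.
  by apply: measurable_funM => //; exact: (measurableT_comp mk measurable_fst).
have [|||i i' e] := @Rfubini R N l H mH.
- have mEH : measurable_fun setT (fun q => `|(H q)%:E|%E).
    by apply/measurable_EFinP; exact: measurableT_comp.
  have ik : integ mu (fun s => `|kap s| * M).
    under eq_fun do rewrite mulrC; apply: integZ.
    apply: (integ_le _ (integ_norm (tfun_integ tk))) => [|z].
      exact: measurableT_comp.
    by rewrite normr_id.
  apply: (@le_lt_trans _ _ (\int[mu]_s (`|kap s| * M)%:E)%E).
    apply: ge0_le_integral => //.
    + by move=> x _; exact: integral_ge0.
    + exact: (measurable_fun_fubini_tonelli_F (m2 := @space_measure R N l) _ mEH (fun _ => abse_ge0 _)).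
    + by apply/measurable_EFinP; exact: integ_meas ik.
    move=> s _; rewrite (_ : (fun y => _) = (fun y => (`|kap s| * `|P (s, y)|)%:E)); last first.
      by apply/funext => y; rewrite /H/= normrM.
    have iN : integ mu (fun y => `|kap s| * `|P (s, y)|) by apply: integZ; exact: integ_norm.
    rewrite -[X in (X <= _)%E](fineK (integrable_fin_num measurableT iN)) lee_fin.
    rewrite -[leLHS]/(\int[mu]_y (`|kap s| * `|P (s, y)|)) RintZ; last exact: integ_norm.
    by rewrite ler_wpM2l.
  case/integrableP : ik => mk2; apply: le_lt_trans.
  have M0 : 0 <= M by rewrite (le_trans _ (hM 0))//; exact: Rint_ge0.
  apply: ge0_le_integral => //.
  + by move=> x _; rewrite lee_fin mulr_ge0.
  + by apply: measurableT_comp.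
  + by move=> x _; rewrite lee_fin ler_norm.
- by move=> s; rewrite /H/=; exact: integZ.
- by move=> z; exact: iK.
have e1 s : \int[mu]_y H (s, y) = kap s * \int[mu]_z P (s, z) by rewrite -RintZ.
split=> //; last by rewrite -e; apply: eq_Rintegral => s _; rewrite e1.
by move: i; under eq_fun do rewrite e1.
Qed.

(** The kernel as a test function applied to [F], for fixed [z']. *)
Lemma mollip_right kap F K : tfun kap -> l2 mu F -> l2 mu K ->
  [/\ integ mu (fun s => kap s * corr F K s),
      integ mu (fun z' => K z' * ip mu F (fun z => kap (z - z'))) &
  mollip kap F K = \int[mu]_z' (K z' * ip mu F (fun z => kap (z - z')))].
Proof.
move=> tk lF lK; pose P (q : E * E) := F (q.2 + q.1) * K q.2.
have [||||i i' e] := @kernel_fubini kap P (2^-1 * (nsq mu F + nsq mu K)) tk.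
- apply: measurable_funM.
    by apply: (measurableT_comp _ measurable_addE); case: lF.
  by apply: (measurableT_comp _ measurable_snd); case: lK.
- by move=> s; apply: l2M => //; exact: (l2_translate s).
- move=> s; rewrite /P/=.
  under eq_Rintegral do rewrite normrM.
  have lFs := l2_translate s lF.
  apply: (le_trans (ler_norm _)); apply: (le_trans (ip_young ltr01 (l2_norm lFs) (l2_norm lK))).
  by rewrite invr1 !mul1r !nsq_norm nsq_translate.
- move=> z; rewrite /P/=.
  rewrite (_ : (fun s => _) = fun s => K z * (kap s * F (s + z))); last first.
    by apply/funext => s; rewrite [z + s]addrC; ring.
  by apply: integZ; apply: l2M; [exact: tfun_l2|exact: (l2_translate z)].
have e1 z' : \int[mu]_s (kap s * P (s, z')) = K z' * ip mu F (fun z => kap (z - z')).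
  have tk' : tfun (fun z => kap (z - z')) by exact: (tfun_translate (- z') tk).
  rewrite /ip -RintZ; last by apply: l2M => //; exact: tfun_l2.
  rewrite -[RHS](Rint_translate z'); last by apply: integZ; apply: l2M => //; exact: tfun_l2.
  by apply: eq_Rintegral => s _; rewrite /P/= addrK [s + z']addrC; ring.
split => //; first by move: i'; under eq_fun do rewrite e1.
rewrite /mollip -[LHS]/(\int[mu]_s (kap s * \int[mu]_z P (s, z))) e.
by apply: eq_Rintegral => z' _; rewrite e1.
Qed.

(** The kernel as a test function applied to [K], for fixed [z]. *)
Lemma mollip_left kap F K : tfun kap -> l2 mu F -> l2 mu K ->
  mollip kap F K = \int[mu]_z (F z * ip mu K (fun z' => kap (z - z'))).
Proof.
move=> tk lF lK; pose P (q : E * E) := F q.2 * K (q.2 - q.1).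
have [||||_ _ e] := @kernel_fubini kap P (2^-1 * (nsq mu F + nsq mu K)) tk.
- apply: measurable_funM.
    by apply: (measurableT_comp _ measurable_snd); case: lF.
  by apply: (measurableT_comp _ measurable_subE); case: lK.
- by move=> s; apply: l2M => //; exact: (l2_translate (- s)).
- move=> s; rewrite /P/=.
  under eq_Rintegral do rewrite normrM.
  have lKs := l2_translate (- s) lK.
  apply: (le_trans (ler_norm _)); apply: (le_trans (ip_young ltr01 (l2_norm lF) (l2_norm lKs))).
  by rewrite invr1 !mul1r !nsq_norm nsq_translate.
- move=> z; rewrite /P/=.
  rewrite (_ : (fun s => _) = fun s => F z * (kap s * K (z - s))); last first.
    by apply/funext => s; ring.
  have i1 : integ mu (fun s => kap (z - s) * K s).
    by apply: l2M => //; apply: tfun_l2; exact: tfun_reflect.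
  apply: integZ; have := integ_translate (- z) (integ_opp i1).
  rewrite /=; apply: eq_integrable => // s _ /=.
  by rewrite !opprB addrC subrK.
rewrite /mollip (_ : (fun s => _) = fun s => kap s * \int[mu]_z P (s, z)); last first.
  apply/funext => s; congr (_ * _); rewrite /corr /ip.
  rewrite -(Rint_translate (- s)); last by apply: l2M => //; exact: (l2_translate s).
  by apply: eq_Rintegral => z _; rewrite /P/= subrK.
rewrite -[LHS]/(\int[mu]_s (kap s * \int[mu]_z P (s, z))) e; apply: eq_Rintegral => z _.
have lk' : l2 mu (fun z' => kap (z - z')) by apply: tfun_l2; exact: tfun_reflect.
rewrite /ip -RintZ; last exact: l2M.
rewrite -[RHS](Rint_reflect z); last by apply: integZ; exact: l2M.
by apply: eq_Rintegral => s _; rewrite /P/= opprB [z + (s - z)]addrC subrK; ring.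
Qed.

(** For fixed [z], [rho (z - z')] is a test function of [z'], so that the
    derivative moves from the mollifier onto [W]; the sign is that of the
    reflection. *)
Lemma mollip_derive a v rho F W Q : tfun rho -> l2 mu F -> l2 mu W -> l2 mu Q ->
  l2 mu (fun z => a z * W z) -> wder a v W Q ->
  mollip ('D_v rho) F (fun z => a z * W z) = mollip rho F Q.
Proof.
move=> tr lF lW lQ laW dW; rewrite !mollip_left//; last exact: tfun_derive.
apply: eq_Rintegral => z _; congr (_ * _).
have tr' : tfun (fun z' => rho (z - z')) by exact: tfun_reflect.
have := dW _ tr'; move/(congr1 -%R); rewrite opprK => <-.
rewrite /ip -RintN; last first.
  have := l2M laW (tfun_l2 (tfun_derive v tr')).
  by apply: eq_integrable => // x _ /=; congr EFin; ring.
apply: eq_Rintegral => z' _; rewrite derive_reflect; last by case: tr.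
ring.
Qed.

(** A weight evaluated before or after a shift by [s] differs by [omega], and
    the rest is Cauchy-Schwarz. *)
Lemma mollip_commutator a b kap F W (omega : R) : tfun kap -> l2 mu F -> l2 mu W ->
  l2 mu (fun z => b z * F z) -> l2 mu (fun z => a z * W z) -> 0 <= omega ->
  (forall s z', kap s != 0 -> W z' != 0 -> `|b (z' + s) - a z'| <= omega) ->
  `|mollip kap (fun z => b z * F z) W - mollip kap F (fun z => a z * W z)| <=
  omega * (2^-1 * (nsq mu F + nsq mu W)) * \int[mu]_s `|kap s|.
Proof.
move=> tk lF lW lbF laW om0 hom.
have [i1 _ _] := mollip_right tk lbF lW; have [i2 _ _] := mollip_right tk lF laW.
rewrite /mollip -RintB// -RintZ; last exact/integ_norm/tfun_integ.
apply: Rint_abs_le; [exact: integB|by apply: integZ; exact/integ_norm/tfun_integ|].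
move=> s; rewrite -mulrBr normrM [leRHS]mulrC.
have [->|ks] := eqVneq (kap s) 0; first by rewrite normr0 !mul0r.
rewrite ler_wpM2l// /corr.
have lFs := l2_translate s lF; have lbFs := l2_translate s lbF.
rewrite /ip -RintB; [|exact: l2M|exact: l2M].
apply: (@le_trans _ _ (\int[mu]_z (omega * (`|F (z + s)| * `|W z|)))).
  apply: Rint_abs_le.
  - by apply: integB; exact: l2M.
  - by apply: integZ; apply: l2M; exact: l2_norm.
  move=> z; have [W0|Wz] := eqVneq (W z) 0.
    by rewrite W0 normr0 !mulr0 subr0 normr0.
  rewrite (_ : _ - _ = (b (z + s) - a z) * (F (z + s) * W z)); last ring.
  by rewrite !normrM ler_wpM2r ?mulr_ge0// hom.
rewrite RintZ; last by apply: l2M; exact: l2_norm.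
rewrite ler_wpM2l//.
apply: (le_trans (ler_norm _)); apply: (le_trans (ip_young ltr01 (l2_norm lFs) (l2_norm lW))).
by rewrite invr1 !mul1r !nsq_norm nsq_translate.
Qed.

(** Approximation of the identity: the shifts in the support of [rho_ n] move
    [F] little in L2. *)
Lemma mollip_cvg (rho_ : nat -> E -> R) F K : (forall n, tfun (rho_ n)) ->
  (forall n z, 0 <= rho_ n z) -> (forall n, 0 < \int[mu]_z rho_ n z) ->
  (forall n, vanishes_off n.+1%:R^-1 (rho_ n)) -> l2 mu F -> l2 mu K ->
  (fun n => mollip (rho_ n) F K / \int[mu]_z rho_ n z) @ \oo --> ip mu F K.
Proof.
move=> tr r0 I0 hr lF lK; apply/cvgrPdist_le => e e0.
pose t := (nsq mu K + 1) / e.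
have K1 : 0 < nsq mu K + 1 by rewrite ltr_wpDl// nsq_ge0.
have t0 : 0 < t by rewrite divr_gt0.
have [d d0 hd] := l2_translate_continuous lF (divr_gt0 e0 t0).
near=> n.
have nd : n.+1%:R^-1 <= d.
  near: n; have := @cvg_harmonic R => /cvgrPdist_le/(_ d d0); apply: filterS => n.
  by rewrite /harmonic/= sub0r normrN ger0_norm.
have In := I0 n.
have -> : ip mu F K - mollip (rho_ n) F K / \int[mu]_z rho_ n z =
    (ip mu F K * \int[mu]_z rho_ n z - mollip (rho_ n) F K) / \int[mu]_z rho_ n z.
  by rewrite mulrBl mulfK// gt_eqF.
rewrite normrM normfV (gtr0_norm In) ler_pdivrMr// distrC -!RintZ; [|exact: tfun_integ..].
have [i1 _ _] := mollip_right (tr n) lF lK.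
rewrite /mollip -RintB//; last by apply: integZ; exact: tfun_integ.
apply: Rint_abs_le; [|by apply: integZ; exact: tfun_integ|].
  by apply: integB => //; apply: integZ; exact: tfun_integ.
move=> s; rewrite [ip mu F K * _]mulrC -mulrBr normrM ger0_norm// mulrC.
have [bs|nbs] := pselect (box n.+1%:R^-1 s); last by rewrite hr// !mulr0.
rewrite ler_wpM2r// /corr -ipBl//; last exact: (l2_translate s).
have lFs : l2 mu (fun z => F (z + s) - F z) by apply: l2B => //; exact: (l2_translate s).
apply: (le_trans (ip_young t0 lFs lK)).
have h1 : t * nsq mu (fun z => F (z + s) - F z) <= e.
  by rewrite mulrC -ler_pdivlMr//; apply: hd; exact: box_le bs.
have h2 : t^-1 * nsq mu K <= e.
  by rewrite /t invf_div mulrAC ler_pdivrMr// ler_wpM2l// ?ltW// ltrDl.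
lra.
Unshelve. all: by end_near.
Qed.

End mollified_pairing.

(** * Mollifiers with separate scales in x and y *)

Section mollifier.
Context (R : realType) (N l : nat).
Local Notation E := ('rV[R]_N * 'rV[R]_l)%type.
Local Notation mu := (lebesgue_space R N l).
Local Notation box := (@box R N l).
Implicit Types (z v s : E) (a f g phi psi rho kap F K W Q : E -> R).

Definition ex (i : 'I_N) : E := (delta_mx 0 i, 0).
Definition ey (j : 'I_l) : E := (0, delta_mx 0 j).

Lemma sum_ex i z : \sum_k (ex i).1 0 k * z.1 0 k = z.1 0 i.
Proof.
rewrite /ex/= (bigD1 i)//= big1 => [|k ki]; rewrite mxE !eqxx.
  by rewrite mul1r addr0.
by rewrite (negPf ki) mul0r.
Qed.

Lemma sum_ey j z : \sum_k (ey j).2 0 k * z.2 0 k = z.2 0 j.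
Proof.
rewrite /ey/= (bigD1 j)//= big1 => [|k kj]; rewrite mxE !eqxx.
  by rewrite mul1r addr0.
by rewrite (negPf kj) mul0r.
Qed.

Lemma Rint_gt0 f (B : set E) : integ mu f -> (forall z, 0 <= f z) ->
  measurable B -> (0 < mu B)%E -> (forall z, B z -> 0 < f z) ->
  0 < \int[mu]_z f z.
Proof.
move=> hf f0 mB B0 fB; rewrite lt_neqAle Rint_ge0// andbT; apply/eqP => i0.
have mf : measurable_fun setT (EFin \o f) by apply/measurable_EFinP; exact: integ_meas hf.
have := (ae_eq_integral_abs mu measurableT mf).1.
have -> : (\int[mu]_x `|(EFin \o f) x| = 0)%E.
  rewrite (eq_integral (EFin \o f)); last by move=> z _ /=; rewrite ger0_norm.
  rewrite -(fineK (integrable_fin_num measurableT hf)).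
  by rewrite -[fine _]/(\int[mu]_z f z) -i0.
move=> /(_ erefl) [A [mA A0 hA]].
have : (mu B <= mu A)%E.
  apply: le_measure; rewrite ?inE// => z Bz; apply: hA => /= h.
  by have := h I => -[] fz; have := fB z Bz; rewrite fz ltxx.
by rewrite A0 leNgt B0.
Qed.

Definition mollx (eta : R) z := flat 0 (eta - qx z).
Definition molly (delta : R) z := flat 0 (delta - qy z).
Definition moll eta delta z := mollx eta z * molly delta z.

Lemma elem_mollx eta : elem (mollx eta).
Proof. by apply: elem_flat; apply: elem_sub; [exact: elem_cst|exact: elem_qx]. Qed.

Lemma elem_molly delta : elem (molly delta).
Proof. by apply: elem_flat; apply: elem_sub; [exact: elem_cst|exact: elem_qy]. Qed.

Lemma mollx_neq0 eta z : mollx eta z != 0 -> qx z < eta.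
Proof. by apply: contraNT; rewrite -leNgt -subr_le0 => h; rewrite /mollx flat_le0. Qed.

Lemma molly_neq0 eta z : molly eta z != 0 -> qy z < eta.
Proof. by apply: contraNT; rewrite -leNgt -subr_le0 => h; rewrite /molly flat_le0. Qed.

Lemma qx_lt z (e : R) i : 0 <= e -> qx z < e ^+ 2 -> `|z.1 0 i| <= e.
Proof. by move=> e0 h; apply: sqr_lt_sqr => //; apply: le_lt_trans h; exact: qx_ge. Qed.

Lemma qy_lt z (e : R) i : 0 <= e -> qy z < e ^+ 2 -> `|z.2 0 i| <= e.
Proof. by move=> e0 h; apply: sqr_lt_sqr => //; apply: le_lt_trans h; exact: qy_ge. Qed.

Lemma moll_vanishes eta delta (e : R) : 0 <= e -> eta <= e ^+ 2 -> delta <= e ^+ 2 ->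
  vanishes_off e (moll eta delta).
Proof.
move=> e0 h1 h2 z nz; apply/eqP; apply: contrapT => /negP; rewrite mulf_eq0 negb_or.
move=> /andP[/mollx_neq0 a1 /molly_neq0 a2]; apply: nz; split => i.
  by apply: qx_lt => //; exact: lt_le_trans h1.
by apply: qy_lt => //; exact: lt_le_trans h2.
Qed.

Lemma tfun_moll eta delta : tfun (moll eta delta).
Proof.
split; first by apply: elem_mul; [exact: elem_mollx|exact: elem_molly].
exists (1 + `|eta| + `|delta|); apply: moll_vanishes.
- by rewrite !addr_ge0.
- rewrite (le_trans (ler_norm _))//.
  have h : 1 <= 1 + `|eta| + `|delta| by rewrite -addrA lerDl addr_ge0.
  apply: (@le_trans _ _ (1 + `|eta| + `|delta|)); first by rewrite addrAC lerDr addr_ge0.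
  by rewrite expr2 ler_peMr// (le_trans _ h).
- rewrite (le_trans (ler_norm _))//.
  have h : 1 <= 1 + `|eta| + `|delta| by rewrite -addrA lerDl addr_ge0.
  apply: (@le_trans _ _ (1 + `|eta| + `|delta|)); first by rewrite lerDr addr_ge0.
  by rewrite expr2 ler_peMr// (le_trans _ h).
Qed.

Lemma moll_ge0 eta delta z : 0 <= moll eta delta z.
Proof. by rewrite mulr_ge0// flat_ge0. Qed.

Lemma moll_int_gt0 eta delta : 0 < eta -> 0 < delta ->
  0 < \int[mu]_z moll eta delta z.
Proof.
move=> e0 d0.
pose c (M : nat) (t : R) := Num.min 1 (t / (M%:R + 1)).
have c0 M t : 0 < t -> 0 < c M t.
  by move=> t0; rewrite lt_min ltr01 divr_gt0// ltr_wpDl.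
have [mB B0] := @lebesgue_space_box_gt0 R N l (fun=> - c N eta) (fun=> c N eta)
  (fun=> - c l delta) (fun=> c l delta)
  (fun=> (gt0_cp (c0 N _ e0)).2) (fun=> (gt0_cp (c0 l _ d0)).2).
apply: (Rint_gt0 _ _ mB B0).
- exact/tfun_integ/tfun_moll.
- exact: moll_ge0.
have key (M : nat) t (w : 'I_M -> R) : 0 < t -> (forall i, - c M t < w i < c M t) ->
    \sum_i w i ^+ 2 < t.
  move=> t0 hw; apply: (@le_lt_trans _ _ (\sum_(i < M) c M t)).
    apply: ler_sum => i _; rewrite -[w i ^+ 2]real_normK ?num_real//.
    have h : `|w i| <= c M t by rewrite ler_norml !ltW//; case/andP: (hw i).
    have c1 : c M t <= 1 by rewrite /c ge_min lexx.
    rewrite expr2; apply: (le_trans (ler_pM _ _ h h)) => //.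
    by rewrite ler_piMr// ltW// c0.
  rewrite sumr_const card_ord -[X in X < _]mulr_natl.
  apply: (@le_lt_trans _ _ (M%:R * (t / (M%:R + 1)))).
    by rewrite ler_wpM2l// /c ge_min lexx orbT.
  rewrite mulrA ltr_pdivrMr ?ltr_wpDl// mulrC mulrDr mulr1 ltrDl//.
by move=> z [h1 h2]; rewrite mulr_gt0// flat_gt0// subr_gt0; apply: key.
Qed.

Lemma measurable_embed_y : measurable_fun [set: 'rV[R]_l] (fun y => (0, y) : E).
Proof. by apply: measurable_fun_pair => //; exact: measurable_cst. Qed.

Lemma measurable_embed_x : measurable_fun [set: 'rV[R]_N] (fun x => (x, 0) : E).
Proof. by apply: measurable_fun_pair => //; exact: measurable_cst. Qed.

Lemma integral_separated (p : 'rV[R]_N -> \bar R) (q : 'rV[R]_l -> \bar R) :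
  measurable_fun setT p -> measurable_fun setT q ->
  (forall x, 0 <= p x)%E -> (forall y, 0 <= q y)%E ->
  (\int[mu]_z (p z.1 * q z.2) = (\int[lebesgue_rV R N]_x p x) * (\int[lebesgue_rV R l]_y q y))%E.
Proof.
move=> mp mq p0 q0.
have mf : measurable_fun [set: 'rV[R]_N * 'rV[R]_l] (fun z => p z.1 * q z.2)%E.
  apply: emeasurable_funM.
    exact: (measurableT_comp mp measurable_fst).
  exact: (measurableT_comp mq measurable_snd).
rewrite /lebesgue_space.
rewrite (@fubini_tonelli1 _ _ _ _ _ (lebesgue_rV R N) (lebesgue_rV R l) (fun z => p z.1 * q z.2)%E)//; last first.
  by move=> z; exact: mule_ge0.
rewrite /fubini_F /=.
under eq_integral do rewrite ge0_integralZl//.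
by rewrite ge0_integralZr//; exact: integral_ge0.
Qed.

Lemma pos_fin_factors (X Y : \bar R) (I : R) : (X * Y = I%:E)%E -> 0 < I ->
  (0 <= X)%E -> (0 <= Y)%E ->
  exists x y, [/\ X = x%:E, Y = y%:E, 0 < x & 0 < y].
Proof.
move: X Y => [x| |] [y| |] //= + I0; rewrite ?lee_fin.
- move=> [xy] x0 y0; exists x, y; split => //; rewrite lt_neqAle ?x0 ?y0 andbT; apply/eqP => h;
  by move: I0; rewrite -xy -h ?mul0r ?mulr0 ltxx.
- move=> + x0; move: x0; rewrite le_eqVlt => /predU1P[<-|x0].
    by rewrite mul0e => -[I00]; move: I0; rewrite I00 ltxx.
  by rewrite gt0_muley.
- move=> + _ y0; move: y0; rewrite le_eqVlt => /predU1P[<-|y0].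
    by rewrite mule0 => -[I00]; move: I0; rewrite I00 ltxx.
  by rewrite gt0_mulye.
Qed.

(** Both integrals have the same factor that depends on [eta], positive and
    finite, which cancels. So [eta] can be sent to [0] for a fixed [delta]
    without losing control of the derivatives in [y], relatively to the mass
    of the mollifier. *)
Lemma moll_dy_int (delta : R) : 0 < delta ->
  exists2 C, 0 <= C & forall eta, 0 < eta -> forall j,
    \int[mu]_z `|'D_(ey j) (moll eta delta) z| <= C * \int[mu]_z moll eta delta z.
Proof.
move=> d0.
pose p eta (x : 'rV[R]_N) := mollx eta ((x, 0) : E).
pose q (y : 'rV[R]_l) := molly delta ((0, y) : E).
pose q' j (y : 'rV[R]_l) := `|'D_(ey j) (molly delta) (0, y)|.
have qyE z : qy z = qy ((0, z.2) : E) by [].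
have qxE z : qx z = qx ((z.1, 0) : E) by [].
have pE eta z : mollx eta z = p eta z.1 by rewrite /mollx qxE.
have qE z : molly delta z = q z.2 by rewrite /molly qyE.
have q'E j z : `|'D_(ey j) (molly delta) z| = q' j z.2.
  have e := derive_translate ((z.1, 0) : E) (ey j) (molly delta) ((0, z.2) : E).
  rewrite (_ : (fun w => _) = molly delta) in e; last first.
    by apply/funext => w; rewrite /molly qyE/= addr0.
  rewrite /q' e (_ : (0, z.2) + (z.1, 0) = z)//.
  by case: z {e} => x y; congr pair; rewrite /= ?add0r ?addr0.
have mp eta : measurable_fun setT (EFin \o p eta).
  apply/measurable_EFinP.
  exact: (measurableT_comp (elem_measurable (elem_mollx eta)) measurable_embed_x).
have mq : measurable_fun setT (EFin \o q).
  apply/measurable_EFinP.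
  exact: (measurableT_comp (elem_measurable (elem_molly delta)) measurable_embed_y).
have mq' j : measurable_fun setT (EFin \o q' j).
  apply/measurable_EFinP; apply: measurableT_comp => //.
  exact: (measurableT_comp (elem_measurable (elem_derive (ey j) (elem_molly delta))) measurable_embed_y).
have p0 eta x : (0 <= (EFin \o p eta) x)%E by rewrite lee_fin flat_ge0.
have q0 x : (0 <= (EFin \o q) x)%E by rewrite lee_fin flat_ge0.
have q'0 j x : (0 <= (EFin \o q' j) x)%E by rewrite lee_fin; exact: normr_ge0.
pose X eta := (\int[lebesgue_rV R N]_x (p eta x)%:E)%E.
pose Y := (\int[lebesgue_rV R l]_x (q x)%:E)%E.
pose Y' j := (\int[lebesgue_rV R l]_x (q' j x)%:E)%E.
have XY eta : (\int[mu]_z (moll eta delta z)%:E = X eta * Y)%E.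
  rewrite -[RHS](integral_separated (mp eta) mq (p0 eta) q0).
  by apply: eq_integral => z _ /=; rewrite /moll pE qE EFinM.
have DE eta j z : 'D_(ey j) (moll eta delta) z = mollx eta z * 'D_(ey j) (molly delta) z.
  have D0 : 'D_(ey j) (mollx eta) z = 0.
    have e t : mollx eta (z + t *: ey j) = mollx eta z.
      congr (flat 0 (_ - _)); apply: eq_bigr => i _.
      by rewrite /= scaler0 addr0.
    rewrite /derive; apply: cvg_lim => //; apply: cvg_near_cst; near=> h.
    rewrite /= -[h *: ey j + z]addrC.
    by rewrite e subrr scaler0.
  have := derive_mul (ey j) (elem_mollx eta) (elem_molly delta).
  by move/(congr1 (fun f => f z)) => /= ->; rewrite D0 mulr0 addr0.
have XY' eta j : (\int[mu]_z (`|'D_(ey j) (moll eta delta) z|)%:E = X eta * Y' j)%E.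
  rewrite -[RHS](integral_separated (mp eta) (mq' j) (p0 eta) (q'0 j)).
  by apply: eq_integral => z _ /=; rewrite DE normrM pE q'E ger0_norm ?EFinM// flat_ge0.
have fXY eta : 0 < eta -> exists x y, [/\ X eta = x%:E, Y = y%:E, 0 < x & 0 < y].
  move=> e0.
  have i := tfun_integ (tfun_moll eta delta).
  have I0 := moll_int_gt0 e0 d0.
  have XYr : (X eta * Y = (\int[mu]_z moll eta delta z)%:E)%E.
    by rewrite -XY /Rintegral fineK//; exact: (integrable_fin_num measurableT i).
  have X0 : (0 <= X eta)%E by apply: integral_ge0 => x _; exact: p0.
  have Y0 : (0 <= Y)%E by apply: integral_ge0 => x _; exact: q0.
  exact: (pos_fin_factors XYr I0 X0 Y0).
have [x1 [y [X1 Yy x10 y0]]] := fXY 1 ltr01.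
have fY' j : exists y', Y' j = y'%:E /\ 0 <= y'.
  have i := integ_norm (tfun_integ (tfun_derive (ey j) (tfun_moll 1 delta))).
  have := XY' 1 j.
  rewrite -(fineK (integrable_fin_num measurableT i)) X1.
  have : (0 <= Y' j)%E by apply: integral_ge0 => w _; exact: q'0.
  move: (Y' j) => [y'| |] //=; first by rewrite lee_fin => h _; exists y'.
  by rewrite gt0_muley.
have [Z hZ] := choice fY'.
exists (\sum_j Z j / y).
  by apply: sumr_ge0 => j _; rewrite divr_ge0 ?(hZ j).2// ltW.
move=> eta e0 j; have [x [y1 [Xx Yy1 x0 _]]] := fXY eta e0.
rewrite /Rintegral XY' XY Xx Yy (hZ j).1 -!EFinM /=.
rewrite mulrCA ler_pM2l// mulr_suml (bigD1 j)//= divfK ?gt_eqF// lerDl.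
by apply: sumr_ge0 => k _; rewrite divfK ?gt_eqF// (hZ k).2.
Unshelve. all: by end_near.
Qed.

End mollifier.

(** * Testing the equation against functions of bounded support in x *)

Section pairing.
Context (R : realType) (N l : nat).
Local Notation E := ('rV[R]_N * 'rV[R]_l)%type.
Local Notation mu := (lebesgue_space R N l).
Local Notation box := (@box R N l).
Implicit Types (z v s : E) (a f g phi psi rho kap F K W Q : E -> R).

(** The two properties of the weight [|x|^gamma] that matter to mollification:
    it is bounded, and uniformly continuous, on sets bounded in [x]. *)
Definition x_bounded a := forall r, exists2 C, 0 <= C & forall z, qx z <= r -> `|a z| <= C.

Definition x_unif a := forall r (e : R), 0 < e -> exists2 eta, 0 < eta &
  forall z s, qx z <= r -> (forall i, `|s.1 0 i| <= eta) -> `|a (z + s) - a z| <= e.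

Lemma qx_add z s (r : R) : qx z <= r -> (forall i, `|s.1 0 i| <= 1) ->
  qx (z + s) <= 2 * r + 2 * N%:R.
Proof.
move=> qz hs; apply: (@le_trans _ _ (\sum_i (2 * z.1 0 i ^+ 2 + 2))).
  apply: ler_sum => i _; rewrite mxE.
  have h1 : s.1 0 i ^+ 2 <= 1.
    by rewrite -[leLHS]real_normK ?num_real// -(expr1n _ 2) ler_sqr ?nnegrE.
  have h2 : 0 <= (z.1 0 i - s.1 0 i) ^+ 2 := sqr_ge0 _.
  rewrite expr2 in h1; rewrite !expr2 in h2 *; lra.
rewrite big_split/= -mulr_sumr sumr_const card_ord -[2 *+ N]mulr_natr lerD2r.
by rewrite ler_wpM2l.
Qed.

Variables (a : E -> R) (j0 : 'I_l) (g : 'I_N -> E -> R) (k : 'I_l -> E -> R)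
  (f : E -> R) (P : 'I_N -> E -> R) (Q : 'I_l -> E -> R) (W : E -> R) (h r : R).
Hypotheses (ma : measurable_fun setT a) (ba : x_bounded a) (ua : x_unif a)
  (lg : forall i, l2 mu (g i)) (lk : forall j, l2 mu (k j)) (lf : l2 mu f)
  (eqn : forall phi, tfun phi ->
    (exists2 t, 0 < t & forall z, z.2 0 j0 <= t -> phi z = 0) ->
    \sum_i ip mu (g i) ('D_(ex R l i) phi) +
    \sum_j ip mu (k j) (fun z => a z * 'D_(ey R N j) phi z) = ip mu f phi)
  (lP : forall i, l2 mu (P i)) (lQ : forall j, l2 mu (Q j)) (lW : l2 mu W)
  (h0 : 0 < h) (Wh : forall z, z.2 0 j0 <= h -> W z = 0)
  (Wr : forall z, r < qx z -> W z = 0)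
  (dP : forall i, wder (fun=> 1) (ex R l i) W (P i))
  (dQ : forall j, wder a (ey R N j) W (Q j)).

Let r1 := 2 * r + 2 * N%:R.
Let b z := a z * \1_[set z | qx z <= r1] z.

Let mqx : measurable [set z : E | qx z <= r1].
Proof.
rewrite (_ : mkset _ = @qx R N l @^-1` `]-oo, r1]).
  by rewrite -[X in measurable X]setTI; apply: (elem_measurable (elem_qx R N l)) => //; exact: measurable_itv.
by apply/seteqP; split => z /=; rewrite in_itv.
Qed.

Let mb : measurable_fun setT b.
Proof. by apply: measurable_funM => //; exact: measurable_indic. Qed.

Let bC : exists2 C, 0 <= C & forall z, `|b z| <= C.
Proof.
have [C C0 hC] := ba r1; exists C => // z; rewrite /b indicE.
case: (boolP (z \in _)) => [|_]; last by rewrite mulr0 normr0.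
by rewrite inE/= => hz; rewrite mulr1 hC.
Qed.

Let lbk j : l2 mu (fun z => b z * k j z).
Proof. by have [C _ hC] := bC; exact: (l2_bM mb hC). Qed.

Let laW : l2 mu (fun z => a z * W z).
Proof.
have [C C0 hC] := ba r; apply: (@l2_le _ _ _ _ _ (fun z => C * W z)).
- by apply: measurable_funM => //; case: lW.
- exact: l2Z.
- move=> z; have [rz|rz] := ltP r (qx z); first by rewrite Wr// !mulr0.
  by rewrite !normrM ler_wpM2r// (le_trans (hC z rz))// ler_norm.
Qed.

(** Test the equation with the mollifier centred at [z'], integrate against [W
    z'], and move the derivatives in [x] onto [W]. In [y] the weight stays
    with [k], at the point [z] instead of [z']. *)
Lemma pairing_scale rho (e : R) : 0 < e -> e <= 1 -> e < h ->
  tfun rho -> vanishes_off e rho ->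
  \sum_i mollip rho (g i) (P i) +
  \sum_j mollip ('D_(ey R N j) rho) (fun z => b z * k j z) W =
  mollip rho f W.
Proof.
move=> e0 e1 eh tr hv.
have lw1 : l2 mu (fun z => 1 * W z) by under eq_fun do rewrite mul1r.
have E1 i : mollip rho (g i) (P i) = mollip ('D_(ex R l i) rho) (g i) W.
  rewrite -(mollip_derive tr (lg i) lW (lP i) lw1 (dP i)).
  by congr mollip; apply/funext => z; rewrite mul1r.
rewrite (eq_bigr (fun i => mollip ('D_(ex R l i) rho) (g i) W)); last by move=> i _; exact: E1.
have J1 i := mollip_right (tfun_derive (ex R l i) tr) (lg i) lW.
have J2 j := mollip_right (tfun_derive (ey R N j) tr) (lbk j) lW.
have J3 := mollip_right tr lf lW.
under eq_bigr do rewrite (let: And3 _ _ e := J1 _ in e).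
under [X in _ + X]eq_bigr do rewrite (let: And3 _ _ e := J2 _ in e).
rewrite (let: And3 _ _ e := J3 in e).
rewrite -!Rint_sum; [|by move=> j; case: (J2 j)|by move=> i; case: (J1 i)].
rewrite -RintD; last 2 first.
- by apply: integ_sum => i; case: (J1 i).
- by apply: integ_sum => j; case: (J2 j).
apply: eq_Rintegral => z' _; rewrite -!mulr_sumr -mulrDr.
have [->|Wz] := eqVneq (W z') 0; first by rewrite !mul0r.
congr (_ * _).
have qz : qx z' <= r by rewrite leNgt; apply: contra Wz => /Wr ->.
have zh : h < z'.2 0 j0 by rewrite ltNge; apply: contra Wz => /Wh ->.
have tr' : tfun (fun z => rho (z - z')) by exact: (tfun_translate (- z') tr).
have off z : ~ box e (z - z') -> rho (z - z') = 0 by exact: hv.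
have <- : \sum_i ip mu (g i) ('D_(ex R l i) (fun z => rho (z - z'))) +
    \sum_j ip mu (k j) (fun z => a z * 'D_(ey R N j) (fun z => rho (z - z')) z) =
    ip mu f (fun z => rho (z - z')).
  apply: eqn => //; exists (h - e); first by rewrite subr_gt0.
  move=> z hz; apply: off => -[_ /(_ j0)]; rewrite !mxE => hh.
  have : z'.2 0 j0 - z.2 0 j0 <= e by rewrite (le_trans (ler_norm _))// distrC.
  lra.
apply: f_equal2; apply: eq_bigr => i _.
  by apply: eq_Rintegral => z _; rewrite (derive_translate (- z')).
apply: eq_Rintegral => z _; rewrite (derive_translate (- z')).
have [bz|nz] := pselect (box e (z - z')); last first.
  by rewrite (vanishes_off_derive (ey R N i) hv nz)// !mulr0.
have -> : b z = a z.
  rewrite /b indicE mem_set ?mulr1//=.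
  rewrite -[z](subrK z') addrC; apply: qx_add => // i'.
  by rewrite (le_trans (bz.1 i')).
by rewrite mulrCA mulrA.
Qed.

(** Replace the weight at [z] by the weight at [z']. The error is the
    oscillation of the weight over the distance [eta] in [x], times the size
    of the derivative in [y] of the mollifier: choose the scale in [y] first,
    then [eta]. *)
Lemma pairing_error : exists2 M, 0 <= M & forall n : nat, exists rho,
  [/\ tfun rho, forall z, 0 <= rho z, 0 < \int[mu]_z rho z,
      vanishes_off n.+1%:R^-1 rho &
      `|\sum_i mollip rho (g i) (P i) + \sum_j mollip rho (k j) (Q j) - mollip rho f W| <=
      M * n.+1%:R^-1 * \int[mu]_z rho z].
Proof.
pose M := \sum_j (2^-1 * (nsq mu (k j) + nsq mu W)).
exists M; first by apply: sumr_ge0 => j _; rewrite mulr_ge0// addr_ge0// nsq_ge0.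
move=> n; pose e := Num.min n.+1%:R^-1 (h / 2).
have n0 : 0 < n.+1%:R^-1 :> R by rewrite invr_gt0.
have e0 : 0 < e by rewrite lt_min n0 divr_gt0.
have en : e <= n.+1%:R^-1 by rewrite /e ge_min lexx.
have e1 : e <= 1 by rewrite (le_trans en)// invf_le1// ler1n.
have eh : e < h.
  by apply: (@le_lt_trans _ _ (h / 2)); [rewrite /e ge_min lexx orbT|rewrite ltr_pdivrMr// mulr_natr mulr2n ltrDl].
have d0 : 0 < e ^+ 2 by rewrite exprn_gt0.
(* [C] depends on the scale [e] in [y] only; the scale in [x] is fixed after it *)
have [C C0 hC] := @moll_dy_int R N l (e ^+ 2) d0.
have C1 : 0 < C + 1 by rewrite ltr_wpDl.
have om0 : 0 < n.+1%:R^-1 / (C + 1) by rewrite divr_gt0.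
have [eta' eta'0 hu] := ua r om0.
pose eta := Num.min (eta' ^+ 2) (e ^+ 2).
have eta0 : 0 < eta by rewrite lt_min d0 exprn_gt0.
have etae : eta <= e ^+ 2 by rewrite /eta ge_min lexx orbT.
have etaeta : eta <= eta' ^+ 2 by rewrite /eta ge_min lexx.
pose rho := @moll R N l eta (e ^+ 2).
exists rho; have tr : tfun rho by exact: tfun_moll.
have I0 : 0 < \int[mu]_z rho z by exact: moll_int_gt0.
have hv : vanishes_off e rho by apply: moll_vanishes => //; exact: ltW.
split => //; first exact: moll_ge0.
  exact: (vanishes_off_le en).
rewrite -(pairing_scale e0 e1 eh tr hv).
rewrite opprD addrACA subrr add0r -sumrB.
have com j : `|mollip rho (k j) (Q j) - mollip ('D_(ey R N j) rho) (fun z => b z * k j z) W| <=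
    2^-1 * (nsq mu (k j) + nsq mu W) * n.+1%:R^-1 * \int[mu]_z rho z.
  rewrite distrC -(mollip_derive tr (lk j) lW (lQ j) laW (dQ j)).
  apply: (@le_trans _ _ (n.+1%:R^-1 / (C + 1) * (2^-1 * (nsq mu (k j) + nsq mu W)) *
      \int[mu]_s `|'D_(ey R N j) rho s|)).
    apply: mollip_commutator => //; [exact: tfun_derive|exact: ltW|].
    move=> s z' ks Wz.
    have qz : qx z' <= r by rewrite leNgt; apply: contra Wz => /Wr ->.
    have bxs : box e s.
      apply: contrapT => ns; move/eqP: ks; apply.
      exact: (vanishes_off_derive (ey R N j) hv).
    have -> : b (z' + s) = a (z' + s).
      rewrite /b indicE mem_set ?mulr1//=; apply: qx_add => // i'.
      by rewrite (le_trans (bxs.1 i')).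
    apply: hu => // i; apply: contrapT => /negP; rewrite -ltNge => hsi.
    move/eqP: ks; apply.
    have sx : eta < qx s.
      apply: le_lt_trans etaeta _; apply: lt_le_trans (qx_ge s i).
      by rewrite -[X in _ < X]real_normK ?num_real// ltr_sqr ?nnegrE// ltW.
    have os : open [set w : E | eta < qx w].
      rewrite (_ : mkset _ = @qx R N l @^-1` [set x | eta < x]) //.
      apply: open_comp; last exact: open_gt.
      by move=> w _; have := elem_continuous (elem_qx R N l); apply.
    have : \near s, cst 0 s = rho s.
      apply: filterS (open_nbhs_nbhs (conj os sx)) => w /= ew.
      by rewrite /rho /moll /mollx flat_le0 ?mul0r// subr_le0 ltW.
    by move=> /(near_eq_derive (ey R N j)) <-; rewrite derive_cst.
  have Cj : \int[mu]_s `|'D_(ey R N j) rho s| <= (C + 1) * \int[mu]_z rho z.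
    by rewrite (le_trans (hC eta eta0 j))// ler_wpM2r ?lerDl// ltW.
  have nn : 0 <= 2^-1 * (nsq mu (k j) + nsq mu W) by rewrite mulr_ge0// addr_ge0// nsq_ge0.
  apply: (@le_trans _ _ (n.+1%:R^-1 / (C + 1) * (2^-1 * (nsq mu (k j) + nsq mu W)) * ((C + 1) * \int[mu]_z rho z))).
    by rewrite ler_wpM2l// mulr_ge0// ltW.
  rewrite le_eqVlt; apply/orP; left; apply/eqP.
  have C1' : C + 1 != 0 by rewrite gt_eqF.
  have n1' : n.+1%:R != 0 :> R by rewrite pnatr_eq0.
  by field; rewrite C1' nat1r n1'.
apply: (le_trans (ler_norm_sum _ _ _)).
apply: (@le_trans _ _ (\sum_j (2^-1 * (nsq mu (k j) + nsq mu W) * n.+1%:R^-1 * \int[mu]_z rho z))).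
  by apply: ler_sum => j _; exact: com.
by rewrite -!mulr_suml.
Qed.

(** The derivatives [d_(y_j) W] need not be locally integrable, only their
    products with the weight are; this is why [W] is not used as a test
    function directly but through its mollifications, in the limit. *)
Lemma pairing_bounded : \sum_i ip mu (g i) (P i) + \sum_j ip mu (k j) (Q j) = ip mu f W.
Proof.
have [M M0 hM] := pairing_error.
have [rho_ hr] := choice hM.
have tr n : tfun (rho_ n) by case: (hr n).
have r0 n z : 0 <= rho_ n z by case: (hr n).
have I0 n : 0 < \int[mu]_z rho_ n z by case: (hr n).
have vr n : vanishes_off n.+1%:R^-1 (rho_ n) by case: (hr n).
have c1 i := mollip_cvg tr r0 I0 vr (lg i) (lP i).
have c2 j := mollip_cvg tr r0 I0 vr (lk j) (lQ j).
have c3 := mollip_cvg tr r0 I0 vr lf lW.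
pose u n := \sum_i (mollip (rho_ n) (g i) (P i) / \int[mu]_z rho_ n z) +
  \sum_j (mollip (rho_ n) (k j) (Q j) / \int[mu]_z rho_ n z) - mollip (rho_ n) f W / \int[mu]_z rho_ n z.
have cu : u @ \oo --> \sum_i ip mu (g i) (P i) + \sum_j ip mu (k j) (Q j) - ip mu f W.
  apply: cvgB => //; by apply: cvgD; [exact: (cvgn_sum c1)|exact: (cvgn_sum c2)].
have c0 : u @ \oo --> (0 : R).
  apply/cvgrPdist_le => e e0; near=> n.
  rewrite sub0r normrN /u -!mulr_suml -mulrDl -mulrBl normrM normfV (gtr0_norm (I0 n)).
  have [_ _ _ _ hn] := hr n.
  rewrite ler_pdivrMr//; apply: (le_trans hn); rewrite ler_wpM2r ?ltW//.
  near: n.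
  have : (fun n => M * n.+1%:R^-1) @ \oo --> M * 0 by apply: cvgMl_tmp; exact: cvg_harmonic.
  rewrite mulr0 => /cvgrPdist_lt/(_ _ e0); apply: filterS => n.
  by rewrite sub0r normrN ger0_norm// mulr_ge0.
by apply/eqP; rewrite -subr_eq0 -(cvg_lim _ cu)// (cvg_lim _ c0).
Unshelve. all: by end_near.
Qed.

End pairing.

(** * Testing the equation against translates of its solution *)

Section shifted_pairing.
Context (R : realType) (N l : nat).
Local Notation E := ('rV[R]_N * 'rV[R]_l)%type.
Local Notation mu := (lebesgue_space R N l).
Local Notation box := (@box R N l).
Implicit Types (z v s : E) (a f g phi psi rho kap F K W Q : E -> R).

Lemma l2_mul_cvg (C : R) (m_ : nat -> E -> R) (m F G : E -> R) :
  (forall n, measurable_fun setT (m_ n)) -> (forall n z, `|m_ n z| <= C) ->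
  (forall z, m_ ^~ z @ \oo --> m z) -> l2 mu F -> l2 mu G ->
  (fun n => ip mu G (fun z => m_ n z * F z)) @ \oo --> ip mu G (fun z => m z * F z).
Proof.
move=> mm mC mc lF lG.
have lm n : l2 mu (fun z => m_ n z * F z) by exact: (l2_bM (mm n) (mC n)).
have [||||lmF c] := @l2dct _ E R mu (fun n z => m_ n z * F z) (fun z => m z * F z) (fun z => C * `|F z|).
- by move=> n; case: (lm n).
- by move=> z; apply: cvgM; [exact: mc|exact: cvg_cst].
- by apply: l2Z; exact: l2_norm.
- by move=> n z; rewrite normrM ler_wpM2r.
by rewrite ipC; under eq_fun do rewrite ipC; exact: ip_cvg.
Qed.

Lemma corr_cvg F G (s_ : nat -> E) : l2 mu F -> l2 mu G ->
  (forall n, box n.+1%:R^-1 (s_ n)) ->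
  (fun n => ip mu G (fun z => F (z + s_ n))) @ \oo --> ip mu G F.
Proof.
move=> lF lG hs; rewrite ipC; under eq_fun do rewrite ipC.
apply: (@ip_cvg _ _ _ _ (fun n z => F (z + s_ n))) => //.
  by move=> n; exact: (l2_translate (s_ n)).
apply/cvgrPdist_le => e e0; have [d d0 hd] := l2_translate_continuous lF e0.
near=> n; rewrite sub0r normrN ger0_norm ?nsq_ge0//; apply: hd; apply: box_le (hs n).
near: n; have := @cvg_harmonic R => /cvgrPdist_le/(_ d d0); apply: filterS => n.
by rewrite /harmonic/= sub0r normrN ger0_norm.
Unshelve. all: by end_near.
Qed.

Lemma wder_translate a v s W K : (forall z, a (z + s) = a z) ->
  measurable_fun setT a -> locally_bounded a -> l2 mu W -> l2 mu K ->
  wder a v W K -> wder a v (fun z => W (z + s)) (fun z => K (z + s)).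
Proof.
move=> as_ ma la lW lK dW phi tphi.
have tphis : tfun (fun z => phi (z - s)) by exact: (tfun_translate (- s) tphi).
have := dW _ tphis.
have l1 : l2 mu (fun z => a z * 'D_v (fun z => phi (z - s)) z).
  exact: (l2_weight ma la (tfun_derive v tphis)).
rewrite -(ip_translate s lW l1) -(ip_translate s lK (tfun_l2 tphis)) => e.
rewrite [RHS](_ : _ = - ip mu (fun z => K (z + s)) (fun z => phi (z + s - s))); last first.
  by congr (- _); apply: eq_Rintegral => z _; rewrite addrK.
rewrite -e; apply: eq_Rintegral => z _; congr (_ * _).
by rewrite as_ (derive_translate (- s)) addrK.
Qed.

(** Cutoffs that do not depend on [y], so that they commute with the weighted
    derivatives; their gradient is bounded and tends to [0]. The factor [expR
    1] normalises [flat 0 1]. *)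
Definition xcut (n : nat) z : R := expR 1 * flat 0 (1 - n.+1%:R^-1 * qx z).

Lemma elem_xcut n : elem (xcut n).
Proof.
apply: elem_scale; apply: elem_flat; apply: elem_sub; first exact: elem_cst.
by apply: elem_scale; exact: elem_qx.
Qed.

Lemma xcut_bound n z : `|xcut n z| <= expR 1.
Proof. by rewrite ger0_norm ?mulr_ge0 ?expR_ge0 ?flat_ge0// ler_piMr ?expR_ge0// flat0_le1. Qed.

Lemma xcut_eq0 n z : n.+1%:R < qx z -> xcut n z = 0.
Proof.
move=> h; rewrite /xcut flat_le0 ?mulr0// subr_le0 mulrC ler_pdivlMr// mul1r.
exact: ltW.
Qed.

Lemma cvg_harmonicM (c : R) : (fun n => n.+1%:R^-1 * c) @ \oo --> (0 : R).
Proof.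
have : (fun n => n.+1%:R^-1 * c) @ \oo --> 0 * c.
  by apply: cvgM; [exact: cvg_harmonic|exact: cvg_cst].
by rewrite mul0r.
Qed.

Lemma xcut_arg_cvg z : (fun n => 1 - n.+1%:R^-1 * qx z) @ \oo --> (1 : R).
Proof.
have : (fun n => 1 - n.+1%:R^-1 * qx z) @ \oo --> 1 - (0 : R).
  by apply: cvgB; [exact: cvg_cst|exact: cvg_harmonicM].
by rewrite subr0.
Qed.

Lemma xcut_cvg z : xcut ^~ z @ \oo --> (1 : R).
Proof.
have -> : (1 : R) = expR 1 * flat 0 1 by rewrite flat_gt0E// expr0 mul1r invr1 expRxMexpNx_1.
apply: cvgMl_tmp.
apply: (@cvg_comp _ _ _ (fun n => 1 - n.+1%:R^-1 * qx z) (flat 0) _ (nbhs (1 : R))).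
  exact: xcut_arg_cvg.
exact: continuous_flat.
Qed.

Lemma derive_xcut n v z : 'D_v (xcut n) z =
  - (expR 1 * flat 2 (1 - n.+1%:R^-1 * qx z) * (n.+1%:R^-1 * (2 * \sum_i v.1 0 i * z.1 0 i))).
Proof.
have e1 : elem (fun z : E => - n.+1%:R^-1 * qx z) by apply: elem_scale; exact: elem_qx.
have e2 : elem (fun z : E => 1 - n.+1%:R^-1 * qx z).
  by apply: elem_sub; [exact: elem_cst|apply: elem_scale; exact: elem_qx].
rewrite /xcut derive_scaleE; last exact: elem_flat.
rewrite derive_flatE// mul0r subr0.
rewrite (_ : 'D_v _ z = - (n.+1%:R^-1 * (2 * \sum_i v.1 0 i * z.1 0 i))); first ring.
rewrite (_ : (fun z : E => _) = fun z => 1 + (- n.+1%:R^-1) * qx z); last first.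
  by apply/funext => w; rewrite mulNr.
rewrite derive_addE//; last exact: elem_cst.
by rewrite derive_scaleE ?derive_qx ?derive_cst ?add0r ?mulNr//; exact: elem_qx.
Qed.

Lemma derive_xcut_x n i z : 'D_(ex R l i) (xcut n) z =
  - (expR 1 * flat 2 (1 - n.+1%:R^-1 * qx z) * (n.+1%:R^-1 * (2 * z.1 0 i))).
Proof. by rewrite derive_xcut sum_ex. Qed.

Lemma derive_xcut_y n j z : 'D_(ey R N j) (xcut n) z = 0.
Proof.
rewrite derive_xcut big1 ?mulr0 ?mulr0 ?oppr0// => i _.
by rewrite mxE mul0r.
Qed.

Lemma derive_xcut_bound n i z : `|'D_(ex R l i) (xcut n) z| <= expR 1 * (4 ^+ 4) * 2.
Proof.
have n0 : 0 < n.+1%:R :> R by [].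
have ni0 : 0 < n.+1%:R^-1 :> R by rewrite invr_gt0.
rewrite derive_xcut_x normrN !normrM [`|expR 1|]gtr0_norm ?expR_gt0// ger0_norm ?flat_ge0//.
have [h|h] := leP (1 - n.+1%:R^-1 * qx z) 0.
  by rewrite flat_le0// mulr0 mul0r !mulr_ge0// ?expR_ge0// exprn_ge0.
rewrite ler_pM ?mulr_ge0 ?expR_ge0 ?flat_ge0//.
  rewrite ler_wpM2l ?expR_ge0// (le_trans (flat_le_sqr 2 _))// ler_piMr ?exprn_ge0//.
  apply: exprn_ile1; first exact: ltW.
  by rewrite lerBlDr lerDl mulr_ge0// ?qx_ge0.
rewrite [`|2|]ger0_norm// [`|n.+1%:R^-1|]gtr0_norm// mulrCA ler_piMr//.
rewrite ler_pdivrMl// mulr1.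
have qn : qx z < n.+1%:R by move: h; rewrite subr_gt0 mulrC ltr_pdivrMr// mul1r.
apply: sqr_lt_sqr => //; apply: (le_lt_trans (qx_ge z i)); apply: (lt_le_trans qn).
by rewrite expr2 ler_peMr// ler1n.
Qed.

Lemma derive_xcut_cvg i z : (fun n => 'D_(ex R l i) (xcut n) z) @ \oo --> (0 : R).
Proof.
under eq_fun do rewrite derive_xcut_x.
have : (fun n => - (expR 1 * flat 2 (1 - n.+1%:R^-1 * qx z) * (n.+1%:R^-1 * (2 * z.1 0 i)))) @ \oo -->
    - (expR 1 * flat 2 1 * (0 : R)).
  apply: cvgN; apply: cvgM; last exact: cvg_harmonicM.
  apply: cvgMl_tmp.
  apply: (@cvg_comp _ _ _ (fun n => 1 - n.+1%:R^-1 * qx z) (flat 2) _ (nbhs (1 : R))).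
    exact: xcut_arg_cvg.
  exact: continuous_flat.
by rewrite mulr0 oppr0.
Qed.

Lemma x_bounded_local a : x_bounded a -> locally_bounded a.
Proof.
move=> ba r; have [C C0 hC] := ba (N%:R * r ^+ 2); exists C => // z [bz _]; apply: hC.
rewrite -[N in N%:R]card_ord mulr_natl -sumr_const; apply: ler_sum => i _.
by rewrite -[leLHS]real_normK ?num_real// ler_sqr ?nnegrE// (le_trans _ (bz i)).
Qed.

Variables (a : E -> R) (j0 : 'I_l) (g : 'I_N -> E -> R) (k : 'I_l -> E -> R)
  (f U : E -> R).
Hypotheses (ma : measurable_fun setT a) (ba : x_bounded a) (ua : x_unif a)
  (ay : forall z j (t : R), a (z + t *: ey R N j) = a z)
  (lg : forall i, l2 mu (g i)) (lk : forall j, l2 mu (k j)) (lf : l2 mu f)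
  (lU : l2 mu U) (U0 : forall z, z.2 0 j0 <= 0 -> U z = 0)
  (dUx : forall i, wder (fun=> 1) (ex R l i) U (g i))
  (dUy : forall j, wder a (ey R N j) U (k j))
  (eqn : forall phi, tfun phi ->
    (exists2 t, 0 < t & forall z, z.2 0 j0 <= t -> phi z = 0) ->
    \sum_i ip mu (g i) ('D_(ex R l i) phi) +
    \sum_j ip mu (k j) (fun z => a z * 'D_(ey R N j) phi z) = ip mu f phi).

Definition pushdown (h : R) : E := (- h) *: ey R N j0.

(** The translated zero extension vanishes for [y_l <= h], so
    [pairing_bounded] applies to it after a cutoff in [x], which is then
    removed. *)
Lemma pairing_shift (h : R) : 0 < h ->
  \sum_i ip mu (g i) (fun z => g i (z + pushdown h)) +
  \sum_j ip mu (k j) (fun z => k j (z + pushdown h)) = ip mu f (fun z => U (z + pushdown h)).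
Proof.
move=> h0; pose s := pushdown h.
have la := x_bounded_local ba.
have lUs : l2 mu (fun z => U (z + s)) by exact: (l2_translate s).
have lgs i : l2 mu (fun z => g i (z + s)) by exact: (l2_translate s).
have lks j : l2 mu (fun z => k j (z + s)) by exact: (l2_translate s).
have d1 i : wder (fun=> 1) (ex R l i) (fun z => U (z + s)) (fun z => g i (z + s)).
  by apply: wder_translate => // r; exists 1 => // z _; rewrite normr1.
have d2 j : wder a (ey R N j) (fun z => U (z + s)) (fun z => k j (z + s)).
  by apply: wder_translate => // z; exact: ay.
have mX n : measurable_fun setT (xcut n) by exact: (elem_measurable (elem_xcut n)).
have mDX n i : measurable_fun setT ('D_(ex R l i) (xcut n)).
  exact: (elem_measurable (elem_derive (ex R l i) (elem_xcut n))).
have lX n F : l2 mu F -> l2 mu (fun z => xcut n z * F z) by exact: (l2_bM (mX n) (xcut_bound n)).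
have lDX n i F : l2 mu F -> l2 mu (fun z => 'D_(ex R l i) (xcut n) z * F z).
  exact: (l2_bM (mDX n i) (derive_xcut_bound n i)).
have main n : \sum_i ip mu (g i) (fun z => xcut n z * g i (z + s) + 'D_(ex R l i) (xcut n) z * U (z + s)) +
    \sum_j ip mu (k j) (fun z => xcut n z * k j (z + s)) = ip mu f (fun z => xcut n z * U (z + s)).
  apply: (@pairing_bounded R N l a j0 g k f _ _ _ h n.+1%:R) => //.
  - by move=> i; apply: l2D; [exact: lX|exact: lDX].
  - by move=> j; exact: lX.
  - exact: lX.
  - move=> z hz; rewrite U0 ?mulr0// /s /pushdown /= !mxE !eqxx/= mulr1 ?subr_le0//.
  - by move=> z hz; rewrite xcut_eq0// mul0r.
  - move=> i phi tphi.
    have tx : tfun (fun z => xcut n z * phi z) by apply: tfun_mull => //; exact: elem_xcut.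
    have := d1 i _ tx.
    have l1 := tfun_l2 (tfun_derive (ex R l i) tphi).
    have l2' := tfun_l2 tphi.
    rewrite (_ : ip mu (fun z => U (z + s)) _ =
      ip mu (fun z => xcut n z * U (z + s)) (fun z => 1 * 'D_(ex R l i) phi z) +
      ip mu (fun z => 'D_(ex R l i) (xcut n) z * U (z + s)) phi); last first.
      rewrite /ip -RintD; last 2 first.
      - by under eq_fun do rewrite mul1r; apply: l2M => //; exact: lX.
      - by apply: l2M => //; exact: lDX.
      apply: eq_Rintegral => z _; rewrite derive_mulE; [ring|exact: elem_xcut|by case: tphi].
    rewrite (_ : ip mu (fun z => g i (z + s)) _ = ip mu (fun z => xcut n z * g i (z + s)) phi); last first.
      by apply: eq_Rintegral => z _; ring.
    rewrite ipDl//; [|exact: lX|exact: lDX].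
    by move=> e; rewrite opprD -e addrK.
  - move=> j phi tphi.
    have tx : tfun (fun z => xcut n z * phi z) by apply: tfun_mull => //; exact: elem_xcut.
    have := d2 j _ tx.
    rewrite (_ : ip mu (fun z => U (z + s)) _ =
      ip mu (fun z => xcut n z * U (z + s)) (fun z => a z * 'D_(ey R N j) phi z)); last first.
      apply: eq_Rintegral => z _; rewrite derive_mulE; last by case: tphi.
        by rewrite derive_xcut_y; ring.
      exact: elem_xcut.
    move=> ->; congr (- _); apply: eq_Rintegral => z _; ring.
have mainE n : \sum_i (ip mu (g i) (fun z => xcut n z * g i (z + s)) +
      ip mu (g i) (fun z => 'D_(ex R l i) (xcut n) z * U (z + s))) +
    \sum_j ip mu (k j) (fun z => xcut n z * k j (z + s)) = ip mu f (fun z => xcut n z * U (z + s)).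
  rewrite -main; congr (_ + _); apply: eq_bigr => i _.
  rewrite ![ip mu (g i) _]ipC ipDl//; [exact: lX|exact: lDX].
have one F : (fun z => 1 * F z) = F :> (E -> R) by apply/funext => z; rewrite mul1r.
have xc F G : l2 mu F -> l2 mu G ->
    (fun n => ip mu G (fun z => xcut n z * F z)) @ \oo --> ip mu G F.
  move=> lF lG; rewrite -[X in ip mu G X]one.
  exact: (l2_mul_cvg mX xcut_bound xcut_cvg lF lG).
have dxc i F G : l2 mu F -> l2 mu G ->
    (fun n => ip mu G (fun z => 'D_(ex R l i) (xcut n) z * F z)) @ \oo --> (0 : R).
  move=> lF lG.
  have := l2_mul_cvg (fun n => mDX n i) (fun n => derive_xcut_bound n i) (derive_xcut_cvg i) lF lG.
  rewrite [X in _ --> X -> _](_ : _ = 0)//.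
  rewrite /ip; under eq_Rintegral do rewrite mul0r mulr0.
  exact: Rint0.
have c1 : (fun n => \sum_i (ip mu (g i) (fun z => xcut n z * g i (z + s)) +
      ip mu (g i) (fun z => 'D_(ex R l i) (xcut n) z * U (z + s))) +
    \sum_j ip mu (k j) (fun z => xcut n z * k j (z + s))) @ \oo -->
    \sum_i (ip mu (g i) (fun z => g i (z + s)) + 0) + \sum_j ip mu (k j) (fun z => k j (z + s)).
  apply: cvgD; apply: cvgn_sum => i; last exact: xc.
  by apply: cvgD; [exact: xc|exact: dxc].
have c2 := xc _ _ lUs lf.
have := cvgn_eq mainE c1 c2.
by under eq_bigr do rewrite addr0.
Qed.

Lemma box_ey j (t : R) : box `|t| (t *: ey R N j).
Proof.
split => i; rewrite !mxE ?mulr0 ?normr0// normrM ler_piMr//.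
by case: (_ && _); rewrite ?normr1 ?normr0.
Qed.

(** The limit [h -> 0] of [pairing_shift]. *)
Lemma energy_identity : \sum_i nsq mu (g i) + \sum_j nsq mu (k j) = ip mu f U.
Proof.
pose s_ n := pushdown n.+1%:R^-1.
have bs n : box n.+1%:R^-1 (s_ n).
  by have := box_ey j0 (- n.+1%:R^-1); rewrite normrN ger0_norm.
have c1 : (fun n => \sum_i ip mu (g i) (fun z => g i (z + s_ n)) +
    \sum_j ip mu (k j) (fun z => k j (z + s_ n))) @ \oo -->
    \sum_i ip mu (g i) (g i) + \sum_j ip mu (k j) (k j).
  by apply: cvgD; apply: cvgn_sum => i; exact: corr_cvg.
have c2 := corr_cvg lU lf bs.
under eq_bigr do rewrite -ip_nsq; under [X in _ + X]eq_bigr do rewrite -ip_nsq.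
by apply: (cvgn_eq _ c1 c2) => n; rewrite pairing_shift// invr_gt0.
Qed.

(** Expand the squares; translation does not change the norms, the mixed terms
    are given by [pairing_shift] and the others by [energy_identity]. *)
Lemma energy_shift (h : R) : 0 < h ->
  \sum_i nsq mu (fun z => g i z - g i (z + pushdown h)) +
  \sum_j nsq mu (fun z => k j z - k j (z + pushdown h)) =
  2 * ip mu f (fun z => U z - U (z + pushdown h)).
Proof.
move=> h0; have lUs : l2 mu (fun z => U (z + pushdown h)) by exact: l2_translate.
rewrite ipBr// -energy_identity -(pairing_shift h0).
have e F : l2 mu F -> nsq mu (fun z => F z - F (z + pushdown h)) =
    2 * (nsq mu F - ip mu F (fun z => F (z + pushdown h))).
  move=> lF; rewrite nsqB ?nsq_translate//; [ring|exact: l2_translate].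
under eq_bigr do rewrite e//; under [X in _ + X = _]eq_bigr do rewrite e//.
by rewrite -!mulr_sumr -mulrDr !sumrB; congr (_ * _); ring.
Qed.

End shifted_pairing.

(** * The flux near the boundary *)

Section power_inequality.
Context (R : realType).
Implicit Types (x y M p r : R).

Lemma powR_succ r x : 0 < r -> 0 <= x -> x `^ r * x = x `^ (r + 1).
Proof.
move=> r0 x0; rewrite powRD ?powRr1//.
by rewrite gt_eqF// addr_gt0.
Qed.

(** Young's inequality with the conjugate exponents [(r + 1) / r] and [r + 1]. *)
Lemma powR_young r x y : 0 < r -> 0 <= x -> 0 <= y ->
  x `^ r * y <= r / (r + 1) * (x `^ r * x) + (r + 1)^-1 * (y `^ r * y).
Proof.
move=> r0 x0 y0; have r1 : 0 < r + 1 by rewrite addr_gt0.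
have rn : r != 0 by rewrite gt_eqF.
have r1n : r + 1 != 0 by rewrite gt_eqF.
have q0 : 0 < (r + 1) / r by rewrite divr_gt0.
have e : ((r + 1) / r)^-1 + (r + 1)^-1 = 1 by field; rewrite rn r1n.
apply: (le_trans (conjugate_powR (powR_ge0 x r) y0 q0 r1 e)).
rewrite -powRrM [r * _]mulrC divfK// !powR_succ//.
by rewrite le_eqVlt; apply/orP; left; apply/eqP; field; rewrite rn r1n.
Qed.

(** Convexity of [t `^ p]. *)
Lemma powR_sub_le p x y : 1 < p -> 0 <= x -> 0 <= y ->
  x `^ p - y `^ p <= p * x `^ (p - 1) * (x - y).
Proof.
move=> p1 x0 y0; have r0 : 0 < p - 1 by rewrite subr_gt0.
have := powR_young r0 x0 y0; rewrite !powR_succ// subrK => h.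
rewrite mulrBr -mulrA powR_succ// subrK.
have p0 : 0 < p by lra.
have : p * (x `^ (p - 1) * y) <= p * ((p - 1) / p * x `^ p + p^-1 * y `^ p).
  by rewrite ler_wpM2l// ltW.
rewrite (_ : p * (_ + _) = (p - 1) * x `^ p + y `^ p); first by lra.
by field; rewrite gt_eqF.
Qed.

Lemma powR_lipschitz p M x y : 1 < p -> 0 <= x <= M -> 0 <= y <= M ->
  (x `^ p - y `^ p) * (x - y) <= p * M `^ (p - 1) * (x - y) ^+ 2.
Proof.
move=> p1; wlog yx : x y / y <= x.
  move=> h hx hy; have [yx|/ltW xy] := leP y x; first exact: h.
  rewrite (_ : (x `^ p - y `^ p) * (x - y) = (y `^ p - x `^ p) * (y - x)); last by ring.
  by rewrite -[(x - y) ^+ 2]sqrrN opprB; exact: h.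
move=> /andP[x0 xM] /andP[y0 yM].
rewrite expr2 mulrA ler_wpM2r ?subr_ge0//.
apply: (le_trans (powR_sub_le p1 x0 y0)).
rewrite ler_wpM2r ?subr_ge0// ler_wpM2l//; first by lra.
apply: ge0_ler_powR; rewrite ?nnegrE//; first by rewrite subr_ge0 ltW.
exact: le_trans xM.
Qed.

End power_inequality.

Section strip_estimate.
Context (R : realType) (N l : nat).
Local Notation E := ('rV[R]_N * 'rV[R]_l)%type.
Local Notation mu := (lebesgue_space R N l).
Local Notation box := (@box R N l).
Implicit Types (z v s : E).

Lemma nsq_le2 (f g : E -> R) : l2 mu f -> l2 mu g -> (forall z, f z ^+ 2 <= g z ^+ 2) ->
  nsq mu f <= nsq mu g.
Proof. by move=> [_ f2] [_ g2] fg; exact: Rint_le. Qed.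

(** The pairing of the translate of [U ^ p] with [U - U (z + s)] is
    nonpositive, by Young's inequality and translation invariance; subtract
    it, and use that [t ^ p] is Lipschitz on the range of [U]. *)
Lemma power_translate_le (p M : R) (U : E -> R) s : 1 < p ->
  (forall z, 0 <= U z <= M) -> l2 mu U -> l2 mu (fun z => U z `^ p) ->
  ip mu (fun z => U z `^ p) (fun z => U z - U (z + s)) <=
  p * M `^ (p - 1) * nsq mu (fun z => U z - U (z + s)).
Proof.
move=> p1 hU lU lf; have p0 : 0 < p by lra.
have pp0 : 0 < p + 1 by lra.
have U0 z : 0 <= U z by case/andP: (hU z).
pose f z := U z `^ p.
have lUs : l2 mu (fun z => U (z + s)) := l2_translate s lU.
have lfs : l2 mu (fun z => f (z + s)) := l2_translate s lf.
have lw : l2 mu (fun z => U z - U (z + s)) by exact: l2B.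
have h1 : ip mu (fun z => f (z + s)) (fun z => U z - U (z + s)) <= 0.
  rewrite ipBr// ip_translate// subr_le0.
  have -> : ip mu f U = p / (p + 1) * ip mu (fun z => f (z + s)) (fun z => U (z + s)) + (p + 1)^-1 * ip mu f U.
    by rewrite ip_translate//; field; rewrite gt_eqF.
  rewrite /ip -!RintZ; [|exact: l2M|exact: l2M].
  rewrite -RintD; [|by apply: integZ; exact: l2M|by apply: integZ; exact: l2M].
  apply: Rint_le; [exact: l2M|by apply: integD; apply: integZ; exact: l2M|].
  by move=> z; exact: powR_young.
have -> : ip mu f (fun z => U z - U (z + s)) =
    ip mu (fun z => f z - f (z + s)) (fun z => U z - U (z + s)) +
    ip mu (fun z => f (z + s)) (fun z => U z - U (z + s)) by rewrite ipBl// subrK.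
rewrite -[leRHS]addr0 lerD// /ip /nsq.
have [_ lw2] := lw; rewrite -RintZ//; apply: Rint_le; last by move=> z; exact: powR_lipschitz.
- by apply: l2M => //; exact: l2B.
- exact: integZ.
Qed.

Variables (a : E -> R) (i0 : 'I_N) (j0 : 'I_l) (g : 'I_N -> E -> R) (k : 'I_l -> E -> R)
  (U : E -> R) (p M : R).
Hypotheses (ma : measurable_fun setT a) (ba : x_bounded a) (ua : x_unif a)
  (ay : forall z j (t : R), a (z + t *: ey R N j) = a z)
  (al : forall d : R, 0 < d -> exists2 c, 0 < c & forall z, d <= `|z.1 0 i0| -> c <= `|a z|)
  (lg : forall i, l2 mu (g i)) (lk : forall j, l2 mu (k j))
  (lf : l2 mu (fun z => U z `^ p)) (p1 : 1 < p) (UM : forall z, 0 <= U z <= M)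
  (lU : l2 mu U) (U0 : forall z, z.2 0 j0 <= 0 -> U z = 0)
  (k0 : forall j z, z.2 0 j0 <= 0 -> k j z = 0)
  (dUx : forall i, wder (fun=> 1) (ex R l i) U (g i))
  (dUy : forall j, wder a (ey R N j) U (k j))
  (eqn : forall phi, tfun phi ->
    (exists2 t, 0 < t & forall z, z.2 0 j0 <= t -> phi z = 0) ->
    \sum_i ip mu (g i) ('D_(ex R l i) phi) +
    \sum_j ip mu (k j) (fun z => a z * 'D_(ey R N j) phi z) =
    ip mu (fun z => U z `^ p) phi).

Let D (h : R) := \sum_i nsq mu (fun z => g i z - g i (z + pushdown N j0 h)) +
  \sum_j nsq mu (fun z => k j z - k j (z + pushdown N j0 h)).

Let w (h : R) z := U z - U (z + pushdown N j0 h).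

Let L := p * M `^ (p - 1).

Let L0 : 0 <= L.
Proof. by rewrite /L mulr_ge0 ?powR_ge0// ltW// (lt_trans _ p1). Qed.

Let lw h : l2 mu (w h).
Proof. by apply: l2B => //; exact: l2_translate. Qed.

Let D_le h : 0 < h -> D h <= 2 * L * nsq mu (w h).
Proof.
move=> h0; rewrite /D (energy_shift ma ba ua ay lg lk lf lU U0 dUx dUy eqn h0).
by rewrite -mulrA ler_wpM2l//; exact: power_translate_le.
Qed.

Let g_le h i : nsq mu (fun z => g i z - g i (z + pushdown N j0 h)) <= D h.
Proof.
rewrite /D (bigD1 i)//= -addrA lerDl addr_ge0//; apply: sumr_ge0 => *; exact: nsq_ge0.
Qed.

Let k_le h j : nsq mu (fun z => k j z - k j (z + pushdown N j0 h)) <= D h.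
Proof.
rewrite /D addrC (bigD1 j)//= -addrA lerDl addr_ge0//; apply: sumr_ge0 => *; exact: nsq_ge0.
Qed.

Let wx_le h (t : R) : 0 <= t ->
  l2 mu (fun z => w h (z + t *: ex R l i0) - w h z) /\
  nsq mu (fun z => w h (z + t *: ex R l i0) - w h z) <= t ^+ 2 * D h.
Proof.
move=> t0; have l1 : locally_bounded ((fun=> 1) : E -> R).
  by move=> r; exists 1 => // z _; rewrite normr1.
have lgs : l2 mu (fun z => g i0 (z + pushdown N j0 h)) := l2_translate _ (lg i0).
have lUs : l2 mu (fun z => U (z + pushdown N j0 h)) := l2_translate _ lU.
have dw : wder (fun=> 1) (ex R l i0) (w h) (fun z => g i0 z - g i0 (z + pushdown N j0 h)).
  move=> phi tphi; have lp := tfun_l2 tphi.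
  have lp' : l2 mu (fun z => 1 * 'D_(ex R l i0) phi z).
    by under eq_fun do rewrite mul1r; exact: (tfun_l2 (tfun_derive _ tphi)).
  rewrite /w !ipBl// opprB dUx// (wder_translate _ _ _ _ _ (dUx i0))//.
  by rewrite opprK addrC.
have [] := wder_shift _ l1 (fun _ _ => erefl) (lw h) (l2B (lg i0) lgs) dw t0 => //.
rewrite (_ : (fun z : E => 1 * _) = fun z => w h (z + t *: ex R l i0) - w h z); last first.
  by apply/funext => z; rewrite mul1r.
by move=> lD nD; split => //; rewrite (le_trans nD)// ler_wpM2l ?sqr_ge0.
Qed.

Let aw_le h : 0 <= h ->
  l2 mu (fun z => a z * w h z) /\ nsq mu (fun z => a z * w h z) <= h ^+ 2 * nsq mu (k j0).
Proof.
move=> h0; have [lG nG] := wder_shift ma (x_bounded_local ba) (fun z t => ay z j0 t) lU (lk j0) (dUy j0) h0.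
have e : (fun z => a z * w h z) =
    (fun z => a (z + pushdown N j0 h) * (U (z + pushdown N j0 h + h *: ey R N j0) - U (z + pushdown N j0 h))).
  by apply/funext => z; rewrite /pushdown ay -addrA -scalerDl addNr scale0r addr0.
rewrite e; split; first exact: (l2_translate _ lG).
by rewrite (nsq_translate _ lG).
Qed.

(** Away from [x = 0] the increment is controlled by the weighted derivative.
    Near it, move by [2 d] in [x] and pay with the increment of the
    [x]-derivative, which [D_le] bounds by the increment itself: for small [d]
    this term is absorbed. *)
Lemma shift_estimate : exists2 C, 0 <= C & forall h, 0 < h -> nsq mu (w h) <= C * h ^+ 2.
Proof.
(* chosen so that [2 * (2 d) ^ 2 * 2 L <= 1 / 2] *)
pose d := (8 * (1 + L))^-1.
have L1 : 0 < 1 + L by rewrite ltr_wpDr.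
have d0 : 0 < d by rewrite invr_gt0 mulr_gt0.
have [c c0 hc] := al d0.
have ci0 : 0 < c^-1 by rewrite invr_gt0.
exists (6 * c^-1 ^+ 2 * nsq mu (k j0)).
  by rewrite mulr_ge0 ?nsq_ge0// mulr_ge0// exprn_ge0// ltW.
move=> h h0; have d2 : 0 <= 2 * d by rewrite mulr_ge0// ltW.
have [lx nx] := wx_le h d2; have [la na] := aw_le (ltW h0).
pose e := (2 * d) *: ex R l i0.
have las : l2 mu (fun z => a (z + e) * w h (z + e)) := l2_translate e la.
(* one of [z] and [z + e] is at distance at least [d] from [x = 0] *)
have key : nsq mu (w h) <= 3 * c^-1 ^+ 2 * nsq mu (fun z => a z * w h z) +
    2 * nsq mu (fun z => w h (z + e) - w h z).
  have -> : 3 * c^-1 ^+ 2 * nsq mu (fun z => a z * w h z) =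
      c^-1 ^+ 2 * nsq mu (fun z => a z * w h z) +
      2 * c^-1 ^+ 2 * nsq mu (fun z => a (z + e) * w h (z + e)).
    by rewrite (nsq_translate e la); ring.
  have [[_ i1] [_ i2] [_ i3] [_ i4]] := And4 (lw h) la las lx.
  rewrite /nsq -!RintZ// -RintD; [|exact: integZ|exact: integZ].
  rewrite -RintD; [|by apply: integD; exact: integZ|exact: integZ].
  apply: Rint_le => //; first by apply: integD; [apply: integD|]; exact: integZ.
  move=> z; have cw (y : E) : d <= `|y.1 0 i0| -> w h y ^+ 2 <= c^-1 ^+ 2 * (a y * w h y) ^+ 2.
    move=> hy; have ca := hc y hy.
    rewrite exprMn mulrA -exprMn ler_peMl ?sqr_ge0// -[leRHS]real_normK ?num_real// normrM.
    rewrite -[leLHS](expr1n _ 2) ler_sqr ?nnegrE// gtr0_norm//.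
    by rewrite ler_pdivlMl// mulr1.
  have s1 : 0 <= c^-1 ^+ 2 * (a z * w h z) ^+ 2 by rewrite mulr_ge0 ?sqr_ge0.
  have s2 : 0 <= c^-1 ^+ 2 * (a (z + e) * w h (z + e)) ^+ 2 by rewrite mulr_ge0 ?sqr_ge0.
  have s3 : 0 <= (w h (z + e) - w h z) ^+ 2 by exact: sqr_ge0.
  have [hz|hz] := leP d `|z.1 0 i0|; first by have := cw z hz; lra.
  have ez : d <= `|(z + e).1 0 i0|.
    rewrite /e /ex/= !mxE !eqxx/= mulr1 (le_trans _ (ler_norm _))//.
    by move: hz; rewrite ltr_norml => /andP[h1 _]; lra.
  have s4 : 0 <= (w h (z + e) - (w h (z + e) - w h z) *+ 2) ^+ 2 by exact: sqr_ge0.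
  have s5 : w h z ^+ 2 <= 2 * w h (z + e) ^+ 2 + 2 * (w h (z + e) - w h z) ^+ 2.
    move: s4; rewrite !expr2 mulr2n; set A := w h z; set B := w h (z + e).
    have : 0 <= (2 * B - A) * (2 * B - A) by rewrite -expr2 sqr_ge0.
    by nra.
  by have := cw _ ez; lra.
have dL : (2 * d) ^+ 2 * (2 * L) <= 4^-1.
  have e1 : d * (1 + L) = 8^-1 by rewrite /d invfM -mulrA mulVf ?mulr1// gt_eqF.
  have dL : d * L <= 8^-1 by rewrite -e1 ler_wpM2l ?lerDr// ltW.
  have d8 : d <= 8^-1 by rewrite -e1 ler_peMr ?lerDl// ltW.
  rewrite (_ : _ * _ = 8 * (d * (d * L))); last by ring.
  have : d * (d * L) <= 8^-1 * 8^-1.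
    apply: ler_pM => //; [exact: ltW|by rewrite mulr_ge0// ltW].
  lra.
have n0 := nsq_ge0 mu (w h).
have h1 : nsq mu (fun z => w h (z + e) - w h z) <= 4^-1 * nsq mu (w h).
  apply: (le_trans nx); apply: (@le_trans _ _ ((2 * d) ^+ 2 * (2 * L * nsq mu (w h)))).
    by rewrite ler_wpM2l ?sqr_ge0// D_le.
  by rewrite mulrA ler_wpM2r.
have h2 : 3 * c^-1 ^+ 2 * nsq mu (fun z => a z * w h z) <= 3 * c^-1 ^+ 2 * (h ^+ 2 * nsq mu (k j0)).
  by rewrite ler_wpM2l// mulr_ge0// sqr_ge0.
rewrite (_ : _ * _ * _ * _ = 2 * (3 * c^-1 ^+ 2 * (h ^+ 2 * nsq mu (k j0)))); last by ring.
lra.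
Qed.

(** Nothing flows in from below the boundary, so the increment of the flux over
    the strip of width [h] is the flux itself. *)
Lemma strip_estimate : exists2 C, 0 <= C & forall h, 0 < h ->
  nsq mu (fun z => \1_[set z : E | z.2 0 j0 <= h] z * k j0 z) <= C * h ^+ 2.
Proof.
have [C C0 hC] := shift_estimate.
exists (2 * L * C); first by rewrite mulr_ge0// mulr_ge0.
move=> h h0; rewrite [leRHS](_ : _ = 2 * L * (C * h ^+ 2)); last by ring.
apply: (@le_trans _ _ (2 * L * nsq mu (w h))); last first.
  by rewrite ler_wpM2l ?hC// mulr_ge0.
apply: le_trans (D_le h0); apply: le_trans (k_le h j0).
have ls : l2 mu (fun z => k j0 (z + pushdown N j0 h)) := l2_translate _ (lk j0).
apply: nsq_le2; [|exact: l2B|].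
  apply: (@l2_bM _ _ _ _ 1) => //.
    apply: measurable_indic; rewrite (_ : mkset _ = coory j0 @^-1` `]-oo, h]).
      by rewrite -[X in measurable X]setTI; apply: measurable_coory => //; exact: measurable_itv.
    by apply/seteqP; split => z /=; rewrite in_itv.
  by move=> z; rewrite indicE; case: (_ \in _); rewrite ?normr1 ?normr0.
move=> z; rewrite indicE; case: (boolP (z \in _)) => [|_]; last first.
  by rewrite mul0r expr0n/= sqr_ge0.
rewrite inE/= => hz; rewrite mul1r [k j0 (_ + _)]k0 ?subr0//.
by rewrite /pushdown /ey/= !mxE !eqxx/= mulr1 subr_le0.
Qed.

End strip_estimate.

(** * The equation across the boundary *)

Section boundary_cutoff.
Context (R : realType) (N l : nat) (j0 : 'I_l).
Local Notation E := ('rV[R]_N * 'rV[R]_l)%type.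
Local Notation mu := (lebesgue_space R N l).
Local Notation box := (@box R N l).
Local Notation strip := (@strip R N l).
Implicit Types (z v s : E) (a f g phi psi K W : E -> R).

(** Equal to [0] for [c * y_l <= 1] and to [1] for [c * y_l >= 2]: the inner
    [flat 0] is at least [expR (-1)] in the first region and vanishes in the
    second. *)
Definition ycut (c : R) z : R := expR 1 * flat 0 (1 - expR 1 * flat 0 (2 - c * z.2 0 j0)).

Lemma elem_ycut c : elem (ycut c).
Proof.
apply: elem_scale; apply: elem_flat; apply: elem_sub; first exact: elem_cst.
apply: elem_scale; apply: elem_flat; apply: elem_sub; first exact: elem_cst.
by apply: elem_scale; exact: elem_y.
Qed.

Lemma ycut_bound c z : `|ycut c z| <= expR 1.
Proof. by rewrite ger0_norm ?mulr_ge0 ?expR_ge0 ?flat_ge0// ler_piMr ?expR_ge0// flat0_le1. Qed.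

Lemma flat0_1 : expR 1 * flat 0 (1 : R) = 1.
Proof. by rewrite flat_gt0E// expr0 mul1r invr1 expRxMexpNx_1. Qed.

Lemma ycut_eq1 c z : 2 <= c * z.2 0 j0 -> ycut c z = 1.
Proof. by move=> h; rewrite /ycut [flat 0 (2 - _)]flat_le0 ?subr_le0// mulr0 subr0 flat0_1. Qed.

Lemma ycut_arg_le0 c z : c * z.2 0 j0 <= 1 -> 1 - expR 1 * flat 0 (2 - c * z.2 0 j0) <= 0.
Proof.
move=> h; rewrite subr_le0 -[leLHS]flat0_1 ler_wpM2l ?expR_ge0//.
have t1 : 1 <= 2 - c * z.2 0 j0 by lra.
rewrite !flat_gt0E//; last by lra.
by rewrite !expr0 !mul1r ler_expR lerN2 invr1 invf_le1//; lra.
Qed.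

Lemma ycut_eq0 c z : c * z.2 0 j0 <= 1 -> ycut c z = 0.
Proof. by move=> h; rewrite /ycut flat_le0 ?mulr0// ycut_arg_le0. Qed.

Lemma ycut_cvg (c_ : nat -> R) z : (forall n, n.+1%:R <= c_ n) ->
  (fun n => ycut (c_ n) z) @ \oo --> (\1_[set z : E | 0 < z.2 0 j0] z : R).
Proof.
move=> hc; rewrite indicE; case: (boolP (z \in _)); rewrite ?notin_setE ?inE/= => hz.
  apply: cvg_near_cst; near=> n; rewrite ycut_eq1// -ler_pdivrMr// (le_trans _ (hc n))//.
  apply: (@le_trans _ _ n%:R); last by rewrite ler_nat.
  by near: n; exact: nbhs_infty_ger.
apply: cvg_near_cst; near=> n; rewrite ycut_eq0//.
apply: (@le_trans _ _ 0) => //; apply: mulr_ge0_le0; last by rewrite leNgt; apply/negP.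
exact: le_trans (hc n).
Unshelve. all: by end_near.
Qed.

Lemma derive_ycut c v z : 'D_v (ycut c) z =
  expR 1 ^+ 2 * (flat 2 (1 - expR 1 * flat 0 (2 - c * z.2 0 j0)) * flat 2 (2 - c * z.2 0 j0)) *
  (c * v.2 0 j0).
Proof.
have e0 : elem (fun z : E => - c * z.2 0 j0) by apply: elem_scale; exact: elem_y.
have e1 : elem (fun z : E => 2 - c * z.2 0 j0).
  by apply: elem_sub; [exact: elem_cst|apply: elem_scale; exact: elem_y].
have e2 : elem (fun z : E => - expR 1 * flat 0 (2 - c * z.2 0 j0)).
  by apply: elem_scale; exact: elem_flat.
have e3 : elem (fun z : E => 1 - expR 1 * flat 0 (2 - c * z.2 0 j0)).
  by apply: elem_sub; [exact: elem_cst|apply: elem_scale; exact: elem_flat].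
rewrite /ycut derive_scaleE; last exact: elem_flat.
rewrite derive_flatE// mul0r subr0.
rewrite (_ : 'D_v (fun z : E => 1 - expR 1 * flat 0 (2 - c * z.2 0 j0)) z = expR 1 * (flat 2 (2 - c * z.2 0 j0) * (c * v.2 0 j0))).
  by ring.
rewrite (_ : (fun z : E => 1 - expR 1 * flat 0 (2 - c * z.2 0 j0)) = fun z => 1 + - expR 1 * flat 0 (2 - c * z.2 0 j0)); last first.
  by apply/funext => y; rewrite mulNr.
rewrite derive_addE//; last exact: elem_cst.
rewrite derive_cst add0r derive_scaleE; last exact: elem_flat.
rewrite derive_flatE// mul0r subr0.
rewrite (_ : 'D_v (fun z : E => 2 - c * z.2 0 j0) z = - c * v.2 0 j0); first by ring.
rewrite (_ : (fun z : E => 2 - c * z.2 0 j0) = fun z => 2 + - c * z.2 0 j0); last first.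
  by apply/funext => y; rewrite mulNr.
rewrite derive_addE//; last exact: elem_cst.
by rewrite derive_cst add0r derive_scaleE ?derive_yE//; exact: elem_y.
Qed.

Definition ycut_slope : R := expR 1 ^+ 2 * (4 ^+ 4 * (4 ^+ 4 * 2 ^+ 2)).

Lemma ycut_slope_ge0 : 0 <= ycut_slope.
Proof. by rewrite /ycut_slope !mulr_ge0 ?exprn_ge0 ?expR_ge0. Qed.

Lemma derive_ycut_eq0 c v z : 0 < c -> ~ (0 <= z.2 0 j0 <= 2 / c) -> 'D_v (ycut c) z = 0.
Proof.
move=> c0 h; rewrite derive_ycut; have [z0|z0] := leP (z.2 0 j0) 0.
  by rewrite flat_le0 ?mul0r ?mulr0 ?mul0r// ycut_arg_le0// (le_trans _ ler01)// mulr_ge0_le0// ltW.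
rewrite [flat 2 (2 - _)]flat_le0 ?mulr0 ?mul0r// subr_le0 leNgt; apply/negP => h'.
by apply: h; rewrite (ltW z0)/= ler_pdivlMr// mulrC ltW.
Qed.

Lemma derive_ycut_bound c v z : 0 < c -> `|v.2 0 j0| <= 1 ->
  `|'D_v (ycut c) z| <= ycut_slope * c.
Proof.
move=> c0 v1; have [h|/derive_ycut_eq0 ->//] := pselect (0 <= z.2 0 j0 <= 2 / c); last first.
  by rewrite normr0 mulr_ge0 ?ycut_slope_ge0// ltW.
rewrite derive_ycut normrM [`|c * _|]normrM (gtr0_norm c0) ger0_norm; last first.
  by rewrite !mulr_ge0 ?exprn_ge0 ?expR_ge0 ?flat_ge0.
apply: ler_pM => //.
- by rewrite !mulr_ge0 ?exprn_ge0 ?expR_ge0 ?flat_ge0.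
- by rewrite mulr_ge0// ltW.
- rewrite /ycut_slope ler_wpM2l ?exprn_ge0 ?expR_ge0// ler_pM ?flat_ge0//.
    have : 1 - expR 1 * flat 0 (2 - c * z.2 0 j0) <= 1.
      by rewrite lerBlDr lerDl mulr_ge0 ?expR_ge0 ?flat_ge0.
    by move=> /(flat2_le ler01); rewrite expr1n mulr1.
  apply: flat2_le => //; rewrite lerBlDr lerDl mulr_ge0//; first exact: ltW.
  by case/andP: h.
- by rewrite ler_piMr// ltW.
Qed.

(** The term produced by differentiating the cutoff lives in a slab of width
    [2 / c] and has size [c]. *)
Lemma ycut_remainder a phi v : locally_bounded a -> tfun phi -> `|v.2 0 j0| <= 1 ->
  exists r, exists2 B, 0 <= B & vanishes_off r phi /\ forall c z, 0 < c ->
    `|a z * (phi z * 'D_v (ycut c) z)| <= B * c * \1_(strip r j0 (2 / c)) z.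
Proof.
move=> la tphi v1; have [C C0 hC] := tfun_bounded tphi; have [ephi [r hr]] := tphi.
have [A A0 hA] := la r.
exists r; exists (A * C * ycut_slope); first by rewrite !mulr_ge0// ycut_slope_ge0.
split => // c z c0; rewrite indicE; case: (boolP (z \in _)); rewrite ?notin_setE ?inE/=.
  move=> [bz _]; rewrite mulr1 !normrM.
  rewrite (_ : _ * _ * _ * c = A * (C * (ycut_slope * c))); last by rewrite !mulrA.
  by apply: ler_pM; rewrite ?mulr_ge0 ?hA//; apply: ler_pM => //; exact: derive_ycut_bound.
move=> hz; rewrite mulr0; have [bz|/hr ->] := pselect (box r z); last first.
  by rewrite mul0r mulr0 normr0.
by rewrite derive_ycut_eq0// ?mulr0 ?normr0// => h; apply: hz.
Qed.

Let half := [set z : E | 0 < z.2 0 j0].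

Let one_half (F : E -> R) : (forall z, z.2 0 j0 <= 0 -> F z = 0) ->
  forall z, \1_half z * F z = F z.
Proof.
move=> F0 z; rewrite indicE; case: (boolP (z \in _)); rewrite ?notin_setE ?inE/= => hz.
  by rewrite mul1r.
by rewrite F0 ?mul0r// leNgt; apply/negP.
Qed.

Lemma ycut_ip_cvg (c_ : nat -> R) (F G : E -> R) : (forall n, n.+1%:R <= c_ n) ->
  l2 mu F -> l2 mu G -> (forall z, z.2 0 j0 <= 0 -> G z = 0) ->
  (fun n => ip mu G (fun z => ycut (c_ n) z * F z)) @ \oo --> ip mu G F.
Proof.
move=> hc lF lG G0.
have -> : ip mu G F = ip mu G (fun z => \1_half z * F z).
  by apply: eq_Rintegral => z _; rewrite [RHS]mulrA [G z * \1_half z]mulrC one_half.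
apply: (@l2_mul_cvg _ _ _ (expR 1)) => // [n|n z|z].
- exact: (elem_measurable (elem_ycut _)).
- exact: ycut_bound.
- exact: ycut_cvg.
Qed.

Lemma tfun_ycut c phi : 0 < c -> tfun phi -> tfun (fun z => ycut c z * phi z) /\
  exists2 t, 0 < t & forall z, z.2 0 j0 <= t -> ycut c z * phi z = 0.
Proof.
move=> c0 tphi; split; first by apply: tfun_mull => //; exact: elem_ycut.
exists c^-1; first by rewrite invr_gt0.
by move=> z hz; rewrite ycut_eq0 ?mul0r// mulrC -ler_pdivlMr// div1r.
Qed.

Lemma Rint_indic (A : set E) (C : R) : measurable A -> (mu A <= C%:E)%E ->
  \int[mu]_z (\1_A z : R) <= C.
Proof.
move=> mA hA; rewrite /Rintegral integral_indic// setIT -lee_fin fineK//.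
by rewrite ge0_fin_numE// (le_lt_trans hA)// ltry.
Qed.

(** Test with [ycut c * phi]. The extra term is an integral over a slab of
    width [2 / c] of a function of size [c] times [W], and [W] is uniformly
    small there. *)
Lemma wder_zero_extension a v W K : measurable_fun setT a -> locally_bounded a ->
  `|v.2 0 j0| <= 1 -> l2 mu W -> l2 mu K ->
  (forall z, z.2 0 j0 <= 0 -> W z = 0) -> (forall z, z.2 0 j0 <= 0 -> K z = 0) ->
  (forall r e : R, 0 < e -> exists2 d, 0 < d & forall z, box r z -> z.2 0 j0 <= d -> `|W z| <= e) ->
  (forall phi, tfun phi -> (exists2 t, 0 < t & forall z, z.2 0 j0 <= t -> phi z = 0) ->
    ip mu W (fun z => a z * 'D_v phi z) = - ip mu K phi) ->
  wder a v W K.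
Proof.
move=> ma la v1 lW lK W0 K0 Wt eqn phi tphi.
have [r [B B0 [hr hB]]] := ycut_remainder la tphi v1.
have [Cs Cs0 hCs] := @measure_strip R N l r j0.
pose c_ (n : nat) : R := n.+1%:R.
have c0 n : 0 < c_ n by [].
have cn n : n.+1%:R <= c_ n by [].
have laD : l2 mu (fun z => a z * 'D_v phi z) := l2_weight ma la (tfun_derive v tphi).
pose rem n z := a z * (phi z * 'D_v (ycut (c_ n)) z).
have lrem n : l2 mu (rem n).
  apply: (l2_weight ma la (phi := fun z => phi z * 'D_v (ycut (c_ n)) z)).
  by apply: tfun_mulr => //; apply: elem_derive; exact: elem_ycut.
have lyc n (F : E -> R) : l2 mu F -> l2 mu (fun z => ycut (c_ n) z * F z).
  exact: (l2_bM (elem_measurable (elem_ycut _)) (ycut_bound _)).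
have main n : ip mu W (fun z => ycut (c_ n) z * (a z * 'D_v phi z)) + ip mu W (rem n) =
    - ip mu K (fun z => ycut (c_ n) z * phi z).
  have [t1 t2] := tfun_ycut (c0 n) tphi; rewrite -(eqn _ t1 t2).
  rewrite !(ipC _ W) -ipDl//; last exact: lyc.
  apply: eq_Rintegral => z _; congr (_ * _).
  by rewrite derive_mulE; [rewrite /rem; ring|exact: elem_ycut|by case: tphi].
have c1 : (fun n => ip mu W (fun z => ycut (c_ n) z * (a z * 'D_v phi z)) + ip mu W (rem n)) @ \oo -->
    ip mu W (fun z => a z * 'D_v phi z) + 0.
  apply: cvgD; first exact: ycut_ip_cvg.
  apply/cvgrPdist_le => e e0.
  have b0 : 0 < 2 * B * Cs + 1 by rewrite ltr_wpDl// !mulr_ge0.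
  have [d d0 hd] := Wt r _ (divr_gt0 e0 b0).
  near=> n; rewrite sub0r normrN.
  have n2 : 0 <= 2 / c_ n by rewrite divr_ge0.
  have [mS mS'] := hCs _ n2.
  have iS : integ mu (\1_(strip r j0 (2 / c_ n))).
    by apply: integ_indic => //; rewrite (le_lt_trans mS')// ltry.
  have nd : 2 / c_ n <= d.
    rewrite ler_pdivrMr// mulrC -ler_pdivrMr// (@le_trans _ _ n%:R) ?ler_nat//.
    by near: n; exact: nbhs_infty_ger.
  apply: (@le_trans _ _ (\int[mu]_z (e / (2 * B * Cs + 1) * B * c_ n * \1_(strip r j0 (2 / c_ n)) z))).
    apply: Rint_abs_le; [exact: l2M|exact: integZ|].
    move=> z; rewrite normrM; have := hB (c_ n) z (c0 n).
    rewrite indicE; case: (boolP (z \in _)); rewrite ?notin_setE ?inE/= => hz; rewrite ?mulr1 ?mulr0 => h.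
      rewrite -[leRHS]mulrA; apply: ler_pM => //; case: hz => bz /andP[_ h2].
      by apply: hd => //; exact: le_trans nd.
    by rewrite (_ : `|rem n z| = 0) ?mulr0//; apply/eqP; rewrite eq_le normr_ge0 h.
  rewrite RintZ//; apply: (@le_trans _ _ (e / (2 * B * Cs + 1) * B * c_ n * (Cs * (2 / c_ n)))).
    rewrite ler_wpM2l ?Rint_indic//.
    by rewrite !mulr_ge0 ?invr_ge0 ?(ltW b0)// ltW.
  rewrite (_ : _ * _ = e / (2 * B * Cs + 1) * (2 * B * Cs)); last first.
    by field; rewrite !gt_eqF.
  by rewrite mulrAC ler_pdivrMr// ler_wpM2l ?ltW// ltrDl.
have c2 : (fun n => - ip mu K (fun z => ycut (c_ n) z * phi z)) @ \oo --> - ip mu K phi.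
  by apply: cvgN; apply: ycut_ip_cvg => //; exact: tfun_l2.
by rewrite -(cvgn_eq main c1 c2) addr0.
Unshelve. all: by end_near.
Qed.

(** The extra term pairs the flux in a strip of width [h = 2 / c], of L2 norm
    [h], with a function of size [1 / h] in a set of measure [h], of L2 norm
    [h ^ (- 1 / 2)]: the product tends to [0]. *)
Lemma extended_equation a (g : 'I_N -> E -> R) (k : 'I_l -> E -> R) f (C : R) :
  measurable_fun setT a -> locally_bounded a ->
  (forall i, l2 mu (g i)) -> (forall j, l2 mu (k j)) -> l2 mu f ->
  (forall i z, z.2 0 j0 <= 0 -> g i z = 0) -> (forall j z, z.2 0 j0 <= 0 -> k j z = 0) ->
  (forall z, z.2 0 j0 <= 0 -> f z = 0) ->
  (forall h, 0 < h -> nsq mu (fun z => \1_[set z : E | z.2 0 j0 <= h] z * k j0 z) <= C * h ^+ 2) ->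
  (forall phi, tfun phi ->
    (exists2 t, 0 < t & forall z, z.2 0 j0 <= t -> phi z = 0) ->
    \sum_i ip mu (g i) ('D_(ex R l i) phi) +
    \sum_j ip mu (k j) (fun z => a z * 'D_(ey R N j) phi z) = ip mu f phi) ->
  forall phi, tfun phi ->
    \sum_i ip mu (g i) ('D_(ex R l i) phi) +
    \sum_j ip mu (k j) (fun z => a z * 'D_(ey R N j) phi z) = ip mu f phi.
Proof.
move=> ma la lg lk lf g0 k0 f0 hk eqn phi tphi.
have v1 : `|(ey R N j0).2 0 j0| <= 1 by rewrite !mxE !eqxx normr1.
have [r [B B0 [hr hB]]] := ycut_remainder la tphi v1.
have [Cs Cs0 hCs] := @measure_strip R N l r j0.
(* With [c = q ^ 2] and the weight [t = q ^ 3] in Young's inequality, both terms are of order [1 / q]. *)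
pose c_ (n : nat) : R := n.+1%:R ^+ 2.
have n0 n : 0 < n.+1%:R :> R by [].
have c0 n : 0 < c_ n by rewrite exprn_gt0.
have cn n : n.+1%:R <= c_ n by rewrite /c_ expr2 ler_peMr// ler1n.
have lphi := tfun_l2 tphi.
have lDx i : l2 mu ('D_(ex R l i) phi) := tfun_l2 (tfun_derive _ tphi).
have laD j : l2 mu (fun z => a z * 'D_(ey R N j) phi z) := l2_weight ma la (tfun_derive _ tphi).
pose rem n z := a z * (phi z * 'D_(ey R N j0) (ycut (c_ n)) z).
have lrem n : l2 mu (rem n).
  apply: (l2_weight ma la (phi := fun z => phi z * 'D_(ey R N j0) (ycut (c_ n)) z)).
  by apply: tfun_mulr => //; apply: elem_derive; exact: elem_ycut.
have lyc n (F : E -> R) : l2 mu F -> l2 mu (fun z => ycut (c_ n) z * F z).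
  exact: (l2_bM (elem_measurable (elem_ycut _)) (ycut_bound _)).
have main n : \sum_i ip mu (g i) (fun z => ycut (c_ n) z * 'D_(ex R l i) phi z) +
    \sum_j ip mu (k j) (fun z => ycut (c_ n) z * (a z * 'D_(ey R N j) phi z)) +
    ip mu (k j0) (rem n) = ip mu f (fun z => ycut (c_ n) z * phi z).
  have [t1 t2] := tfun_ycut (c0 n) tphi; rewrite -(eqn _ t1 t2) -addrA.
  have De v z : 'D_v (fun z => ycut (c_ n) z * phi z) z =
      ycut (c_ n) z * 'D_v phi z + phi z * 'D_v (ycut (c_ n)) z.
    by rewrite derive_mulE//; [exact: elem_ycut|case: tphi].
  apply: f_equal2.
    apply: eq_bigr => i _; apply: eq_Rintegral => z _; rewrite De derive_ycut.
    by rewrite mxE !mulr0 addr0.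
  rewrite (bigD1 j0)//= [RHS](bigD1 j0)//= addrAC; apply: f_equal2.
    rewrite !(ipC _ (k j0)) -ipDl//; last exact: lyc.
    by apply: eq_Rintegral => z _; rewrite De /rem; ring.
  apply: eq_bigr => j jj; apply: eq_Rintegral => z _; rewrite De derive_ycut.
  have -> : (ey R N j).2 0 j0 = 0 by rewrite mxE eq_sym (negPf jj) andbF.
  by ring.
have rem_le n : `|ip mu (k j0) (rem n)| <= 2^-1 * (4 * C + 2 * B ^+ 2 * Cs) * n.+1%:R^-1.
  have n2 : 0 < 2 / c_ n by rewrite divr_gt0.
  have [mS mS'] := hCs _ (ltW n2).
  have iS : integ mu (\1_(strip r j0 (2 / c_ n))).
    by apply: integ_indic => //; rewrite (le_lt_trans mS')// ltry.
  pose kn z := \1_[set z : E | z.2 0 j0 <= 2 / c_ n] z * k j0 z.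
  have lkn : l2 mu kn.
    apply: (@l2_bM _ _ _ _ 1) => //.
      apply: measurable_indic; rewrite (_ : mkset _ = coory j0 @^-1` `]-oo, 2 / c_ n]).
        by rewrite -[X in measurable X]setTI; apply: measurable_coory => //; exact: measurable_itv.
      by apply/seteqP; split => z /=; rewrite in_itv.
    by move=> z; rewrite indicE; case: (_ \in _); rewrite ?normr1 ?normr0.
  have -> : ip mu (k j0) (rem n) = ip mu kn (rem n).
    apply: eq_Rintegral => z _; rewrite /kn indicE.
    case: (boolP (z \in _)); rewrite ?notin_setE ?inE/= => hz; first by rewrite mul1r.
    by rewrite /rem derive_ycut_eq0 ?mulr0// => /andP[_ ?]; exact: hz.
  apply: (le_trans (ip_young (t := n.+1%:R ^+ 3) _ lkn (lrem n))); first exact: exprn_gt0.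
  rewrite -mulrA ler_wpM2l//.
  have q1 : nsq mu kn <= C * (2 / c_ n) ^+ 2 by exact: hk.
  have q2 : nsq mu (rem n) <= (B * c_ n) ^+ 2 * (Cs * (2 / c_ n)).
    apply: (@le_trans _ _ (\int[mu]_z ((B * c_ n) ^+ 2 * \1_(strip r j0 (2 / c_ n)) z))).
      have [_ i2] := lrem n; apply: Rint_le => //; first exact: integZ.
      move=> z; have := hB (c_ n) z (c0 n); rewrite indicE; case: (_ \in _).
        rewrite !mulr1 => h; rewrite -[leLHS]real_normK ?num_real//.
        by rewrite lerXn2r// nnegrE// (le_trans _ h).
      by rewrite !mulr0 normr_le0 => /eqP; rewrite -/(rem n z) => ->; rewrite expr0n.
    by rewrite RintZ// ler_wpM2l ?sqr_ge0// Rint_indic.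
  apply: (@le_trans _ _ (n.+1%:R ^+ 3 * (C * (2 / c_ n) ^+ 2) +
      (n.+1%:R ^+ 3)^-1 * ((B * c_ n) ^+ 2 * (Cs * (2 / c_ n))))).
    by rewrite lerD// ler_wpM2l ?invr_ge0 ?exprn_ge0.
  rewrite le_eqVlt; apply/orP; left; apply/eqP; rewrite /c_.
  by field; rewrite nat1r.
have c1 : (fun n => \sum_i ip mu (g i) (fun z => ycut (c_ n) z * 'D_(ex R l i) phi z) +
    \sum_j ip mu (k j) (fun z => ycut (c_ n) z * (a z * 'D_(ey R N j) phi z)) +
    ip mu (k j0) (rem n)) @ \oo -->
    \sum_i ip mu (g i) ('D_(ex R l i) phi) +
    \sum_j ip mu (k j) (fun z => a z * 'D_(ey R N j) phi z) + 0.
  apply: cvgD.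
    apply: cvgD; apply: cvgn_sum => i; apply: ycut_ip_cvg => //; [exact: g0|exact: k0].
  apply/cvgrPdist_le => e e0; near=> n; rewrite sub0r normrN (le_trans (rem_le n))//.
  near: n; have : (fun n => 2^-1 * (4 * C + 2 * B ^+ 2 * Cs) * n.+1%:R^-1) @ \oo --> (0 : R).
    by under eq_fun do rewrite mulrC; exact: cvg_harmonicM.
  move=> /cvgrPdist_le/(_ _ e0); apply: filterS => n; rewrite sub0r normrN => h.
  exact: le_trans (ler_norm _) h.
have c2 := ycut_ip_cvg cn lphi lf f0.
by rewrite -(cvgn_eq main c1 c2) addr0.
Unshelve. all: by end_near.
Qed.

End boundary_cutoff.

(** * The weight and the barrier *)

Section weight.
Context (R : realType) (N l : nat).
Local Notation E := ('rV[R]_N * 'rV[R]_l)%type.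
Local Notation mu := (lebesgue_space R N l).
Local Notation box := (@box R N l).
Local Notation qx := (@qx R N l).
Implicit Types (z v s : E) (a : E -> R).

Lemma qx_box (r : R) z : qx z <= r -> forall i, `|z.1 0 i| <= `|r| + 2.
Proof.
move=> h i; have := @sqr_lt_abs R (z.1 0 i) (`|r| + 1).
rewrite -addrA; apply; apply: (le_lt_trans (qx_ge z i)).
by rewrite (le_lt_trans h)// (le_lt_trans (ler_norm r))// ltrDl.
Qed.

(** Uniform continuity on a compact box; the variable [y] is set to [0]. *)
Lemma x_unif_continuous a : continuous a -> (forall z, a z = a ((z.1, 0) : E)) -> x_unif a.
Proof.
move=> ca a1 r e e0; pose r' := `|r| + 2.
have /compact_near_coveringP cov := @compact_box R N l r'.
pose P (s z : E) := `|a (z + s) - a z| <= e.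
have e2 : 0 < e / 2 by rewrite divr_gt0.
have : \forall s \near nbhs (0 : E), box r' `<=` P s.
  apply: (cov E (nbhs (0 : E)) P _).
  move=> z0 _; have /cvgrPdist_le/(_ _ e2)/nbhs_ballP[d /= d0 hd] := ca z0.
  have d2 : 0 < d / 2 by rewrite divr_gt0.
  exists (ball z0 (d / 2), ball (0 : E) (d / 2)).
    by split; exact: nbhsx_ballx.
  move=> [z s] [/= hz hs]; rewrite /P.
  have h1 : `|a z0 - a z| <= e / 2.
    by apply: hd; apply: (le_ball _ hz); rewrite ler_pdivrMr// mulr_natr mulr2n lerDl ltW.
  have h2 : `|a z0 - a (z + s)| <= e / 2.
    apply: hd; rewrite [d]splitr; apply: (ball_triangle hz).
    by move: hs; rewrite -!ball_normE /ball_/= sub0r opprD addNKr.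
  rewrite (_ : a (z + s) - a z = (a z0 - a z) - (a z0 - a (z + s))); last by ring.
  by rewrite (le_trans (ler_normB _ _))// (le_trans (lerD h1 h2))// -splitr.
move=> /nbhs_ballP[d /= d0 hd]; exists (d / 2); first by rewrite divr_gt0.
move=> z s qz hs; rewrite a1 [a z]a1.
have -> : ((z + s).1, 0) = ((z.1, 0) : E) + ((s.1, 0) : E).
  by congr pair; rewrite addr0.
have := hd ((s.1, 0) : E); rewrite -ball_normE /ball_/= /P => /(_ _ ((z.1, 0) : E)); apply.
  rewrite sub0r normrN; apply: (@le_lt_trans _ _ (d / 2)); last by rewrite ltr_pdivrMr// ltr_pMr// ltr1n.
  apply: box_norm; first by rewrite divr_ge0// ltW.
  by split => i //=; rewrite mxE normr0 divr_ge0// ltW.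
by split => i /=; [exact: qx_box|rewrite mxE normr0 addr_ge0].
Qed.

Variable gamma : R.
Hypothesis gamma0 : 0 < gamma.

Definition weight z : R := euclidean_norm z.1 `^ gamma.

Let kap := 2^-1 * gamma.

Let kap0 : 0 < kap.
Proof. by rewrite mulr_gt0. Qed.

(** A power of the polynomial [qx] instead of the square root. *)
Lemma weightE z : weight z = qx z `^ kap.
Proof. by rewrite /weight /euclidean_norm -powR12_sqrt ?qx_ge0// -powRrM. Qed.

Lemma weight_x z : weight z = weight ((z.1, 0) : E).
Proof. by []. Qed.

Lemma weight_y z j (t : R) : weight (z + t *: ey R N j) = weight z.
Proof. by rewrite /weight /ey /= scaler0 addr0. Qed.

Lemma measurable_weight : measurable_fun setT weight.
Proof.
rewrite (_ : weight = (powR (R := R))^~ kap \o qx); last first.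
  by apply/funext => z; exact: weightE.
apply: measurableT_comp; first exact: measurable_powR.
exact: (elem_measurable (elem_qx R N l)).
Qed.

Lemma weight_le r z : qx z <= r -> weight z <= r `^ kap.
Proof.
move=> h; rewrite weightE; apply: ge0_ler_powR => //; rewrite ?nnegrE ?qx_ge0//.
  exact: ltW.
by rewrite (le_trans _ h)// qx_ge0.
Qed.

Lemma weight_ge r z : 0 <= r -> r <= qx z -> r `^ kap <= weight z.
Proof.
move=> r0 h; rewrite weightE; apply: ge0_ler_powR => //; rewrite ?nnegrE ?qx_ge0//.
exact: ltW.
Qed.

Lemma weight_ge0 z : 0 <= weight z.
Proof. exact: powR_ge0. Qed.

Lemma weight_x_bounded : x_bounded weight.
Proof.
move=> r; exists (r `^ kap); first exact: powR_ge0.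
by move=> z h; rewrite ger0_norm ?weight_ge0// weight_le.
Qed.

Lemma weight_lower (i : 'I_N) (d : R) : 0 < d ->
  exists2 c, 0 < c & forall z, d <= `|z.1 0 i| -> c <= `|weight z|.
Proof.
move=> d0; exists ((d ^+ 2) `^ kap); first by rewrite powR_gt0// exprn_gt0.
move=> z h; rewrite ger0_norm ?weight_ge0// weight_ge ?sqr_ge0//.
rewrite (le_trans _ (qx_ge z i))// -[leRHS]real_normK ?num_real//.
by rewrite lerXn2r// nnegrE ltW.
Qed.

Lemma continuous_weight : continuous weight.
Proof.
move=> z; have cq := elem_continuous (elem_qx R N l) (x := z).
have [qz|qz] := ltP 0 (qx z).
  have c1 : (fun y => expR (kap * ln (qx y))) @ z --> expR (kap * ln (qx z)).
    apply: (@cvg_comp _ _ _ (fun y => kap * ln (qx y)) expR _ (nbhs (kap * ln (qx z)))).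
      apply: cvgMl_tmp; apply: (@cvg_comp _ _ _ qx (@ln R) _ (nbhs (qx z))); first exact: cq.
      exact: continuous_ln.
    exact: continuous_expR.
  have e y : 0 < qx y -> expR (kap * ln (qx y)) = weight y.
    by move=> qy; rewrite weightE /powR gt_eqF.
  rewrite /continuous_at -(e z qz); apply: cvg_trans c1; apply: near_eq_cvg.
  by near=> y; apply: e; near: y; exact: (cvgr_gt _ cq).
have z0 : qx z = 0 by apply: le_anti; rewrite qz qx_ge0.
apply/cvgrPdist_le => e e0.
have w0 : weight z = 0 by rewrite weightE z0 powR0// gt_eqF.
near=> y; rewrite w0 sub0r normrN ger0_norm ?weight_ge0//.
have -> : e = (e `^ kap^-1) `^ kap by rewrite -powRrM mulVf ?powRr1 ?gt_eqF// ltW.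
apply: weight_le; near: y.
apply: (cvgr_le _ cq); rewrite z0; exact: powR_gt0.
Unshelve. all: by end_near.
Qed.

Lemma weight_x_unif : x_unif weight.
Proof. by apply: x_unif_continuous; [exact: continuous_weight|exact: weight_x]. Qed.

(** Replaces the weight, which is not smooth at [x = 0], in test functions
    supported where [1 <= qx z]. The additional [flat] term keeps the argument
    of [ln] positive. *)
Definition smooth_weight z : R := expR (kap * ln (qx z + flat 0 (1 - qx z))).

Lemma elem_smooth_weight : elem smooth_weight.
Proof.
apply: elem_exp; apply: elem_scale; apply: elem_ln => [|z].
  apply: elem_add; first exact: elem_qx.
  by apply: elem_flat; apply: elem_sub; [exact: elem_cst|exact: elem_qx].
have [q0|q0] := ltP 0 (qx z); first by rewrite ltr_pwDl// flat_ge0.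
rewrite ltr_wpDl ?qx_ge0//; apply: flat_gt0; rewrite subr_gt0.
exact: le_lt_trans q0 _.
Qed.

Lemma smooth_weightE z : 1 <= qx z -> smooth_weight z = weight z.
Proof.
move=> h; rewrite /smooth_weight flat_le0 ?subr_le0// addr0 weightE /powR gt_eqF//.
exact: lt_le_trans h.
Qed.

Lemma derive_smooth_weight j z : 'D_(ey R N j) smooth_weight z = 0.
Proof.
have e (h : R) : smooth_weight (h *: ey R N j + z) = smooth_weight z.
  rewrite /smooth_weight; have -> : qx (h *: ey R N j + z) = qx z; last by [].
  by rewrite /ey; apply: eq_bigr => i _; rewrite /= scaler0 add0r.
rewrite /derive; apply: (@cvg_lim _ _ _) => //; apply: cvg_near_cst; near=> h.
by rewrite /= e subrr scaler0.
Unshelve. all: by end_near.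
Qed.

End weight.

Section barrier.
Context (R : realType) (N l : nat).
Local Notation E := ('rV[R]_N * 'rV[R]_l)%type.
Local Notation mu := (lebesgue_space R N l).
Local Notation box := (@box R N l).
Implicit Types (z v s w : E).

Let K : R := (16 * (N + l)%:R)^-1.

(** The factor [K] makes [hump_arg] small on the support of the hump, where
    [flat 4] then dominates [flat 3] and [flat 2]. *)
Definition hump_arg w : R := K * (4 - (qx w + qy w)).
Definition hump w : R := flat 0 (hump_arg w).

Hypothesis Nl : (0 < N + l)%N.

Let K0 : 0 < K.
Proof. by rewrite invr_gt0 mulr_gt0// ltr0n. Qed.

Let K16 : 16 * K * (N + l)%:R = 1.
Proof. by rewrite mulrAC mulfV// mulf_neq0// pnatr_eq0 -?lt0n. Qed.

Let K16' : K <= 16^-1.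
Proof.
rewrite /K invfM ler_piMr// invf_le1 ?ltr0n// ler1n//.
Qed.

Lemma elem_hump_arg : elem hump_arg.
Proof.
apply: elem_scale; apply: elem_sub; first exact: elem_cst.
by apply: elem_add; [exact: elem_qx|exact: elem_qy].
Qed.

Lemma hump_arg_gt0 w : 0 < hump_arg w -> qx w + qy w < 4.
Proof. by rewrite /hump_arg pmulr_rgt0// subr_gt0. Qed.

Lemma tfun_hump : tfun hump.
Proof.
split; first by apply: elem_flat; exact: elem_hump_arg.
exists 5 => w nw; apply: flat_le0; rewrite leNgt; apply/negP => /hump_arg_gt0 h; apply: nw.
split => i.
  have := @sqr_lt_abs R (w.1 0 i) 4; rewrite -[4 + 1]/(4 + 1%:R) -natrD; apply.
  by apply: le_lt_trans (qx_ge w i) _; rewrite (le_lt_trans _ h)// lerDl qy_ge0.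
have := @sqr_lt_abs R (w.2 0 i) 4; rewrite -[4 + 1]/(4 + 1%:R) -natrD; apply.
by apply: le_lt_trans (qy_ge w i) _; rewrite (le_lt_trans _ h)// lerDr qx_ge0.
Qed.

Lemma derive_hump_arg v w : 'D_v hump_arg w =
  - 2 * K * (\sum_i v.1 0 i * w.1 0 i + \sum_j v.2 0 j * w.2 0 j).
Proof.
have e1 : elem (fun w : E => -1 * (qx w + qy w)).
  by apply: elem_scale; apply: elem_add; [exact: elem_qx|exact: elem_qy].
have e2 : elem (fun w : E => 4 - (qx w + qy w)).
  by apply: elem_sub; [exact: elem_cst|apply: elem_add; [exact: elem_qx|exact: elem_qy]].
rewrite /hump_arg derive_scaleE//.
rewrite (_ : (fun w : E => 4 - (qx w + qy w)) = fun w => 4 + -1 * (qx w + qy w)); last first.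
  by apply/funext => z; rewrite mulN1r.
rewrite derive_addE//; last exact: elem_cst.
rewrite derive_cst add0r derive_scaleE; last by apply: elem_add; [exact: elem_qx|exact: elem_qy].
rewrite derive_addE; [|exact: elem_qx|exact: elem_qy].
by rewrite derive_qx derive_qy; ring.
Qed.

(** Both kinds of directions at once: [coo] is the coordinate along [v]. *)
Lemma derive2_hump v (coo : E -> R) w : elem coo ->
  (forall w, \sum_i v.1 0 i * w.1 0 i + \sum_j v.2 0 j * w.2 0 j = coo w) ->
  'D_v coo w = 1 ->
  'D_v ('D_v hump) w =
  (flat 4 (hump_arg w) - 2 * flat 3 (hump_arg w)) * (4 * K ^+ 2 * coo w ^+ 2)
  - 2 * K * flat 2 (hump_arg w).
Proof.
move=> ec hc dc; have ea := elem_hump_arg.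
have -> : 'D_v hump = fun w => flat 2 (hump_arg w) * (- 2 * K * coo w).
  apply/funext => z; rewrite derive_flatE// mul0r subr0 derive_hump_arg hc.
  by [].
have e1 : elem (fun w : E => - 2 * K * coo w) by exact: elem_scale.
have e2 : elem (fun w : E => flat 2 (hump_arg w)) by exact: elem_flat.
rewrite derive_mulE// derive_scaleE// dc derive_flatE// derive_hump_arg hc.
by ring.
Qed.

Lemma derive2_hump_x i w : 'D_(ex R l i) ('D_(ex R l i) hump) w =
  (flat 4 (hump_arg w) - 2 * flat 3 (hump_arg w)) * (4 * K ^+ 2 * w.1 0 i ^+ 2)
  - 2 * K * flat 2 (hump_arg w).
Proof.
apply: (@derive2_hump _ (fun w : E => w.1 0 i)); first exact: elem_x.
  move=> z; rewrite sum_ex big1 ?addr0// => j _; by rewrite mxE mul0r.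
by rewrite derive_xE mxE !eqxx.
Qed.

Lemma derive2_hump_y j w : 'D_(ey R N j) ('D_(ey R N j) hump) w =
  (flat 4 (hump_arg w) - 2 * flat 3 (hump_arg w)) * (4 * K ^+ 2 * w.2 0 j ^+ 2)
  - 2 * K * flat 2 (hump_arg w).
Proof.
apply: (@derive2_hump _ (fun w : E => w.2 0 j)); first exact: elem_y.
  move=> z; rewrite sum_ey big1 ?add0r// => i _; by rewrite mxE mul0r.
by rewrite derive_yE mxE !eqxx.
Qed.

(** The second derivative of [exp (-1/t)] dominates the first for small [t].
    The distance to the centre in the [y] directions, at least [1], keeps the
    gradient of the hump from vanishing. *)
Lemma hump_subharmonic (A : R) w : 1 <= A -> 1 <= qy w ->
  0 <= \sum_i 'D_(ex R l i) ('D_(ex R l i) hump) w +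
       \sum_j A * 'D_(ey R N j) ('D_(ey R N j) hump) w.
Proof.
move=> A1 q1; set T := hump_arg w.
under eq_bigr do rewrite derive2_hump_x.
under [X in _ + X]eq_bigr do rewrite derive2_hump_y mulrBr mulrCA.
rewrite !sumrB -!mulr_sumr -/T.
rewrite -/(qx w) -/(qy w) !sumr_const !card_ord.
have [T0|T0] := leP T 0; first by rewrite !flat_le0// !(mulr0,mul0rn,mul0r,subr0,addr0,oppr0).
have K0' : 0 <= K by exact: ltW.
have T4 : T <= 4 * K.
  rewrite /T /hump_arg mulrC ler_wpM2r ?(ltW K0)//.
  by rewrite lerBlDr lerDl addr_ge0// ?qx_ge0// qy_ge0.
have Tn : T != 0 by rewrite gt_eqF.
have f3 : flat 3 T = T * flat 4 T by rewrite !flat_gt0E//; field.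
have f2 : flat 2 T = T ^+ 2 * flat 4 T by rewrite !flat_gt0E//; field.
rewrite f3 f2; have := flat_ge0 4 T; move: (flat 4 T) => F F0.
rewrite -[_ *+ N]mulr_natr -[_ *+ l]mulr_natr.
have qx0 := qx_ge0 w.
have K2 : 0 <= K ^+ 2 by rewrite sqr_ge0.
have TT : T ^+ 2 <= 16 * K ^+ 2.
  rewrite (_ : 16 * K ^+ 2 = (4 * K) ^+ 2); last by ring.
  apply: lerXn2r => //; rewrite nnegrE; [exact: ltW|exact: mulr_ge0].
have KN : 16 * K * (N%:R + l%:R) = 1 by rewrite -natrD.
rewrite (_ : _ + _ = F * ((1 - 2 * T) * (4 * K ^+ 2) * (qx w + A * qy w) -
   2 * K * T ^+ 2 * (N%:R + A * l%:R))); last by ring.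
rewrite mulr_ge0// subr_ge0.
have h1 : 2^-1 <= 1 - 2 * T.
  have : T <= 4 * 16^-1 by rewrite (le_trans T4)// ler_wpM2l.
  by move: (T) => t; lra.
have h2 : A <= qx w + A * qy w.
  by rewrite -[leLHS]add0r lerD// ler_peMr// (le_trans ler01).
have h3 : N%:R + A * l%:R <= A * (N%:R + l%:R) :> R.
  by rewrite mulrDr lerD2r ler_peMl.
have A0 : 0 <= A by rewrite (le_trans ler01).
apply: (@le_trans _ _ (2 * K * (16 * K ^+ 2) * (A * (N%:R + l%:R)))).
  apply: ler_pM => //.
  - by apply: mulr_ge0; [exact: mulr_ge0|exact: sqr_ge0].
  - by apply: addr_ge0 => //; exact: mulr_ge0.
  - by apply: ler_wpM2l => //; exact: mulr_ge0.
rewrite (_ : _ * (A * _) = 2 * K ^+ 2 * A * (16 * K * (N%:R + l%:R))); last by ring.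
rewrite KN mulr1 (_ : 2 * K ^+ 2 * A = 2^-1 * (4 * K ^+ 2) * A); last by field.
apply: ler_pM => //; first by apply: mulr_ge0 => //; exact: mulr_ge0.
by apply: ler_wpM2r => //; exact: mulr_ge0.
Qed.

End barrier.

(** * Nonexistence *)

Section no_solution.
Context (R : realType) (N l : nat) (gamma : R) (i0 : 'I_N) (j0 : 'I_l).
Local Notation E := ('rV[R]_N * 'rV[R]_l)%type.
Local Notation mu := (lebesgue_space R N l).
Local Notation box := (@box R N l).
Local Notation a := (@weight R N l gamma).
Local Notation at_ := (@smooth_weight R N l gamma).
Local Notation hump := (@hump R N l).
Local Notation hump_arg := (@hump_arg R N l).
Implicit Types (z v w : E).
Hypothesis gamma0 : 0 < gamma.

Let Nl : (0 < N + l)%N.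
Proof. by rewrite addn_gt0 (leq_ltn_trans _ (ltn_ord i0)). Qed.

Let s : E := ((-3) *: delta_mx 0 i0, delta_mx 0 j0).

Let phi z := hump (z + s).

Let tphi : tfun phi.
Proof. exact: (tfun_translate s (tfun_hump R Nl)). Qed.

Let sx z i : (z + s).1 0 i = z.1 0 i - (i == i0)%:R * 3.
Proof. by rewrite /s/= !mxE eqxx/= mulrC mulrN. Qed.

Let sy z j : (z + s).2 0 j = z.2 0 j + (j == j0)%:R.
Proof. by rewrite /s/= !mxE eqxx/=. Qed.

Let Dphi v z : 'D_v phi z = 'D_v hump (z + s).
Proof. exact: derive_translate. Qed.

Let DDphi v z : 'D_v ('D_v phi) z = 'D_v ('D_v hump) (z + s).
Proof.
rewrite (_ : 'D_v phi = fun z => 'D_v hump (z + s)); last by apply/funext => w; exact: Dphi.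
exact: derive_translate.
Qed.

Let Dphi0 v z : hump_arg (z + s) <= 0 -> 'D_v phi z = 0.
Proof.
move=> h; rewrite Dphi derive_flatE; last exact: elem_hump_arg.
by rewrite !flat_le0// mulr0 subr0 mul0r.
Qed.

Let supp z : 0 < hump_arg (z + s) -> 1 <= qx z.
Proof.
move=> /(hump_arg_gt0 Nl) h.
have h2 : `|(z + s).1 0 i0| <= 2.
  apply: sqr_lt_sqr => //; apply: (le_lt_trans (qx_ge (z + s) i0)).
  apply: (@le_lt_trans _ _ (qx (z + s) + qy (z + s))); first by rewrite lerDl qy_ge0.
  by rewrite (lt_le_trans h)// expr2 -natrM.
move: h2; rewrite sx eqxx mul1r ler_norml => /andP[h2 _].
apply: le_trans (qx_ge z i0).
have h3 : 1 <= z.1 0 i0 by lra.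
by rewrite -[leLHS](expr1n _ 2); apply: lerXn2r; rewrite // nnegrE// (le_trans ler01).
Qed.

Let at_a z j : at_ z * 'D_(ey R N j) phi z = a z * 'D_(ey R N j) phi z.
Proof.
have [h|h] := leP (hump_arg (z + s)) 0; first by rewrite Dphi0// !mulr0.
by rewrite smooth_weightE// supp.
Qed.

(** Insert a hump centred at distance [1] below the boundary and at distance
    [3] from [x = 0]: on its support the weight is at least [1], and in the
    half space the hump is subharmonic. Integrating by parts twice, the
    reaction term would be nonpositive. *)
Lemma barrier_contradiction (g : 'I_N -> E -> R) (k : 'I_l -> E -> R) (f U : E -> R) :
  (forall i, l2 mu (g i)) -> (forall j, l2 mu (k j)) -> l2 mu f -> l2 mu U ->
  (forall z, 0 <= U z) -> (forall z, z.2 0 j0 <= 0 -> U z = 0) ->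
  (forall z, 0 <= f z) -> (forall z, 0 < z.2 0 j0 -> 0 < f z) ->
  (forall i, wder (fun=> 1) (ex R l i) U (g i)) ->
  (forall j, wder a (ey R N j) U (k j)) ->
  (forall phi, tfun phi ->
    \sum_i ip mu (g i) ('D_(ex R l i) phi) +
    \sum_j ip mu (k j) (fun z => a z * 'D_(ey R N j) phi z) = ip mu f phi) ->
  False.
Proof.
move=> lg lk lf lU U0 Uz f0 fpos dUx dUy eqn.
have lphi := tfun_l2 tphi.
have ma : measurable_fun setT a := @measurable_weight R N l gamma.
have la : locally_bounded a by apply: x_bounded_local; exact: weight_x_bounded.
have tx i : tfun ('D_(ex R l i) phi) := tfun_derive _ tphi.
have txx i : tfun ('D_(ex R l i) ('D_(ex R l i) phi)) := tfun_derive _ (tx i).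
have ty j : tfun ('D_(ey R N j) phi) := tfun_derive _ tphi.
have tyy j : tfun ('D_(ey R N j) ('D_(ey R N j) phi)) := tfun_derive _ (ty j).
have tat (psi : E -> R) : tfun psi -> tfun (fun z => at_ z * psi z).
  by move=> tpsi; apply: tfun_mull => //; exact: elem_smooth_weight.
pose Lap z := \sum_i 'D_(ex R l i) ('D_(ex R l i) phi) z +
  \sum_j (a z * at_ z) * 'D_(ey R N j) ('D_(ey R N j) phi) z.
have laa j : l2 mu (fun z => (a z * at_ z) * 'D_(ey R N j) ('D_(ey R N j) phi) z).
  have := l2_weight ma la (tat _ (tyy j)).
  by rewrite (_ : (fun z => _) = (fun z => a z * at_ z * 'D_(ey R N j) ('D_(ey R N j) phi) z))//;
     apply/funext => z; rewrite mulrA.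
have green : ip mu U Lap = - ip mu f phi.
  have -> : ip mu U Lap = \sum_i ip mu U ('D_(ex R l i) ('D_(ex R l i) phi)) +
      \sum_j ip mu U (fun z => (a z * at_ z) * 'D_(ey R N j) ('D_(ey R N j) phi) z).
    rewrite /ip -!Rint_sum.
    - rewrite -RintD; last 2 first.
      + by apply: integ_sum => i; apply: l2M => //; exact: tfun_l2.
      + by apply: integ_sum => j; exact: l2M.
      by apply: eq_Rintegral => z _; rewrite /Lap mulrDr !mulr_sumr.
    - by move=> j; exact: l2M.
    - by move=> i; apply: l2M => //; exact: tfun_l2.
  rewrite -(eqn _ tphi) opprD -!sumrN; apply: f_equal2; apply: eq_bigr => i _.
    by rewrite -(dUx i _ (tx i)); apply: eq_Rintegral => z _; rewrite mul1r.
  transitivity (- ip mu (k i) (fun z => at_ z * 'D_(ey R N i) phi z)).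
    rewrite -(dUy i _ (tat _ (ty i))); apply: eq_Rintegral => z _.
    rewrite derive_mulE; [|exact: elem_smooth_weight|by case: (ty i)].
    by rewrite derive_smooth_weight mulr0 addr0 [a z * (_ * _)]mulrA.
  by congr (- _); apply: eq_Rintegral => z _; rewrite at_a.
have Lap0 z : 0 <= U z * Lap z.
  have [zl|zl] := leP (z.2 0 j0) 0; first by rewrite Uz// mul0r.
  apply: mulr_ge0 => //; rewrite /Lap.
  under eq_bigr do rewrite DDphi.
  under [X in _ + X]eq_bigr do rewrite DDphi.
  have [h|h] := leP (hump_arg (z + s)) 0.
    rewrite !big1 ?addr0// => i _.
      by rewrite derive2_hump_y !flat_le0// !(mulr0, subr0, mul0r).
    by rewrite derive2_hump_x !flat_le0// !(mulr0, subr0, mul0r).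
  have qz := supp h.
  have a1 : 1 <= a z by have := weight_ge gamma0 ler01 qz; rewrite powR1.
  apply: (hump_subharmonic Nl).
    by rewrite smooth_weightE// -[leLHS]mulr1 ler_pM.
  apply: le_trans (qy_ge (z + s) j0).
  rewrite sy eqxx -[leLHS](expr1n _ 2); apply: lerXn2r; rewrite ?nnegrE ?lerDr ?(ltW zl)//.
  by rewrite addr_ge0// ltW.
have fphi : 0 < ip mu f phi.
  (* a box of half-width [e] around the point of the boundary above the centre *)
  pose e : R := (N + l).+1%:R^-1.
  have e0 : 0 < e by rewrite invr_gt0.
  have eN : (N + l).+1%:R * e = 1 by rewrite mulfV.
  have e2 : e <= 2^-1 by rewrite lef_pV2 ?posrE// ler_nat ltnS.
  have hab (i : 'I_N) : (i == i0)%:R * 3 - e < (i == i0)%:R * 3 + e by rewrite ltrD2l gtrN.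
  have hcd (j : 'I_l) : (if j == j0 then 0 else - e) < e by case: ifP => // _; rewrite gtrN.
  have [mB B0] := lebesgue_space_box_gt0 hab hcd.
  apply: (Rint_gt0 (l2M lf lphi) _ mB B0) => [z|z [hx hy]].
    by rewrite mulr_ge0// flat_ge0.
  have zl : 0 < z.2 0 j0 by have := hy j0; rewrite eqxx => /andP[].
  apply: mulr_gt0; first exact: fpos.
  apply: flat_gt0; rewrite /hump_arg mulr_gt0 ?invr_gt0 ?mulr_gt0 ?ltr0n// subr_gt0.
  have sq (x : R) : - e < x < e -> x ^+ 2 <= e ^+ 2.
    move=> h; rewrite -[leLHS]real_normK ?num_real//.
    by apply: lerXn2r; rewrite ?nnegrE ?(ltW e0)//; rewrite ler_norml !ltW//; case/andP: h.
  have bx : qx (z + s) <= N%:R * e ^+ 2.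
    rewrite -[N in N%:R]card_ord mulr_natl -sumr_const; apply: ler_sum => i _.
    by apply: sq; rewrite sx; have := hx i; rewrite ltrBlDr ltrBrDl => /andP[h1 h2]; lra.
  have by_ : qy (z + s) <= (1 + e) ^+ 2 + l%:R * e ^+ 2.
    rewrite /qy (bigD1 j0)//=; apply: lerD.
      have := hy j0; rewrite sy !eqxx mulr1n => /andP[h1 h2].
      by apply: lerXn2r; rewrite ?nnegrE; lra.
    apply: (@le_trans _ _ (\sum_(j | j != j0) e ^+ 2)).
      apply: ler_sum => j jj; apply: sq; rewrite sy; have := hy j.
      by rewrite (negPf jj) addr0.
    rewrite -[l in l%:R]card_ord mulr_natl -sumr_const [leRHS](bigID (fun j => j != j0))/=.
    by rewrite lerDl sumr_ge0// => j _; exact: sqr_ge0.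
  have eN' : (N%:R + l%:R) * e <= 1.
    rewrite -natrD -[leRHS]eN; apply: ler_wpM2r; first exact: ltW.
    by rewrite ler_nat.
  have : (N%:R + l%:R) * e * e <= 1 * 2^-1.
    by apply: ler_pM => //; [apply: mulr_ge0; [exact: addr_ge0|exact: ltW]|exact: ltW].
  have : e * e <= 2^-1 * 2^-1.
    by apply: ler_pM => //; exact: ltW.
  have := lerD bx by_; rewrite !expr2.
  set q := qx _ + qy _ => hq h1 h2; nra.
have : 0 <= ip mu U Lap by exact: Rint_ge0.
by rewrite green oppr_ge0 leNgt fphi.
Qed.

End no_solution.

Section half_space_facts.
Context (R : realType) (N l : nat) (hl : (1 <= l)%N).
Local Notation E := ('rV[R]_N * 'rV[R]_l)%type.
Local Notation mu := (lebesgue_space R N l).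
Local Notation box := (@box R N l).
Local Notation O := (half_space hl : set E).
Local Notation j0 := (last_index hl).
Implicit Types (z : E) (u : E -> R).

Definition zero_ext u z : R := if 0 < z.2 0 j0 then u z else 0.

Lemma patch_zero_ext u : u \_ O = zero_ext u.
Proof.
apply/funext => z; rewrite patchE /zero_ext.
by rewrite (_ : (z \in O) = (0 < z.2 0 j0))//; apply/idP/idP; rewrite inE.
Qed.

Lemma zero_ext_out u z : z.2 0 j0 <= 0 -> zero_ext u z = 0.
Proof. by rewrite /zero_ext ltNge => ->. Qed.

Lemma l2_zero_ext u : L2 O u -> l2 mu (zero_ext u).
Proof.
rewrite /L2 patch_zero_ext => h; split; last exact: Lfun2_integrable_sqr.
by move: h; rewrite inE => /andP[]; rewrite inE.
Qed.

Lemma Rint_half_space u : \int[mu]_(z in O) u z = \int[mu]_z zero_ext u z.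
Proof. by rewrite Rintegral_mkcond patch_zero_ext. Qed.

Lemma closure_half_space z : z.2 0 j0 = 0 -> closure O z.
Proof.
move=> z0 B /nbhs_ballP[d /= d0 hB].
have d2 : 0 < d / 2 by rewrite divr_gt0.
exists (z + (d / 2) *: ey R N j0); split.
  by rewrite /half_space /ey/= !mxE !eqxx/= z0 add0r mulr1.
apply: hB; rewrite -ball_normE /ball_/= opprD addNKr normrN.
apply: (@le_lt_trans _ _ (d / 2)); last by rewrite ltr_pdivrMr// ltr_pMr// ltr1n.
apply: box_norm; first exact: ltW.
by have := @box_ey R N l j0 (d / 2); rewrite gtr0_norm.
Qed.

Lemma boundary_half_space z : z.2 0 j0 = 0 -> boundary O z.
Proof.
move=> z0; split; first exact: closure_half_space.
by move=> /interior_subset; rewrite /half_space/= z0 ltxx.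
Qed.

(** Compactness of the box and continuity up to the boundary. *)
Lemma zero_ext_small u : {within closure O, continuous u} ->
  (forall z, boundary O z -> u z = 0) ->
  forall r e : R, 0 < e ->
    exists2 d, 0 < d & forall z, box r z -> z.2 0 j0 <= d -> `|zero_ext u z| <= e.
Proof.
move=> cu ub r e e0.
have /compact_near_coveringP cov := @compact_box R N l r.
pose P (d : R) (z : E) := z.2 0 j0 <= d -> `|zero_ext u z| <= e.
have cc : continuous (fun z : E => z.2 0 j0) := elem_continuous (elem_y R N j0).
have : \forall d \near nbhs (0 : R), box r `<=` P d.
  apply: (cov R (nbhs (0 : R)) P _) => z0 _.
  have [z00|z00] := ltP 0 (z0.2 0 j0).
    have z2 : 0 < z0.2 0 j0 / 2 by rewrite divr_gt0.
    exists ([set z : E | z0.2 0 j0 / 2 < z.2 0 j0], [set d : R | d < z0.2 0 j0 / 2]).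
      split; last exact: (lt_nbhsl z2).
      have h : z0.2 0 j0 / 2 < z0.2 0 j0 by rewrite ltr_pdivrMr// ltr_pMr// ltr1n.
      by rewrite /=; apply: (cvgr_gt (z0.2 0 j0) (cc z0)).
    by move=> [z d] [/= h1 h2] h3; have := lt_le_trans h1 (le_trans h3 (ltW h2)); rewrite ltxx.
  have [z01|z01] := ltP (z0.2 0 j0) 0.
    exists ([set z : E | z.2 0 j0 < 0], setT).
      by split; [rewrite /=; exact: (cvgr_lt (z0.2 0 j0) (cc z0))|exact: filterT].
    by move=> [z d] [/= h1 _] _; rewrite zero_ext_out ?normr0 ltW.
  have z0b : z0.2 0 j0 = 0 by apply: le_anti; rewrite z00 z01.
  have := (subspace_continuousP _ _).1 cu z0 (closure_half_space z0b).
  move=> /cvgrPdist_le/(_ _ e0) hn.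
  exists ([set z : E | closure O z -> `|u z0 - u z| <= e], setT).
    by split; [exact: hn|exact: filterT].
  move=> [z d] [/= h1 _] _; rewrite /zero_ext; case: ifPn => [zl|_]; last by rewrite normr0 ltW.
  have zO : O z by [].
  have := h1 (@subset_closure _ O _ zO); rewrite ub; last exact: boundary_half_space.
  by rewrite sub0r normrN.
move=> /nbhs_ballP[d /= d0 hd]; exists (d / 2); first by rewrite divr_gt0.
move=> z bz hz; apply: (hd (d / 2)) => //.
rewrite -ball_normE /ball_/= sub0r normrN gtr0_norm ?divr_gt0//.
by rewrite ltr_pdivrMr// ltr_pMr// ltr1n.
Qed.

End half_space_facts.

Theorem theorem1p2 (R : realType) (N l : nat) (hN : (1 <= N)%N)
    (hl : (1 <= l)%N) (hNl : (3 <= N + l)%N) (gamma p : R)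
    (hgamma : 0 < gamma)
    (hp1 : 1 + 4 / hom_dim N l gamma <= p)
    (hp2 : p < (hom_dim N l gamma + 2) / (hom_dim N l gamma - 2))
    (u : 'rV[R]_N * 'rV[R]_l -> R)
    (hH : H12 gamma (half_space hl) u)
    (hC : {within closure (half_space hl), continuous u})
    (hu : positive_solution gamma p (half_space hl) u)
    (hb : [bounded u z | z in half_space hl]) :
  forall z, closure (half_space hl) z -> u z = 0.

Proof.
have hd0 : 0 < hom_dim N l gamma.
  by rewrite /hom_dim ltr_wpDr ?ltr0n// mulr_ge0// addr_ge0// ltW.
have p1 : 1 < p by apply: lt_le_trans hp1; rewrite ltrDl divr_gt0.
have p0 : p != 0 by rewrite gt_eqF// (lt_trans ltr01).
case: hH => /l2_zero_ext lU _.
case: hu => -[G [hGx hGy hDx hDy] hsol] upos ubd.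
pose i0 : 'I_N := Ordinal hN; pose j0 := last_index hl.
pose a := @weight R N l gamma.
pose U := zero_ext hl u.
pose g i := zero_ext hl (fun z => (G z).1 0 i).
pose k j := zero_ext hl (fun z => (G z).2 0 j).
have lg i : l2 (lebesgue_space R N l) (g i) by exact: l2_zero_ext.
have lk j : l2 (lebesgue_space R N l) (k j) by exact: l2_zero_ext.
have [M0 [_ hM0]] := hb.
have Mr : M0 < `|M0| + 1 by rewrite (le_lt_trans (ler_norm M0))// ltrDl.
pose M := `|M0| + 1.
have UM z : 0 <= U z <= M.
  rewrite /U /zero_ext; case: ifPn => [zl|_]; last by rewrite lexx addr_ge0.
  by rewrite (ltW (upos z zl)) (le_trans (ler_norm _))// (hM0 M Mr z zl).
have U0 (z : 'rV[R]_N * 'rV[R]_l) : z.2 0 j0 <= 0 -> U z = 0 by exact: zero_ext_out.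
have lf : l2 (lebesgue_space R N l) (fun z => U z `^ p).
  have [mU _] := lU.
  apply: (@l2_le _ _ _ _ _ (fun z => M `^ (p - 1) * U z)); last 2 first.
  - exact: l2Z.
  - move=> z; have /andP[Uz0 UzM] := UM z.
    rewrite normrM !ger0_norm ?powR_ge0// -[X in _ `^ X](subrK 1) -powR_succ//; last by rewrite subr_gt0.
    rewrite ler_wpM2r//; apply: ge0_ler_powR; rewrite ?nnegrE//; first by rewrite subr_ge0 ltW.
    exact: le_trans UzM.
  - by apply: (measurableT_comp (measurable_powR p) mU).
have ma : measurable_fun setT a := @measurable_weight R N l gamma.
have ba : x_bounded a := @weight_x_bounded R N l gamma hgamma.
have la := x_bounded_local ba.
have l1 : locally_bounded ((fun=> 1) : 'rV[R]_N * 'rV[R]_l -> R).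
  by move=> r; exists 1 => // z _; rewrite normr1.
have small := zero_ext_small hC ubd.
have dUx i : wder (fun=> 1) (ex R l i) U (g i).
  apply: (@wder_zero_extension _ _ _ j0) => //.
  - by rewrite mxE normr0.
  - by move=> z; exact: zero_ext_out.
  move=> phi tphi [t t0 ht].
  have := hDx phi (tfun_test tphi t0 ht) i; rewrite !Rint_half_space.
  rewrite (_ : zero_ext hl (fun z => u z * _) = fun z => U z * (1 * 'D_(ex R l i) phi z)); last first.
    apply/funext => z; rewrite /U /zero_ext; case: ifP => _; last by rewrite mul0r.
    by rewrite mxE mul1r.
  rewrite (_ : zero_ext hl (fun z => _ * phi z) = fun z => g i z * phi z)//.
  by apply/funext => z; rewrite /g /zero_ext; case: ifP => _; rewrite ?mul0r.
have dUy j : wder a (ey R N j) U (k j).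
  apply: (@wder_zero_extension _ _ _ j0) => //.
  - by rewrite mxE eqxx/=; case: (_ == _); rewrite ?normr1 ?normr0.
  - by move=> z; exact: zero_ext_out.
  move=> phi tphi [t t0 ht].
  have := hDy phi (tfun_test tphi t0 ht) j; rewrite !Rint_half_space.
  rewrite (_ : zero_ext hl (fun z => u z * _) = fun z => U z * (a z * 'D_(ey R N j) phi z)); last first.
    apply/funext => z; rewrite /U /zero_ext; case: ifP => _; last by rewrite mul0r.
    by rewrite mxE.
  rewrite (_ : zero_ext hl (fun z => _ * phi z) = fun z => k j z * phi z)//.
  by apply/funext => z; rewrite /k /zero_ext; case: ifP => _; rewrite ?mul0r.
have eqn (phi : 'rV[R]_N * 'rV[R]_l -> R) : tfun phi -> (exists2 t, 0 < t & forall z : 'rV[R]_N * 'rV[R]_l, z.2 0 j0 <= t -> phi z = 0) ->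
    \sum_i ip (lebesgue_space R N l) (g i) ('D_(ex R l i) phi) +
    \sum_j ip (lebesgue_space R N l) (k j) (fun z => a z * 'D_(ey R N j) phi z) =
    ip (lebesgue_space R N l) (fun z => U z `^ p) phi.
  move=> tphi [t t0 ht].
  have := hsol phi (tfun_test tphi t0 ht); rewrite !Rint_half_space.
  rewrite (_ : zero_ext hl (fun z => _ * phi z) = fun z => U z `^ p * phi z); last first.
    apply/funext => z; rewrite /U /zero_ext; case: ifP => _ //.
    by rewrite powR0// mul0r.
  rewrite (_ : zero_ext hl _ = fun z => \sum_i g i z * 'D_(ex R l i) phi z +
      \sum_j k j z * (a z * 'D_(ey R N j) phi z)); last first.
    apply/funext => z; rewrite /g /k /zero_ext; case: ifP => _; last first.
      by rewrite !big1 ?addr0// => i _; rewrite mul0r.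
    by rewrite /dot; apply: f_equal2; apply: eq_bigr => i _; rewrite mxE.
  have tx i := tfun_l2 (tfun_derive (ex R l i) tphi).
  have ty j := l2_weight ma la (tfun_derive (ey R N j) tphi).
  rewrite RintD; last 2 first.
  - by apply: integ_sum => i; exact: l2M.
  - by apply: integ_sum => j; exact: l2M.
  by rewrite !Rint_sum => [//|j|i]; exact: l2M.
have [C _ hCk] := strip_estimate (i0 := i0) ma ba (weight_x_unif N l hgamma) (@weight_y R N l gamma)
  (weight_lower l hgamma i0) lg lk lf p1 UM lU U0 (fun j z => @zero_ext_out _ _ _ _ _ z) dUx dUy eqn.
have f0 (z : 'rV[R]_N * 'rV[R]_l) : z.2 0 j0 <= 0 -> U z `^ p = 0 by move=> h; rewrite U0// powR0.
have full := extended_equation ma la lg lk lf (fun i z => @zero_ext_out _ _ _ _ _ z)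
  (fun j z => @zero_ext_out _ _ _ _ _ z) f0 hCk eqn.
exfalso; apply: (barrier_contradiction (j0 := j0) i0 hgamma lg lk lf lU _ U0 _ _ dUx dUy full).
- by move=> z; case/andP: (UM z).
- by move=> z; exact: powR_ge0.
- by move=> z zl; rewrite powR_gt0// /U /zero_ext zl; exact: upos.
Qed.
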